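(* Let $W$ be a c.e. theory that is $\tau$-$\mathsf{R}_{0\mathsf{p}}$-sourced for a translation $\tau$, and let $A$ be a finitely axiomatized theory. Then one can effectively find, from an index of $W$, a $\Sigma_1$-sentence $\lambda$ of $\mathbb{L}_{\sf a}$ such that the following are equivalent: (i) $\mathbb{N}\models\lambda$; (ii) $([\lambda]_{\sf p})^\tau\rhd A$; (iii) $W\rhd A$.
   Context: $\mathbb{L}_{\sf a}=\{0,\mathsf{S},+,\times,\leq\}$ with $\leq$ primitive; $x<y$ abbreviates $x\leq y\wedge x\neq y$; $\overline{n}$ numerals. $\mathbb{L}_{\sf ap}$ is $\mathbb{L}_{\sf a}$ plus a unary predicate $\mathsf{P}$; $\mathfrak{id}_{\sf ap}$ its identity axioms. $\mathsf{R}_0$ has axioms, for all $m,n$: $\overline{m}+\overline{n}=\overline{m+n}$; $\overline{m}\times\overline{n}=\overline{m\times n}$; $\overline{m}\neq\overline{n}$ if $m\neq n$; $\forall x(x\leq\overline{n}\to\bigvee_{i\leq n}x=\overline{i})$; $\overline{m}\leq\overline{n}$ if $m\leq n$. $\mathsf{R}_{0\mathsf{p}}$ is $\mathsf{R}_0$ plus $\mathsf{P}(\overline{n})$ for all $n$. Translations (domain formula, formulas for relation symbols incl. identity, function symbols via graphs, quantifiers relativized; possibly multidimensional with parameters) and interpretations: $V\rhd U$ iff there is a translation $\tau$ with $V\vdash\varphi^\tau$ for all theorems $\varphi$ of $U$. $W$ is $\tau$-$\mathsf{R}_{0\mathsf{p}}$-sourced iff $W$ is deductively equivalent to $(\mathsf{R}_{0\mathsf{p}}+\mathfrak{id}_{\sf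 ap})^\tau$. Pure $\Delta_0$-formulas: bounded formulas whose atomic $\leq$-formulas relate variables and whose equations have forms $x_0=x_1,0=x_0,\mathsf{S}x_0=x_1,x_0+x_1=x_2,x_0\times x_1=x_2$. For a $\Sigma_1$-sentence $\lambda$, $\lambda^\bullet=\exists x\,\lambda_0(x)$ ($\lambda_0$ pure $\Delta_0$) is an effectively found sentence with $\mathbb{N}\models\lambda\leftrightarrow\lambda^\bullet$ and $\lambda^\bullet\to\lambda$ valid, and $[\lambda]_{\sf p}:=\bigwedge\mathfrak{id}_{\sf ap}\wedge\exists v(\mathsf{cert}(v)\wedge\lambda_0(v)\wedge\forall x\leq v\,\mathsf{P}(x))$, where $\mathsf{cert}(v)$ is the conjunction of: $0\leq v$; $\forall x<v\;\mathsf{S}x\leq v$; $\forall x(x\leq0\leftrightarrow x=0)$; $\forall x<v\,\forall y(y\leq\mathsf{S}x\leftrightarrow(y\leq x\vee y=\mathsf{S}x))$; $\forall x,y,z\leq v\;\mathsf{S}((x\times y)+z)\neq0$; $\forall x,y,z,w\leq v(\mathsf{S}((x\times y)+z)=\mathsf{S}w\to(x\times y)+z=w)$; $\forall x,y\leq v\;(x\times y)+0=x\times y$; $\forall x,y,z\leq v\;(x\times y)+\mathsf{S}z=\mathsf{S}((x\times y)+z)$; $\forall x\leq v\;x\times0=0$; $\forall x,y\leq v\;x\times\mathsf{S}y=(x\times y)+x$. *)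

(* Defs.v *)
From Stdlib Require Import Arith List Bool Cantor.
Import ListNotations.

(* ------------------------------------------------------------------ *)
(** * First-order syntax with identity *)

(* A finite signature: function symbol [f] is the [f]-th entry of [fun_ar] and
   that entry is its arity; likewise for relation symbols. Identity is logical
   and is not listed. *)
Record signature := Signature { fun_ar : list nat; rel_ar : list nat }.

(* Raw de Bruijn syntax, shared by all signatures; [wf_tm] and [wf_form] select
   the expressions of a given signature. *)
Inductive tm : Type :=
| TVar (x : nat)
| TFun (f : nat) (ts : list tm).

Inductive form : Type :=
| FBot
| FEq (s t : tm)
| FRel (r : nat) (ts : list tm)
| FAnd (p q : form)
| FOr (p q : form)
| FImp (p q : form)
| FAll (p : form)
| FEx (p : form).

Definition FNot (p : form) := FImp p FBot.
Definition FTop := FNot FBot.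
Definition FIff (p q : form) := FAnd (FImp p q) (FImp q p).
Definition conj_list (l : list form) := fold_right FAnd FTop l.
Definition disj_list (l : list form) := fold_right FOr FBot l.
Definition foralls (n : nat) (p : form) := Nat.iter n FAll p.
Definition exs (n : nat) (p : form) := Nat.iter n FEx p.
Definition vars (a n : nat) : list tm := map TVar (seq a n).

Fixpoint subst_tm (s : nat -> tm) (t : tm) : tm :=
  match t with
  | TVar x => s x
  | TFun f ts => TFun f (map (subst_tm s) ts)
  end.

Definition shift_tm (n : nat) (t : tm) := subst_tm (fun x => TVar (x + n)) t.

Definition up (s : nat -> tm) (x : nat) : tm :=
  match x with 0 => TVar 0 | S y => shift_tm 1 (s y) end.

Fixpoint subst (s : nat -> tm) (p : form) : form :=
  match p with
  | FBot => FBot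
  | FEq t u => FEq (subst_tm s t) (subst_tm s u)
  | FRel r ts => FRel r (map (subst_tm s) ts)
  | FAnd p q => FAnd (subst s p) (subst s q)
  | FOr p q => FOr (subst s p) (subst s q)
  | FImp p q => FImp (subst s p) (subst s q)
  | FAll p => FAll (subst (up s) p)
  | FEx p => FEx (subst (up s) p)
  end.

Definition shift (p : form) := subst (fun x => TVar (S x)) p.

(* p[t/x_0], lowering the other free variables. *)
Definition inst1 (t : tm) (p : form) :=
  subst (fun x => match x with 0 => t | S y => TVar y end) p.

Definition has_arity (ar : list nat) (i n : nat) : bool :=
  match nth_error ar i with Some m => m =? n | None => false end.

Fixpoint wf_tm (sg : signature) (t : tm) : bool :=
  match t with
  | TVar _ => true
  | TFun f ts => has_arity (fun_ar sg) f (length ts) && forallb (wf_tm sg) ts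
  end.

Fixpoint wf_form (sg : signature) (p : form) : bool :=
  match p with
  | FBot => true
  | FEq s t => wf_tm sg s && wf_tm sg t
  | FRel r ts => has_arity (rel_ar sg) r (length ts) && forallb (wf_tm sg) ts
  | FAnd p q | FOr p q | FImp p q => wf_form sg p && wf_form sg q
  | FAll p | FEx p => wf_form sg p
  end.

(* All free variables are < k. *)
Fixpoint closed_tm (k : nat) (t : tm) : bool :=
  match t with
  | TVar x => x <? k
  | TFun _ ts => forallb (closed_tm k) ts
  end.

Fixpoint closed (k : nat) (p : form) : bool :=
  match p with
  | FBot => true
  | FEq s t => closed_tm k s && closed_tm k t
  | FRel _ ts => forallb (closed_tm k) ts
  | FAnd p q | FOr p q | FImp p q => closed k p && closed k q
  | FAll p | FEx p => closed (S k) p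
  end.

Definition formula_in (sg : signature) (k : nat) (p : form) : Prop :=
  wf_form sg p = true /\ closed k p = true.
Definition sentence (sg : signature) (p : form) : Prop := formula_in sg 0 p.

(* ------------------------------------------------------------------ *)
(** * Classical natural deduction with identity; theories *)

Inductive derives : list form -> form -> Prop :=
| d_ax G p : In p G -> derives G p
| d_raa G p : derives (FNot p :: G) FBot -> derives G p
| d_andI G p q : derives G p -> derives G q -> derives G (FAnd p q)
| d_andE1 G p q : derives G (FAnd p q) -> derives G p
| d_andE2 G p q : derives G (FAnd p q) -> derives G q
| d_orI1 G p q : derives G p -> derives G (FOr p q)
| d_orI2 G p q : derives G q -> derives G (FOr p q)
| d_orE G p q r : derives G (FOr p q) ->
    derives (p :: G) r -> derives (q :: G) r -> derives G r
| d_impI G p q : derives (p :: G) q -> derives G (FImp p q)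
| d_impE G p q : derives G (FImp p q) -> derives G p -> derives G q
| d_allI G p : derives (map shift G) p -> derives G (FAll p)
| d_allE G p t : derives G (FAll p) -> derives G (inst1 t p)
| d_exI G p t : derives G (inst1 t p) -> derives G (FEx p)
| d_exE G p q : derives G (FEx p) -> derives (p :: map shift G) (shift q) ->
    derives G q
| d_refl G t : derives G (FEq t t)
| d_eqE G s t p : derives G (FEq s t) -> derives G (inst1 s p) ->
    derives G (inst1 t p).

(* A theory is given by a signature and a set of axioms. *)
Record theory := Theory { th_sig : signature; th_ax : form -> Prop }.

Definition wf_theory (T : theory) : Prop :=
  forall p, th_ax T p -> sentence (th_sig T) p.

Definition proves (T : theory) (p : form) : Prop :=
  exists G, (forall q, In q G -> th_ax T q) /\ derives G p.

Definition ded_equiv (T U : theory) : Prop :=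
  th_sig T = th_sig U /\
  forall p, sentence (th_sig T) p -> (proves T p <-> proves U p).

Record fin_theory := FinTheory { fin_sig : signature; fin_ax : list form }.

Definition wf_fin_theory (A : fin_theory) : Prop :=
  forall p, In p (fin_ax A) -> sentence (fin_sig A) p.

Coercion theory_of_fin (A : fin_theory) : theory :=
  Theory (fin_sig A) (fun p => In p (fin_ax A)).

(* ------------------------------------------------------------------ *)
(** * Tarskian semantics *)

Record structure := Structure {
  dom : Type;
  ifun : nat -> list dom -> dom;
  irel : nat -> list dom -> Prop
}.

Fixpoint eval (M : structure) (rho : nat -> dom M) (t : tm) : dom M :=
  match t with
  | TVar x => rho x
  | TFun f ts => ifun M f (map (eval M rho) ts)
  end.

Definition scons {D : Type} (d : D) (rho : nat -> D) (x : nat) : D :=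
  match x with 0 => d | S y => rho y end.

Fixpoint sat (M : structure) (rho : nat -> dom M) (p : form) : Prop :=
  match p with
  | FBot => False
  | FEq s t => eval M rho s = eval M rho t
  | FRel r ts => irel M r (map (eval M rho) ts)
  | FAnd p q => sat M rho p /\ sat M rho q
  | FOr p q => sat M rho p \/ sat M rho q
  | FImp p q => sat M rho p -> sat M rho q
  | FAll p => forall d, sat M (scons d rho) p
  | FEx p => exists d, sat M (scons d rho) p
  end.

Definition valid (p : form) : Prop := forall M rho, sat M rho p.

(* ------------------------------------------------------------------ *)
(** * Translations and interpretations *)

(* An element of the source is a [tr_dim]-tuple of the target; there are
   [tr_npar] parameters, ranging over the parameter domain [tr_par]. With
   m = tr_dim, in the formula for an n-place notion the i-th tuple occupies the
   variables i*m, ..., i*m+m-1 and the parameters the variables from n*m on.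
   An n-ary function symbol is sent to its (n+1)-place graph, value last. *)
Record translation := Translation {
  tr_dim : nat;
  tr_npar : nat;
  tr_par : form;
  tr_dom : form;
  tr_eq : form;
  tr_fun : list form;
  tr_rel : list form
}.

Definition wf_translation (src tgt : signature) (T : translation) : Prop :=
  let ok n p := formula_in tgt (n * tr_dim T + tr_npar T) p in
  1 <= tr_dim T /\ ok 0 (tr_par T) /\ ok 1 (tr_dom T) /\ ok 2 (tr_eq T) /\
  Forall2 (fun n p => ok (S n) p) (fun_ar src) (tr_fun T) /\
  Forall2 (fun n p => ok n p) (rel_ar src) (tr_rel T).

(* Unwinding of terms: every formula is first rewritten so that its atoms are
   x = y, f(x_1,...,x_n) = y and R(x_1,...,x_n) with variables x_i, y. *)

Definition is_var (t : tm) : bool :=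
  match t with TVar _ => true | TFun _ _ => false end.

(* [unw_eq s t y] says that [t], with its variables raised by [s], equals the
   variable [y]. *)
Fixpoint unw_eq (s : nat) (t : tm) (y : nat) {struct t} : form :=
  match t with
  | TVar x => FEq (TVar (x + s)) (TVar y)
  | TFun f ts =>
      if forallb is_var ts then FEq (TFun f (map (shift_tm s) ts)) (TVar y)
      else
        let n := length ts in
        let fix args (i : nat) (us : list tm) : list form :=
          match us with
          | [] => []
          | u :: us => unw_eq (s + n) u i :: args (S i) us
          end in
        exs n (FAnd (conj_list (args 0 ts))
                    (FEq (TFun f (vars 0 n)) (TVar (y + n))))
  end.

Definition unw_rel (r : nat) (ts : list tm) : form :=
  if forallb is_var ts then FRel r ts
  else
    let n := length ts in
    exs n (FAnd (conj_list (map (fun iu => unw_eq n (snd iu) (fst iu))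
                                (combine (seq 0 n) ts)))
                (FRel r (vars 0 n))).

Definition unw_id (t u : tm) : form :=
  match u with
  | TVar y => unw_eq 0 t y
  | TFun _ _ => FEx (FAnd (unw_eq 1 t 0) (unw_eq 1 u 0))
  end.

Fixpoint unwind (p : form) : form :=
  match p with
  | FBot => FBot
  | FEq t u => unw_id t u
  | FRel r ts => unw_rel r ts
  | FAnd p q => FAnd (unwind p) (unwind q)
  | FOr p q => FOr (unwind p) (unwind q)
  | FImp p q => FImp (unwind p) (unwind q)
  | FAll p => FAll (unwind p)
  | FEx p => FEx (unwind p)
  end.

Definition var_of (t : tm) : nat :=
  match t with TVar x => x | TFun _ _ => 0 end.

(* [tr_inst T k p xs]: the component [p] of [T] applied to the source variables
   [xs] in a scope of [k] source variables. There the source variable x is the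
   tuple x*m, ..., x*m+m-1 and the parameters start at k*m. *)
Definition tr_inst (T : translation) (k : nat) (p : form) (xs : list nat) : form :=
  let m := tr_dim T in
  let n := length xs in
  subst (fun v => if v <? n * m
                  then TVar (nth (v / m) xs 0 * m + v mod m)
                  else TVar (k * m + (v - n * m))) p.

(* Meant for unwound formulas. *)
Fixpoint tr_unwound (T : translation) (k : nat) (p : form) : form :=
  match p with
  | FBot => FBot
  | FEq (TVar x) u => tr_inst T k (tr_eq T) [x; var_of u]
  | FEq (TFun f ts) u =>
      tr_inst T k (nth f (tr_fun T) FBot) (map var_of ts ++ [var_of u])
  | FRel r ts => tr_inst T k (nth r (tr_rel T) FBot) (map var_of ts)
  | FAnd p q => FAnd (tr_unwound T k p) (tr_unwound T k q)
  | FOr p q => FOr (tr_unwound T k p) (tr_unwound T k q)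
  | FImp p q => FImp (tr_unwound T k p) (tr_unwound T k q)
  | FAll p => foralls (tr_dim T)
      (FImp (tr_inst T (S k) (tr_dom T) [0]) (tr_unwound T (S k) p))
  | FEx p => exs (tr_dim T)
      (FAnd (tr_inst T (S k) (tr_dom T) [0]) (tr_unwound T (S k) p))
  end.

(* p^T for a sentence p. The parameter domain alpha is closed off in the usual
   way: V proves p^T iff it proves both that alpha is non-empty and
   forall z (alpha(z) -> p^{T,z}). Without parameters and with alpha = FTop this
   is the plain translation up to a trivial conjunct. *)
Definition translate (T : translation) (p : form) : form :=
  FAnd (exs (tr_npar T) (tr_par T))
       (foralls (tr_npar T) (FImp (tr_par T) (tr_unwound T 0 (unwind p)))).

Definition interprets (V U : theory) : Prop :=
  exists T, wf_translation (th_sig U) (th_sig V) T /\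
    forall p, sentence (th_sig U) p -> proves U p -> proves V (translate T p).

(* ------------------------------------------------------------------ *)
(** * Identity axioms of a signature *)

(* Function symbols are translated through their graphs, so their identity
   axioms are stated for graphs: totality, functionality and congruence. *)

Definition eqs (a b n : nat) : form :=
  conj_list (map (fun i => FEq (TVar (a + i)) (TVar (b + i))) (seq 0 n)).

Definition id_refl : form := FAll (FEq (TVar 0) (TVar 0)).
Definition id_sym : form :=
  foralls 2 (FImp (FEq (TVar 1) (TVar 0)) (FEq (TVar 0) (TVar 1))).
Definition id_trans : form :=
  foralls 3 (FImp (FAnd (FEq (TVar 2) (TVar 1)) (FEq (TVar 1) (TVar 0)))
                  (FEq (TVar 2) (TVar 0))).

Definition id_rel (r n : nat) : form :=
  foralls (n + n) (FImp (FAnd (eqs 0 n n) (FRel r (vars 0 n))) (FRel r (vars n n))).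

Definition id_fun_total (f n : nat) : form :=
  foralls n (FEx (FEq (TFun f (vars 1 n)) (TVar 0))).
Definition id_fun_unique (f n : nat) : form :=
  foralls (2 + n) (FImp (FAnd (FEq (TFun f (vars 2 n)) (TVar 0))
                              (FEq (TFun f (vars 2 n)) (TVar 1)))
                        (FEq (TVar 0) (TVar 1))).
Definition id_fun_congr (f n : nat) : form :=
  foralls (2 + (n + n))
    (FImp (FAnd (eqs 2 (2 + n) n)
                (FAnd (FEq (TVar 0) (TVar 1)) (FEq (TFun f (vars 2 n)) (TVar 0))))
          (FEq (TFun f (vars (2 + n) n)) (TVar 1))).

Definition with_index (l : list nat) : list (nat * nat) :=
  combine (seq 0 (length l)) l.

Definition id_axioms (sg : signature) : list form :=
  [id_refl; id_sym; id_trans]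
  ++ map (fun rn => id_rel (fst rn) (snd rn)) (with_index (rel_ar sg))
  ++ flat_map (fun fn => [id_fun_total (fst fn) (snd fn);
                          id_fun_unique (fst fn) (snd fn);
                          id_fun_congr (fst fn) (snd fn)]) (with_index (fun_ar sg)).

(* ------------------------------------------------------------------ *)
(** * Arithmetic *)

Definition sig_a : signature := Signature [0; 1; 2; 2] [2].
Definition sig_ap : signature := Signature [0; 1; 2; 2] [2; 1].

Definition tzero : tm := TFun 0 [].
Definition tsucc (t : tm) : tm := TFun 1 [t].
Definition tadd (s t : tm) : tm := TFun 2 [s; t].
Definition tmul (s t : tm) : tm := TFun 3 [s; t].
Definition fle (s t : tm) : form := FRel 0 [s; t].
Definition fP (t : tm) : form := FRel 1 [t].
Definition flt (s t : tm) : form := FAnd (fle s t) (FNot (FEq s t)).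
Definition num (n : nat) : tm := Nat.iter n tsucc tzero.

(* The bound [t] lives outside the quantifier. *)
Definition all_le (t : tm) (p : form) := FAll (FImp (fle (TVar 0) (shift_tm 1 t)) p).
Definition ex_le (t : tm) (p : form) := FEx (FAnd (fle (TVar 0) (shift_tm 1 t)) p).
Definition all_lt (t : tm) (p : form) := FAll (FImp (flt (TVar 0) (shift_tm 1 t)) p).

(* The interpretation of P is irrelevant: only formulas over [sig_a] are
   evaluated in this structure. *)
Definition nat_structure : structure := Structure nat
  (fun f xs => match f, xs with
               | 1, [x] => S x
               | 2, [x; y] => x + y
               | 3, [x; y] => x * y
               | _, _ => 0
               end)
  (fun r xs => match r, xs with
               | 0, [x; y] => x <= y
               | _, _ => False
               end).

Definition true_in_N (p : form) : Prop := sat nat_structure (fun _ => 0) p.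

Inductive R0p_axiom : form -> Prop :=
| R0_add m n : R0p_axiom (FEq (tadd (num m) (num n)) (num (m + n)))
| R0_mul m n : R0p_axiom (FEq (tmul (num m) (num n)) (num (m * n)))
| R0_neq m n : m <> n -> R0p_axiom (FNot (FEq (num m) (num n)))
| R0_bound n : R0p_axiom
    (FAll (FImp (fle (TVar 0) (num n))
                (disj_list (map (fun i => FEq (TVar 0) (num i)) (seq 0 (S n))))))
| R0_le m n : m <= n -> R0p_axiom (fle (num m) (num n))
| R0p_P n : R0p_axiom (fP (num n)).

(* W is deductively equivalent to (R_0p + id_ap)^T. *)
Definition R0p_sourced (T : translation) (W : theory) : Prop :=
  wf_translation sig_ap (th_sig W) T /\
  ded_equiv W (Theory (th_sig W)
    (fun q => exists p, (R0p_axiom p \/ In p (id_axioms sig_ap)) /\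
                        q = translate T p)).

Inductive delta0 : form -> Prop :=
| D0_bot : delta0 FBot
| D0_eq s t : delta0 (FEq s t)
| D0_le s t : delta0 (fle s t)
| D0_and p q : delta0 p -> delta0 q -> delta0 (FAnd p q)
| D0_or p q : delta0 p -> delta0 q -> delta0 (FOr p q)
| D0_imp p q : delta0 p -> delta0 q -> delta0 (FImp p q)
| D0_all t p : delta0 p -> delta0 (all_le t p)
| D0_ex t p : delta0 p -> delta0 (ex_le t p).

Inductive sigma1 : form -> Prop :=
| S1_delta0 p : delta0 p -> sigma1 p
| S1_ex p : sigma1 p -> sigma1 (FEx p).

Definition sigma1_sentence (p : form) : Prop := sentence sig_a p /\ sigma1 p.

Inductive pure_delta0 : form -> Prop :=
| P0_bot : pure_delta0 FBot
| P0_eq x y : pure_delta0 (FEq (TVar x) (TVar y))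
| P0_zero x : pure_delta0 (FEq tzero (TVar x))
| P0_succ x y : pure_delta0 (FEq (tsucc (TVar x)) (TVar y))
| P0_add x y z : pure_delta0 (FEq (tadd (TVar x) (TVar y)) (TVar z))
| P0_mul x y z : pure_delta0 (FEq (tmul (TVar x) (TVar y)) (TVar z))
| P0_le x y : pure_delta0 (fle (TVar x) (TVar y))
| P0_and p q : pure_delta0 p -> pure_delta0 q -> pure_delta0 (FAnd p q)
| P0_or p q : pure_delta0 p -> pure_delta0 q -> pure_delta0 (FOr p q)
| P0_imp p q : pure_delta0 p -> pure_delta0 q -> pure_delta0 (FImp p q)
| P0_all y p : pure_delta0 p -> pure_delta0 (all_le (TVar y) p)
| P0_ex y p : pure_delta0 p -> pure_delta0 (ex_le (TVar y) p).

(* cert(v), with v the variable 0. *)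
Definition cert : form :=
  let x i := TVar i in
  let prodsum a b c := tadd (tmul a b) c in
  conj_list
  [ fle tzero (x 0);
    all_lt (x 0) (fle (tsucc (x 0)) (x 1));
    FAll (FIff (fle (x 0) tzero) (FEq (x 0) tzero));
    all_lt (x 0) (FAll (FIff (fle (x 0) (tsucc (x 1)))
                             (FOr (fle (x 0) (x 1)) (FEq (x 0) (tsucc (x 1))))));
    all_le (x 0) (all_le (x 1) (all_le (x 2)
      (FNot (FEq (tsucc (prodsum (x 2) (x 1) (x 0))) tzero))));
    all_le (x 0) (all_le (x 1) (all_le (x 2) (all_le (x 3)
      (FImp (FEq (tsucc (prodsum (x 3) (x 2) (x 1))) (tsucc (x 0)))
            (FEq (prodsum (x 3) (x 2) (x 1)) (x 0))))));
    all_le (x 0) (all_le (x 1)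
      (FEq (prodsum (x 1) (x 0) tzero) (tmul (x 1) (x 0))));
    all_le (x 0) (all_le (x 1) (all_le (x 2)
      (FEq (prodsum (x 2) (x 1) (tsucc (x 0)))
           (tsucc (prodsum (x 2) (x 1) (x 0))))));
    all_le (x 0) (FEq (tmul (x 0) tzero) tzero);
    all_le (x 0) (all_le (x 1)
      (FEq (tmul (x 1) (tsucc (x 0))) (prodsum (x 1) (x 0) (x 1)))) ].

(* [lambda]_p, where [m] is the matrix lambda_0 of lambda^bullet, with free
   variable 0. *)
Definition certified_p (m : form) : form :=
  FAnd (conj_list (id_axioms sig_ap))
       (FEx (FAnd cert (FAnd m (all_le (TVar 0) (fP (TVar 0)))))).

(* ------------------------------------------------------------------ *)
(** * Partial recursive functions *)

Definition cpair (a b : nat) : nat := Cantor.to_nat (a, b).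

(* Unary partial recursive functions, several arguments being passed through
   the Cantor pairing, which is a bijection. *)
Inductive code : Type :=
| CZero
| CSucc
| CFst
| CSnd
| CPair (c d : code)
| CComp (c d : code)
| CPrec (c d : code)
| CMin (c : code).

Inductive computes : code -> nat -> nat -> Prop :=
| ev_zero n : computes CZero n 0
| ev_succ n : computes CSucc n (S n)
| ev_fst a b : computes CFst (cpair a b) a
| ev_snd a b : computes CSnd (cpair a b) b
| ev_pair c d n a b : computes c n a -> computes d n b ->
    computes (CPair c d) n (cpair a b)
| ev_comp c d n m k : computes d n m -> computes c m k -> computes (CComp c d) n k
| ev_prec0 c d a r : computes c a r -> computes (CPrec c d) (cpair a 0) r
| ev_precS c d a n i r : computes (CPrec c d) (cpair a n) i ->
    computes d (cpair a (cpair n i)) r -> computes (CPrec c d) (cpair a (S n)) r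
| ev_min c a n : computes c (cpair a n) 0 ->
    (forall m, m < n -> exists k, computes c (cpair a m) (S k)) ->
    computes (CMin c) a n.

(** Gödel numberings *)

Fixpoint gn_list (l : list nat) : nat :=
  match l with [] => 0 | a :: l => S (cpair a (gn_list l)) end.

Fixpoint gn_tm (t : tm) : nat :=
  match t with
  | TVar x => cpair 0 x
  | TFun f ts => cpair 1 (cpair f (gn_list (map gn_tm ts)))
  end.

Fixpoint gn_form (p : form) : nat :=
  match p with
  | FBot => cpair 0 0
  | FEq s t => cpair 1 (cpair (gn_tm s) (gn_tm t))
  | FRel r ts => cpair 2 (cpair r (gn_list (map gn_tm ts)))
  | FAnd p q => cpair 3 (cpair (gn_form p) (gn_form q))
  | FOr p q => cpair 4 (cpair (gn_form p) (gn_form q))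
  | FImp p q => cpair 5 (cpair (gn_form p) (gn_form q))
  | FAll p => cpair 6 (gn_form p)
  | FEx p => cpair 7 (gn_form p)
  end.

Definition gn_sig (sg : signature) : nat :=
  cpair (gn_list (fun_ar sg)) (gn_list (rel_ar sg)).

Definition gn_fin_theory (A : fin_theory) : nat :=
  cpair (gn_sig (fin_sig A)) (gn_list (map gn_form (fin_ax A))).

Definition gn_translation (T : translation) : nat :=
  gn_list [tr_dim T; tr_npar T; gn_form (tr_par T); gn_form (tr_dom T);
           gn_form (tr_eq T); gn_list (map gn_form (tr_fun T));
           gn_list (map gn_form (tr_rel T))].

Fixpoint gn_code (c : code) : nat :=
  match c with
  | CZero => cpair 0 0
  | CSucc => cpair 1 0
  | CFst => cpair 2 0
  | CSnd => cpair 3 0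
  | CPair c d => cpair 4 (cpair (gn_code c) (gn_code d))
  | CComp c d => cpair 5 (cpair (gn_code c) (gn_code d))
  | CPrec c d => cpair 6 (cpair (gn_code c) (gn_code d))
  | CMin c => cpair 7 (gn_code c)
  end.

(* An index of a c.e. theory: its signature together with a program whose
   halting set is the set of its axioms. *)
Definition ce_index (i : nat) (W : theory) : Prop :=
  exists e : code,
    i = cpair (gn_sig (th_sig W)) (gn_code e) /\
    forall p, th_ax W p <-> exists n, computes e (gn_form p) n.

(* [lam0] sends a Sigma_1-sentence lambda to the matrix lambda_0 of
   lambda^bullet = exists x, lambda_0(x). *)
Definition bullet_matrix (lam0 : form -> form) : Prop :=
  (exists c : code, forall lam, sigma1_sentence lam ->
     computes c (gn_form lam) (gn_form (lam0 lam))) /\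
  forall lam, sigma1_sentence lam ->
    pure_delta0 (lam0 lam) /\
    closed 1 (lam0 lam) = true /\
    (true_in_N lam <-> true_in_N (FEx (lam0 lam))) /\
    valid (FImp (FEx (lam0 lam)) lam).

(* Main.v *)
(* The sentence lambda is a fixed point: it says of itself that the translated
   certified sentence ([lambda]_p)^tau interprets A.  This can be said by a
   Sigma_1-sentence, because A is finitely axiomatized: a translation T is an
   interpretation of A as soon as the T-images of the axioms of A, of the
   identity axioms, and of the non-emptiness of the domain are derivable.

   If lambda is true, then R_0p proves [lambda]_p, so W proves its translation
   and inherits the interpretation of A.  If lambda is false, then in any model
   of [lambda]_p the certified witness v lies above all numerals: were v the
   numeral n, the pure Delta_0-matrix would be absolute below v and n would
   witness lambda in N.  Hence [lambda]_p proves R_0p, its translation proves W,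
   and W |> A would give (ii) and so lambda.

   Provability is handled semantically, through a completeness theorem for
   structures in which identity is interpreted by a congruence.  For these, a
   translation turns a model into an internal model without taking quotients.

   Sigma_1-definability is obtained from Horn programs: every predicate that is
   inductively defined by Horn clauses over numbers is Sigma_1, its derivations
   being ranked finite sets of facts coded by divisibility. *)

(* No general fixed-point lemma is used. One bounded formula [psi] is fixed, with a variable for a
   number z that codes the Gödel number of [psi] together with the given data. Reading z, the Horn
   program rebuilds the code of lambda itself, runs the given program for [lam0] on it to obtain the
   matrix, and only then looks for an interpretation. So [psi] depends on the program for [lam0]
   alone, and lambda is found from the data by pairing and forming one numeral.

   On the logical side the obstacle is that a translation only offers formulas for identity and for
   graphs, and acts on unwound formulas. An internal model is therefore relational at first and
   becomes a structure, by choice, once the identity axioms are known to hold in it; this is what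
   the identity conjunct of [lambda]_p achieves. On the computational side unwinding is never
   programmed: the evidence for an axiom of A contains some flat sentence and a derivation of its
   equivalence with the axiom. *)
From Stdlib Require Import Arith List Bool Lia Cantor Factorial.
From Stdlib Require Import Classical ClassicalEpsilon FunctionalExtensionality.
From Stdlib Require Import Setoid Morphisms.
Require Import Defs.
Import ListNotations.

Local Arguments Nat.ltb : simpl never.
Local Arguments Nat.div : simpl never.
Local Arguments Nat.modulo : simpl never.
Local Arguments cpair : simpl never.

(** * Substitution *)

(** The generated induction principle gives no hypothesis for the members of an argument list. *)
Lemma tm_nested_ind (P : tm -> Prop) :
  (forall x, P (TVar x)) -> (forall f ts, Forall P ts -> P (TFun f ts)) -> forall t, P t.
Proof.
  intros Hv Hf. fix IH 1. intros [x|f ts]; [apply Hv|].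
  apply Hf. induction ts; constructor; auto.
Qed.

Lemma map_ext_Forall_in {A B} (f g : A -> B) l :
  Forall (fun x => f x = g x) l -> map f l = map g l.
Proof. induction 1; cbn; congruence. Qed.

Lemma subst_tm_comp s1 s2 t :
  subst_tm s2 (subst_tm s1 t) = subst_tm (fun x => subst_tm s2 (s1 x)) t.
Proof.
  induction t as [x|f ts IH] using tm_nested_ind; cbn; auto.
  f_equal. rewrite map_map. apply map_ext_Forall_in, IH.
Qed.

Lemma subst_tm_id t : subst_tm TVar t = t.
Proof.
  induction t as [x|f ts IH] using tm_nested_ind; cbn; auto.
  f_equal. rewrite (map_ext_Forall_in _ (fun x => x)); auto using map_id.
Qed.

Lemma up_comp s1 s2 :
  (fun x => subst_tm (up s2) (up s1 x)) = up (fun x => subst_tm s2 (s1 x)).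
Proof.
  extensionality x. destruct x as [|x]; cbn; auto.
  unfold shift_tm. rewrite !subst_tm_comp. f_equal. extensionality y.
  cbn. rewrite Nat.add_1_r. reflexivity.
Qed.

Lemma up_id : up TVar = TVar.
Proof. extensionality x. destruct x; cbn; auto. now rewrite Nat.add_1_r. Qed.

Lemma subst_comp p : forall s1 s2,
  subst s2 (subst s1 p) = subst (fun x => subst_tm s2 (s1 x)) p.
Proof.
  induction p; intros s1 s2; cbn;
    rewrite ?subst_tm_comp, ?map_map, ?IHp1, ?IHp2, ?IHp, ?up_comp; auto.
  f_equal. apply map_ext. intros; apply subst_tm_comp.
Qed.

Lemma subst_id p : subst TVar p = p.
Proof.
  induction p; cbn; rewrite ?up_id, ?subst_tm_id; try congruence.
  f_equal. rewrite <- (map_id ts) at 2. apply map_ext, subst_tm_id.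
Qed.

Lemma subst_inst1 s t p :
  subst s (inst1 t p) = inst1 (subst_tm s t) (subst (up s) p).
Proof.
  unfold inst1. rewrite !subst_comp. f_equal. extensionality x.
  destruct x as [|x]; cbn; auto.
  unfold shift_tm. rewrite subst_tm_comp.
  rewrite <- (subst_tm_id (s x)) at 1. f_equal.
  extensionality y. rewrite Nat.add_1_r. reflexivity.
Qed.

Lemma subst_shift s p : subst (up s) (shift p) = shift (subst s p).
Proof.
  unfold shift. rewrite !subst_comp. f_equal. extensionality x. cbn.
  unfold shift_tm. f_equal. extensionality y. now rewrite Nat.add_1_r.
Qed.

Lemma inst1_shift_tm t u :
  subst_tm (fun x => match x with 0 => t | S y => TVar y end) (shift_tm 1 u) = u.
Proof.
  unfold shift_tm. rewrite subst_tm_comp. rewrite <- (subst_tm_id u) at 2.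
  f_equal. extensionality x. now rewrite Nat.add_1_r.
Qed.

(** Splits a simultaneous substitution into a lift and an instance of variable 0, the form in which
    the quantifier cases of the truth lemma need it. *)
Lemma subst_scons t s p :
  subst (fun x => match x with 0 => t | S y => s y end) p = inst1 t (subst (up s) p).
Proof.
  unfold inst1. rewrite subst_comp. f_equal. extensionality x.
  destruct x; cbn; auto. now rewrite inst1_shift_tm.
Qed.

(** The generic instance: the eigenvariable 0 is fed to a formula shifted below its binder. It
    yields an existential from a counterexample in [omega_all]. *)
Lemma inst1_up_shift p : inst1 (TVar 0) (subst (up (fun x => TVar (S x))) p) = p.
Proof.
  rewrite <- subst_scons. rewrite <- (subst_id p) at 2. f_equal.
  extensionality x. now destruct x.
Qed.

Lemma forallb_imp {A} (f g : A -> bool) l :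
  Forall (fun x => f x = true -> g x = true) l -> forallb f l = true -> forallb g l = true.
Proof.
  induction 1; cbn; auto. rewrite !andb_true_iff. intuition.
Qed.

Lemma closed_tm_mono k k' t : k <= k' -> closed_tm k t = true -> closed_tm k' t = true.
Proof.
  intros Hk. induction t as [x|f ts IH] using tm_nested_ind; cbn.
  - rewrite !Nat.ltb_lt. lia.
  - now apply forallb_imp.
Qed.

Lemma closed_mono p : forall k k', k <= k' -> closed k p = true -> closed k' p = true.
Proof.
  induction p; intros k k' Hk; cbn; rewrite ?andb_true_iff; auto.
  - intros []; split; eapply closed_tm_mono; eauto.
  - apply forallb_imp, Forall_forall. intros x _. now apply closed_tm_mono.
  - intros []; split; eauto.
  - intros []; split; eauto.
  - intros []; split; eauto.
  - apply IHp. lia.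
  - apply IHp. lia.
Qed.

Lemma subst_tm_closed k s s' t : closed_tm k t = true ->
  (forall x, x < k -> s x = s' x) -> subst_tm s t = subst_tm s' t.
Proof.
  intros Hc Hs. induction t as [x|f ts IH] using tm_nested_ind; cbn in *.
  - apply Hs. now apply Nat.ltb_lt.
  - f_equal. apply map_ext_Forall_in. rewrite forallb_forall in Hc.
    rewrite Forall_forall in *. auto.
Qed.

Lemma subst_closed p : forall k s s', closed k p = true ->
  (forall x, x < k -> s x = s' x) -> subst s p = subst s' p.
Proof.
  induction p; intros k s' s'' Hc Hs; cbn in *; rewrite ?andb_true_iff in Hc; auto.
  - destruct Hc. f_equal; eapply subst_tm_closed; eauto.
  - f_equal. apply map_ext_in. intros t Ht. rewrite forallb_forall in Hc.
    eapply subst_tm_closed; eauto.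
  - destruct Hc. f_equal; eauto.
  - destruct Hc. f_equal; eauto.
  - destruct Hc. f_equal; eauto.
  - f_equal. eapply IHp; eauto. intros [|x] Hx; cbn; auto. rewrite Hs; auto; lia.
  - f_equal. eapply IHp; eauto. intros [|x] Hx; cbn; auto. rewrite Hs; auto; lia.
Qed.

Lemma closed_subst_tm k n s t : closed_tm n t = true ->
  (forall x, x < n -> closed_tm k (s x) = true) -> closed_tm k (subst_tm s t) = true.
Proof.
  intros Hc Hs. induction t as [x|f ts IH] using tm_nested_ind; cbn in *.
  - apply Hs. now apply Nat.ltb_lt.
  - rewrite forallb_forall in *. intros u Hu. apply in_map_iff in Hu as (t & <- & Ht).
    rewrite Forall_forall in IH. auto.
Qed.

Lemma closed_shift_tm k n t : closed_tm k t = true -> closed_tm (k + n) (shift_tm n t) = true.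
Proof.
  intros H. eapply closed_subst_tm; eauto. intros x Hx. cbn. apply Nat.ltb_lt. lia.
Qed.

Lemma closed_subst p : forall n k s, closed n p = true ->
  (forall x, x < n -> closed_tm k (s x) = true) -> closed k (subst s p) = true.
Proof.
  assert (Hup : forall n k s, (forall x, x < n -> closed_tm k (s x) = true) ->
    forall x, x < S n -> closed_tm (S k) (up s x) = true).
  { intros n k s Hs [|x] Hx; cbn; auto. rewrite <- (Nat.add_1_r k).
    apply closed_shift_tm, Hs. lia. }
  induction p; intros n k s' Hc Hs; cbn in *; rewrite ?andb_true_iff in *; auto.
  - destruct Hc; split; eapply closed_subst_tm; eauto.
  - rewrite forallb_forall in *. intros u Hu. apply in_map_iff in Hu as (t & <- & Ht).
    eapply closed_subst_tm; eauto.
  - destruct Hc; split; eauto.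
  - destruct Hc; split; eauto.
  - destruct Hc; split; eauto.
  - eapply IHp; eauto.
  - eapply IHp; eauto.
Qed.

Lemma wf_subst_tm sg s t : (forall x, wf_tm sg (s x) = true) ->
  wf_tm sg t = true -> wf_tm sg (subst_tm s t) = true.
Proof.
  intros Hs. induction t as [x|f ts IH] using tm_nested_ind; cbn; auto.
  rewrite length_map, !andb_true_iff. intros [H1 H2]; split; auto.
  rewrite forallb_forall in *. intros u Hu. apply in_map_iff in Hu as (t & <- & Ht).
  rewrite Forall_forall in IH. auto.
Qed.

Lemma wf_subst sg p : forall s, (forall x, wf_tm sg (s x) = true) ->
  wf_form sg p = true -> wf_form sg (subst s p) = true.
Proof.
  assert (Hup : forall s, (forall x, wf_tm sg (s x) = true) ->
    forall x, wf_tm sg (up s x) = true).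
  { intros s Hs [|x]; cbn; auto. apply wf_subst_tm; auto. }
  induction p; intros s' Hs Hc; cbn in *; rewrite ?andb_true_iff in *; auto.
  - destruct Hc; split; apply wf_subst_tm; auto.
  - rewrite length_map. destruct Hc as [? Hc]; split; auto.
    rewrite forallb_forall in *. intros u Hu. apply in_map_iff in Hu as (t & <- & Ht).
    apply wf_subst_tm; auto.
  - destruct Hc; split; auto.
  - destruct Hc; split; auto.
  - destruct Hc; split; auto.
Qed.

(** * Structures with an explicit congruence in place of identity *)

Section Sat.
Variable (M : structure) (E : dom M -> dom M -> Prop).

Fixpoint satE (rho : nat -> dom M) (p : form) : Prop :=
  match p with
  | FBot => False
  | FEq s t => E (eval M rho s) (eval M rho t)
  | FRel r ts => irel M r (map (eval M rho) ts)
  | FAnd p q => satE rho p /\ satE rho q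
  | FOr p q => satE rho p \/ satE rho q
  | FImp p q => satE rho p -> satE rho q
  | FAll p => forall d, satE (scons d rho) p
  | FEx p => exists d, satE (scons d rho) p
  end.

Record congruence : Prop := {
  cg_refl : forall x, E x x;
  cg_sym : forall x y, E x y -> E y x;
  cg_trans : forall x y z, E x y -> E y z -> E x z;
  cg_fun : forall f xs ys, Forall2 E xs ys -> E (ifun M f xs) (ifun M f ys);
  cg_rel : forall r xs ys, Forall2 E xs ys -> irel M r xs -> irel M r ys
}.

Lemma eval_subst rho s t :
  eval M rho (subst_tm s t) = eval M (fun x => eval M rho (s x)) t.
Proof.
  induction t as [x|f ts IH] using tm_nested_ind; cbn; auto.
  f_equal. rewrite map_map. apply map_ext_Forall_in, IH.
Qed.

Lemma eval_up d rho s :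
  (fun x => eval M (scons d rho) (up s x)) = scons d (fun x => eval M rho (s x)).
Proof.
  extensionality x. destruct x as [|x]; cbn; auto. unfold shift_tm.
  rewrite eval_subst. f_equal. extensionality y. cbn. now rewrite Nat.add_1_r.
Qed.

Lemma satE_subst p : forall rho s,
  satE rho (subst s p) <-> satE (fun x => eval M rho (s x)) p.
Proof.
  induction p; intros rho s'; cbn; rewrite ?eval_subst; try tauto.
  - rewrite map_map. erewrite map_ext; [reflexivity|]. intros; apply eval_subst.
  - now rewrite IHp1, IHp2.
  - now rewrite IHp1, IHp2.
  - now rewrite IHp1, IHp2.
  - split; intros H d; specialize (H d); rewrite IHp, eval_up in *; auto.
  - split; intros [d H]; exists d; rewrite IHp, eval_up in *; auto.
Qed.

Lemma satE_shift rho d p : satE (scons d rho) (shift p) <-> satE rho p.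
Proof. unfold shift. rewrite satE_subst. reflexivity. Qed.

Lemma satE_inst1 rho t p : satE rho (inst1 t p) <-> satE (scons (eval M rho t) rho) p.
Proof.
  unfold inst1. rewrite satE_subst.
  replace (fun x => _) with (scons (eval M rho t) rho); [reflexivity|].
  extensionality x. now destruct x.
Qed.

Lemma eval_closed k rho rho' t : closed_tm k t = true ->
  (forall x, x < k -> rho x = rho' x) -> eval M rho t = eval M rho' t.
Proof.
  intros Hc Hs. induction t as [x|f ts IH] using tm_nested_ind; cbn in *.
  - apply Hs. now apply Nat.ltb_lt.
  - f_equal. apply map_ext_Forall_in. rewrite forallb_forall in Hc.
    rewrite Forall_forall in *. auto.
Qed.

Lemma satE_closed p : forall k rho rho', closed k p = true ->
  (forall x, x < k -> rho x = rho' x) -> satE rho p <-> satE rho' p.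
Proof.
  induction p; intros k rho rho' Hc Hs; cbn in *; rewrite ?andb_true_iff in Hc; try tauto.
  - destruct Hc. rewrite (eval_closed k rho rho' s), (eval_closed k rho rho' t); tauto.
  - erewrite map_ext_in; [reflexivity|]. intros t Ht. rewrite forallb_forall in Hc.
    eapply eval_closed; eauto.
  - destruct Hc. erewrite IHp1, IHp2; eauto; tauto.
  - destruct Hc. erewrite IHp1, IHp2; eauto; tauto.
  - destruct Hc. erewrite IHp1, IHp2; eauto; tauto.
  - split; intros H d; specialize (H d); revert H; apply (IHp (S k)); auto;
      intros [|x] Hx; cbn; auto; rewrite Hs; auto; lia.
  - split; intros [d H]; exists d; revert H; apply (IHp (S k)); auto;
      intros [|x] Hx; cbn; auto; rewrite Hs; auto; lia.
Qed.

Hypothesis HE : congruence.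

Lemma eval_congr rho rho' t : (forall x, E (rho x) (rho' x)) ->
  E (eval M rho t) (eval M rho' t).
Proof.
  intros Hr. induction t as [x|f ts IH] using tm_nested_ind; cbn; auto.
  apply (cg_fun HE). induction IH; cbn; auto.
Qed.

Lemma map_eval_congr rho rho' ts : (forall x, E (rho x) (rho' x)) ->
  Forall2 E (map (eval M rho) ts) (map (eval M rho') ts).
Proof. intros Hr. induction ts; cbn; auto using eval_congr. Qed.

(** Implication exchanges the two environments in its premise; since [E] is symmetric and the
    induction ranges over both environments, one direction suffices. *)
Lemma satE_congr_imp p : forall rho rho', (forall x, E (rho x) (rho' x)) ->
  satE rho p -> satE rho' p.
Proof.
  assert (Hs : forall rho rho' d, (forall x, E (rho x) (rho' x)) ->
    forall x, E (scons d rho x) (scons d rho' x)).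
  { intros rho rho' d H [|x]; cbn; auto. apply (cg_refl HE). }
  assert (Hy : forall rho rho' : nat -> dom M, (forall x, E (rho x) (rho' x)) ->
    forall x, E (rho' x) (rho x)) by (intros; now apply (cg_sym HE)).
  induction p; intros rho rho' Hr; cbn; try tauto.
  - intros H. apply (cg_trans HE) with (eval M rho s); [now apply eval_congr; auto|].
    apply (cg_trans HE) with (eval M rho t); auto. now apply eval_congr.
  - apply (cg_rel HE). now apply map_eval_congr.
  - intros []; eauto.
  - intros []; eauto.
  - intros H Hp. eapply IHp2; eauto.
  - intros H d. eapply IHp; [apply Hs, Hr|]; auto.
  - intros [d H]. exists d. eapply IHp; [apply Hs, Hr|]; auto.
Qed.

Theorem derives_sound G p : derives G p ->
  forall rho, (forall q, In q G -> satE rho q) -> satE rho p.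
Proof.
  induction 1; intros rho HG; cbn in *.
  - auto.
  - apply NNPP. intros Hn. apply (IHderives rho). intros q [<-|Hq]; auto.
  - split; auto.
  - now apply IHderives.
  - now apply IHderives.
  - auto.
  - auto.
  - destruct (IHderives1 rho HG); [apply IHderives2|apply IHderives3];
      intros u [<-|Hu]; auto.
  - intros Hp. apply IHderives. intros u [<-|Hu]; auto.
  - now apply IHderives1, IHderives2.
  - intros d. apply IHderives. intros q Hq. apply in_map_iff in Hq as (u & <- & Hu).
    apply satE_shift; auto.
  - apply satE_inst1. now apply IHderives.
  - exists (eval M rho t). apply satE_inst1; auto.
  - destruct (IHderives1 rho HG) as [d Hd]. apply (satE_shift rho d), IHderives2.
    intros u [<-|Hu]; auto. apply in_map_iff in Hu as (w & <- & Hw).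
    apply satE_shift; auto.
  - apply (cg_refl HE).
  - specialize (IHderives2 rho HG). specialize (IHderives1 rho HG).
    rewrite satE_inst1 in *. revert IHderives2. apply satE_congr_imp.
    intros [|x]; cbn; [exact IHderives1|apply (cg_refl HE)].
Qed.

End Sat.

(** * Completeness *)

Lemma derives_weaken G p : derives G p -> forall G', incl G G' -> derives G' p.
Proof.
  induction 1; intros G' HG.
  - apply d_ax; auto.
  - apply d_raa, IHderives, incl_cons; [now left|]. now apply incl_tl.
  - apply d_andI; auto.
  - eapply d_andE1; auto.
  - eapply d_andE2; auto.
  - apply d_orI1; auto.
  - apply d_orI2; auto.
  - eapply d_orE; [auto|apply IHderives2|apply IHderives3];
      (apply incl_cons; [now left|]; now apply incl_tl).
  - apply d_impI, IHderives, incl_cons; [now left|]. now apply incl_tl.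
  - eapply d_impE; auto.
  - apply d_allI, IHderives. now apply incl_map.
  - apply d_allE; auto.
  - eapply d_exI; eauto.
  - eapply d_exE; [auto|apply IHderives2].
    apply incl_cons; [now left|]. now apply incl_tl, incl_map.
  - apply d_refl.
  - eapply d_eqE; eauto.
Qed.

(** Needed for renaming: a Henkin variable in a derivation can be exchanged for an eigenvariable. *)
Lemma derives_subst G p : derives G p ->
  forall s, derives (map (subst s) G) (subst s p).
Proof.
  assert (Hsh : forall s G, map (subst (up s)) (map shift G) = map shift (map (subst s) G)).
  { intros s G'. rewrite !map_map. apply map_ext. intros; apply subst_shift. }
  induction 1; intros s'; cbn in *.
  - apply d_ax. now apply in_map.
  - apply d_raa, IHderives.
  - apply d_andI; auto.
  - eapply d_andE1; eauto.
  - eapply d_andE2; eauto.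
  - apply d_orI1; auto.
  - apply d_orI2; auto.
  - eapply d_orE; [apply IHderives1|apply IHderives2|apply IHderives3].
  - apply d_impI, IHderives.
  - eapply d_impE; eauto.
  - apply d_allI. rewrite <- Hsh. apply IHderives.
  - rewrite subst_inst1. apply d_allE, IHderives.
  - specialize (IHderives s'). rewrite subst_inst1 in IHderives. eapply d_exI; eauto.
  - eapply d_exE; [apply IHderives1|]. rewrite <- Hsh, <- subst_shift. apply IHderives2.
  - apply d_refl.
  - rewrite subst_inst1 in *. specialize (IHderives2 s'). rewrite subst_inst1 in IHderives2.
    eapply d_eqE; eauto.
Qed.

Lemma derives_cut G H p : (forall q, In q H -> derives G q) -> derives H p -> derives G p.
Proof.
  revert p. induction H as [|q H IH]; intros p HG Hp.
  - eapply derives_weaken; eauto. intros x [].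
  - eapply d_impE; [apply IH|apply HG; now left].
    + intros; apply HG; now right.
    + now apply d_impI.
Qed.

Lemma closed_exists p : exists k, closed k p = true.
Proof.
  assert (Ht : forall t, exists k, closed_tm k t = true).
  { intros t. induction t as [x|f ts IH] using tm_nested_ind.
    - exists (S x). apply Nat.ltb_lt. lia.
    - cbn. induction IH as [|t ts [k Hk] _ [k' Hk']]; [now exists 0|].
      exists (k + k'). cbn. rewrite andb_true_iff. split.
      + eapply closed_tm_mono; [|eauto]. lia.
      + revert Hk'. apply forallb_imp, Forall_forall. intros u _. apply closed_tm_mono. lia. }
  assert (H2 : forall p q, (exists k, closed k p = true) -> (exists k, closed k q = true) ->
    exists k, closed k p && closed k q = true).
  { intros p1 q1 [k Hk] [k' Hk']. exists (k + k'). rewrite andb_true_iff.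
    split; [apply closed_mono with k|apply closed_mono with k']; auto; lia. }
  induction p; cbn; auto.
  - now exists 0.
  - destruct (Ht s) as [k Hk], (Ht t) as [k' Hk']. exists (k + k').
    rewrite andb_true_iff.
    split; [apply closed_tm_mono with k|apply closed_tm_mono with k']; auto; lia.
  - destruct (Ht (TFun r ts)) as [k Hk]. now exists k.
  - destruct IHp as [k Hk]. exists k. apply closed_mono with k; auto.
  - destruct IHp as [k Hk]. exists k. apply closed_mono with k; auto.
Qed.

Lemma closed_list_exists L : exists k, forall p, In p L -> closed k p = true.
Proof.
  induction L as [|p L [k Hk]]; [exists 0; intros p []|].
  destruct (closed_exists p) as [k' Hk']. exists (k + k').
  intros q [<-|Hq]; [apply closed_mono with k'|apply closed_mono with k]; auto; lia.
Qed.

(** * Injectivity of the Gödel numbers *)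

Lemma cpair_inj a b c d : cpair a b = cpair c d -> a = c /\ b = d.
Proof.
  intros H. apply (f_equal Cantor.of_nat) in H. unfold cpair in H.
  rewrite !Cantor.cancel_of_to in H. now inversion H.
Qed.

Lemma gn_list_inj l : forall l', gn_list l = gn_list l' -> l = l'.
Proof.
  induction l as [|a l IH]; intros [|b l']; cbn; intros H; try discriminate; auto.
  injection H as H. apply cpair_inj in H as [-> H]. f_equal; auto.
Qed.

Lemma gn_map_inj {A} (f : A -> nat) : (forall x y, f x = f y -> x = y) ->
  forall l l', gn_list (map f l) = gn_list (map f l') -> l = l'.
Proof.
  intros Hf l l' H. apply gn_list_inj in H. revert l' H.
  induction l; intros [|b l']; cbn; intros H; try discriminate; auto.
  inversion H. f_equal; auto.
Qed.

Lemma gn_tm_inj t : forall t', gn_tm t = gn_tm t' -> t = t'.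
Proof.
  induction t as [x|f ts IH] using tm_nested_ind; intros [y|g us]; cbn [gn_tm]; intros H;
    apply cpair_inj in H as [H0 H]; try discriminate; [now subst|].
  apply cpair_inj in H as [-> H]. apply gn_list_inj in H. f_equal.
  revert us H. induction IH; intros [|u us]; cbn; intros He; try discriminate; auto.
  inversion He. f_equal; auto.
Qed.

Lemma gn_form_inj p : forall q, gn_form p = gn_form q -> p = q.
Proof.
  induction p; intros [] H; cbn [gn_form] in H; apply cpair_inj in H as [H0 H];
    try discriminate; auto.
  - apply cpair_inj in H as [H1 H2]. f_equal; now apply gn_tm_inj.
  - apply cpair_inj in H as [-> H2]. f_equal. eapply gn_map_inj; eauto.
    intros; now apply gn_tm_inj.
  - apply cpair_inj in H as [H1 H2]. f_equal; auto.
  - apply cpair_inj in H as [H1 H2]. f_equal; auto.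
  - apply cpair_inj in H as [H1 H2]. f_equal; auto.
  - f_equal; auto.
  - f_equal; auto.
Qed.

(** * The Henkin construction *)

Section Henkin.
Variable B : form -> Prop.
Hypothesis B_closed : forall q, B q -> closed 0 q = true.

Definition con (L : list form) : Prop :=
  ~ exists G, (forall q, In q G -> B q) /\ derives (L ++ G) FBot.

Hypothesis B_con : con [].

(** Inverts the injective numbering, so that [p] is treated at stage [gn_form p]. Numbers that code
    no formula contribute an arbitrary one, which does no harm. *)
Definition enum_form (n : nat) : form := epsilon (inhabits FBot) (fun p => gn_form p = n).

Lemma enum_form_gn p : enum_form (gn_form p) = p.
Proof.
  apply gn_form_inj. unfold enum_form. apply epsilon_spec. now exists p.
Qed.

Definition fresh (L : list form) : nat :=
  epsilon (inhabits 0) (fun k => forall p, In p L -> closed k p = true).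

Lemma fresh_spec L p : In p L -> closed (fresh L) p = true.
Proof.
  revert p. unfold fresh. apply epsilon_spec. apply closed_list_exists.
Qed.

Definition henkin_step (p : form) (L : list form) : list form :=
  if excluded_middle_informative (con (p :: L)) then
    match p with
    | FEx q => inst1 (TVar (fresh (p :: L))) q :: p :: L
    | _ => p :: L
    end
  else L.

(* The free variables of raw formulas serve as Henkin constants; this works
   because the axioms in [B] are closed. *)
Fixpoint henkin (n : nat) : list form :=
  match n with 0 => [] | S n => henkin_step (enum_form n) (henkin n) end.

Lemma con_witness q L : con (FEx q :: L) ->
  con (inst1 (TVar (fresh (FEx q :: L))) q :: FEx q :: L).
Proof.
  intros Hc (G & HG & Hd). apply Hc. exists G. split; auto.
  set (k := fresh (FEx q :: L)) in *.
  (* The renaming sends the fresh variable to 0 and raises all others. On formulas without that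
     variable it agrees with [shift], so the renamed derivation is the minor premise of existential
     elimination. *)
  set (s := fun x => if x =? k then TVar 0 else TVar (S x)).
  assert (Hs : forall x, x < k -> s x = TVar (S x)).
  { intros x Hx. unfold s. destruct (Nat.eqb_spec x k); auto; lia. }
  assert (Hk : closed k (FEx q) = true) by (apply fresh_spec; now left).
  apply derives_subst with (s := s) in Hd. cbn [map app] in Hd.
  eapply d_exE; [apply d_ax; now left|].
  replace q with (subst s (inst1 (TVar k) q)) at 1.
  - replace (map shift ((FEx q :: L) ++ G)) with (map (subst s) ((FEx q :: L) ++ G)).
    + exact Hd.
    + apply map_ext_in. intros p Hp. unfold shift. apply subst_closed with (k := k); auto.
      apply in_app_or in Hp as [Hp|Hp]; [now apply fresh_spec|].
      apply closed_mono with 0; auto; lia.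
  - unfold inst1. rewrite subst_comp. rewrite <- (subst_id q) at 2.
    apply subst_closed with (k := S k); auto.
    intros [|x] Hx; cbn.
    + unfold s. now rewrite Nat.eqb_refl.
    + apply Hs. lia.
Qed.

Lemma henkin_con n : con (henkin n).
Proof.
  induction n as [|n IH]; cbn; auto. unfold henkin_step.
  destruct (excluded_middle_informative _) as [Hc|_]; auto.
  destruct (enum_form n); auto. now apply con_witness.
Qed.

Lemma henkin_incl n m : n <= m -> incl (henkin n) (henkin m).
Proof.
  induction 1; [apply incl_refl|]. eapply incl_tran; eauto. cbn. unfold henkin_step.
  destruct (excluded_middle_informative _); [|apply incl_refl].
  destruct (enum_form m); repeat apply incl_tl; apply incl_refl.
Qed.

Definition omega (p : form) : Prop := exists n, In p (henkin n).

Lemma henkin_add p : con (p :: henkin (gn_form p)) -> omega p.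
Proof.
  intros Hc. exists (S (gn_form p)). cbn. rewrite enum_form_gn. unfold henkin_step.
  destruct (excluded_middle_informative _); [|tauto].
  destruct p; cbn; auto.
Qed.

Lemma omega_B q : B q -> omega q.
Proof.
  intros Hq. apply henkin_add. intros (G & HG & Hd).
  apply (henkin_con (gn_form q)). exists (q :: G). split.
  - intros u [<-|Hu]; auto.
  - eapply derives_weaken; eauto. intros u [<-|Hu]; [|apply in_app_or in Hu as []];
      apply in_or_app; cbn; auto.
Qed.

Lemma omega_list G : (forall q, In q G -> omega q) -> exists n, incl G (henkin n).
Proof.
  induction G as [|p G IH]; intros HG; [exists 0; intros x []|].
  destruct IH as [n Hn]; [intros; apply HG; now right|].
  destruct (HG p (or_introl eq_refl)) as [m Hm]. exists (n + m).
  intros x [<-|Hx].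
  - apply (henkin_incl m); auto; lia.
  - apply (henkin_incl n); auto; lia.
Qed.

Lemma omega_con G : (forall q, In q G -> omega q) -> ~ derives G FBot.
Proof.
  intros HG Hd. destruct (omega_list G HG) as [n Hn]. apply (henkin_con n).
  exists []. split; [intros q []|]. rewrite app_nil_r. eapply derives_weaken; eauto.
Qed.

(** A formula outside [omega] was rejected at its own stage, hence is refuted by the finite list of
    that stage together with finitely many members of [B]. *)
Lemma omega_refute p : ~ omega p ->
  exists G, (forall q, In q G -> omega q) /\ derives (p :: G) FBot.
Proof.
  intros Hp. destruct (classic (con (p :: henkin (gn_form p)))) as [Hc|Hc].
  - now apply henkin_add in Hc.
  - apply NNPP in Hc as (G & HG & Hd). exists (henkin (gn_form p) ++ G). split; auto.
    intros q Hq. apply in_app_or in Hq as [Hq|Hq]; [now eexists; eauto|].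
    now apply omega_B, HG.
Qed.

Lemma omega_derives G p : (forall q, In q G -> omega q) -> derives G p -> omega p.
Proof.
  intros HG Hd. apply NNPP. intros Hp. destruct (omega_refute p Hp) as (G' & HG' & Hd').
  apply (omega_con (G ++ G')).
  - intros q Hq. apply in_app_or in Hq as []; auto.
  - eapply d_impE.
    + apply d_impI. eapply derives_weaken; eauto. intros x [<-|Hx]; [now left|].
      right. apply in_or_app; auto.
    + eapply derives_weaken; eauto. apply incl_appl, incl_refl.
Qed.

Lemma omega_1 p q : derives [p] q -> omega p -> omega q.
Proof. intros Hd Hp. apply (omega_derives [p]); auto. intros u [<-|[]]; auto. Qed.

Lemma omega_2 p p' q : derives [p; p'] q -> omega p -> omega p' -> omega q.
Proof. intros Hd Hp Hp'. apply (omega_derives [p; p']); auto. intros u [<-|[<-|[]]]; auto. Qed.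

Lemma omega_not p : omega (FNot p) <-> ~ omega p.
Proof.
  split.
  - intros Hn Hp. apply (omega_con [FNot p; p]); [intros u [<-|[<-|[]]]; auto|].
    apply d_impE with p; apply d_ax; cbn; auto.
  - intros Hp. destruct (omega_refute p Hp) as (G & HG & Hd).
    apply (omega_derives G); auto. now apply d_impI.
Qed.

Lemma omega_and p q : omega (FAnd p q) <-> omega p /\ omega q.
Proof.
  split.
  - intros H; split; revert H; apply omega_1;
      [eapply d_andE1|eapply d_andE2]; apply d_ax; cbn; eauto.
  - intros [Hp Hq]. revert Hp Hq. apply omega_2. apply d_andI; apply d_ax; cbn; auto.
Qed.

Lemma omega_imp p q : omega (FImp p q) <-> (omega p -> omega q).
Proof.
  split.
  - intros H. revert H. intros H Hp. revert H Hp. apply omega_2.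
    apply d_impE with p; apply d_ax; cbn; auto.
  - intros H. destruct (classic (omega q)) as [Hq|Hq].
    + revert Hq. apply omega_1. apply d_impI, d_ax. cbn; auto.
    + assert (Hp : omega (FNot p)) by (apply omega_not; tauto).
      revert Hp. apply omega_1. apply d_impI, d_raa. apply d_impE with p; apply d_ax; cbn; auto.
Qed.

Lemma omega_or p q : omega (FOr p q) <-> omega p \/ omega q.
Proof.
  split.
  - intros H. apply NNPP. intros Hn.
    assert (Hp : omega (FNot p)) by (apply omega_not; tauto).
    assert (Hq : omega (FNot q)) by (apply omega_not; tauto).
    apply (omega_con [FOr p q; FNot p; FNot q]); [intros u [<-|[<-|[<-|[]]]]; auto|].
    eapply d_orE; [apply d_ax; cbn; auto| |]; (eapply d_impE; [|apply d_ax; now left]);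
      apply d_ax; cbn; unfold FNot; auto.
  - intros [H|H]; revert H; apply omega_1; [apply d_orI1|apply d_orI2]; apply d_ax; cbn; auto.
Qed.

Lemma omega_ex p : omega (FEx p) <-> exists t, omega (inst1 t p).
Proof.
  split.
  - intros H. assert (Hc : con (FEx p :: henkin (gn_form (FEx p)))).
    { intros (G & HG & Hd). apply (omega_con (FEx p :: henkin (gn_form (FEx p)) ++ G)); auto.
      intros q [<-|Hq]; auto. apply in_app_or in Hq as [Hq|Hq]; [now eexists; eauto|].
      now apply omega_B, HG. }
    eexists. exists (S (gn_form (FEx p))). cbn [henkin]. rewrite enum_form_gn.
    unfold henkin_step. destruct (excluded_middle_informative _); [|tauto].
    now left.
  - intros [t H]. revert H. apply omega_1. apply d_exI with t, d_ax. now left.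
Qed.

Lemma omega_all p : omega (FAll p) <-> forall t, omega (inst1 t p).
Proof.
  split.
  - intros H t. revert H. apply omega_1. apply d_allE, d_ax. now left.
  - intros H. apply NNPP. intros Hn. apply omega_not in Hn.
    (* A failing universal gives, classically, an existential of the negation, and its Henkin
       witness contradicts [H]. *)
    assert (He : omega (FEx (FNot p))).
    { revert Hn. apply omega_1. apply d_raa.
      apply d_impE with (FAll p); [apply d_ax; cbn; auto|].
      apply d_allI, d_raa. cbn [map].
      eapply d_impE; [apply d_ax; right; left; reflexivity|].
      apply d_exI with (TVar 0). apply d_ax. left. symmetry.
      apply (inst1_up_shift (FNot p)). }
    apply omega_ex in He as [t Ht]. change (omega (FNot (inst1 t p))) in Ht.
    apply omega_not in Ht. auto.
Qed.

Lemma omega_eq s t p : omega (FEq s t) -> omega (inst1 s p) -> omega (inst1 t p).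
Proof. apply omega_2. apply d_eqE with s; apply d_ax; cbn; auto. Qed.

Definition term_structure : structure :=
  Structure tm TFun (fun r ts => omega (FRel r ts)).
Definition term_eq (s t : dom term_structure) : Prop := omega (FEq s t).

Lemma eval_term rho t : eval term_structure rho t = subst_tm rho t.
Proof.
  induction t as [x|f ts IH] using tm_nested_ind; cbn; auto.
  f_equal. apply map_ext_Forall_in, IH.
Qed.

Lemma map_inst_shift t ts :
  map (subst_tm (fun x => match x with 0 => t | S y => TVar y end)) (map (shift_tm 1) ts) = ts.
Proof.
  rewrite map_map. rewrite <- (map_id ts) at 2. apply map_ext. intros; apply inst1_shift_tm.
Qed.

Lemma term_congruence : congruence term_structure term_eq.
Proof.
  assert (Hr : forall t, omega (FEq t t)).
  { intros t. apply (omega_derives []); [intros q []|]. apply d_refl. }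
  assert (Hrep : forall s t p, omega (FEq s t) -> omega (inst1 s p) -> omega (inst1 t p))
    by (intros s t p; apply omega_eq).
  assert (Hsym : forall s t, omega (FEq s t) -> omega (FEq t s)).
  { intros s t H. specialize (Hrep s t (FEq (TVar 0) (shift_tm 1 s)) H).
    unfold inst1 in Hrep. cbn [subst] in Hrep. rewrite !inst1_shift_tm in Hrep. cbn in Hrep.
    auto. }
  unfold term_eq. split; cbn; auto.
  - intros x y z Hxy Hyz. apply Hsym in Hxy.
    specialize (Hrep y x (FEq (TVar 0) (shift_tm 1 z)) Hxy).
    unfold inst1 in Hrep. cbn [subst] in Hrep. rewrite !inst1_shift_tm in Hrep. cbn in Hrep.
    auto.
  - intros f xs ys H. revert H.
    (* [d_eqE] replaces one argument at a time. The prefix [pre], common to both sides, is what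
       stands to the left of the current argument and grows along the induction. *)
    enough (forall pre, Forall2 (fun s t => omega (FEq s t)) xs ys ->
              omega (FEq (TFun f (pre ++ xs)) (TFun f (pre ++ ys)))) as He by apply (He []).
    revert ys. induction xs as [|x xs IH]; intros ys pre H; inversion H; subst; auto.
    apply Hsym.
    specialize (Hrep x y (FEq (TFun f (map (shift_tm 1) pre ++ TVar 0 :: map (shift_tm 1) l'))
       (TFun f (map (shift_tm 1) (pre ++ x :: xs)))) H2).
    unfold inst1 in Hrep. cbn [subst subst_tm] in Hrep.
    rewrite !map_app in Hrep. cbn [map subst_tm] in Hrep.
    rewrite !map_inst_shift, !inst1_shift_tm in Hrep. apply Hrep. clear Hrep.
    apply Hsym. specialize (IH l' (pre ++ [x]) H4).
    rewrite <- !app_assoc in IH. exact IH.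
  - intros r xs ys H. revert H.
    enough (forall pre, Forall2 (fun s t => omega (FEq s t)) xs ys ->
              omega (FRel r (pre ++ xs)) -> omega (FRel r (pre ++ ys))) as He by apply (He []).
    revert ys. induction xs as [|x xs IH]; intros ys pre H; inversion H; subst; auto.
    intros Hx.
    specialize (Hrep x y (FRel r (map (shift_tm 1) pre ++ TVar 0 :: map (shift_tm 1) xs)) H2).
    unfold inst1 in Hrep. cbn [subst] in Hrep.
    rewrite !map_app in Hrep. cbn [map subst_tm] in Hrep.
    rewrite !map_inst_shift in Hrep. apply Hrep in Hx.
    change (y :: l') with ([y] ++ l'). rewrite app_assoc. apply IH; auto.
    rewrite <- app_assoc. exact Hx.
Qed.

Lemma truth_lemma p : forall rho,
  satE term_structure term_eq rho p <-> omega (subst rho p).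
Proof.
  assert (Hsc : forall t rho p, subst (scons t rho) p = inst1 t (subst (up rho) p)).
  { intros. rewrite <- subst_scons. f_equal. }
  induction p; intros rho; cbn.
  - split; [tauto|]. intros H. apply (omega_con [FBot]); [intros q [<-|[]]; auto|].
    apply d_ax. now left.
  - unfold term_eq. now rewrite !eval_term.
  - erewrite map_ext; [reflexivity|]. apply eval_term.
  - now rewrite IHp1, IHp2, omega_and.
  - now rewrite IHp1, IHp2, omega_or.
  - now rewrite IHp1, IHp2, omega_imp.
  - rewrite omega_all. split; intros H t; specialize (H t); rewrite IHp, Hsc in *; auto.
  - rewrite omega_ex. split; intros [t H]; exists t; rewrite IHp, Hsc in *; auto.
Qed.

End Henkin.

Definition entails (ax : form -> Prop) (p : form) : Prop :=
  forall M E, congruence M E ->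
    (forall q, ax q -> forall rho, satE M E rho q) -> forall rho, satE M E rho p.

Theorem completeness (ax : form -> Prop) (p : form) :
  (forall q, ax q -> closed 0 q = true) -> closed 0 p = true ->
  entails ax p -> exists G, (forall q, In q G -> ax q) /\ derives G p.
Proof.
  intros Hax Hp Hent. apply NNPP. intros Hn.
  set (B := fun q => ax q \/ q = FNot p).
  assert (HB : forall q, B q -> closed 0 q = true).
  { intros q [Hq| ->]; auto. cbn. now rewrite Hp. }
  assert (Hcon : con B []).
  { intros (G & HG & Hd). apply Hn.
    (* Whatever is dropped from [G] is a copy of [FNot p], and [d_raa] provides that as a
       hypothesis. *)
    exists (filter (fun q => if excluded_middle_informative (ax q) then true else false) G).
    split.
    - intros q Hq. apply filter_In in Hq as [_ Hq].
      destruct (excluded_middle_informative (ax q)); auto; discriminate.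
    - apply d_raa. eapply derives_weaken; eauto. intros q Hq.
      destruct (HG q Hq) as [Ha| ->]; [right|now left].
      apply filter_In. split; auto. destruct (excluded_middle_informative (ax q)); tauto. }
  assert (Hmod : forall q, B q -> forall rho, satE _ (term_eq B) rho q).
  { intros q Hq rho. apply truth_lemma; auto.
    rewrite subst_closed with (k := 0) (s' := TVar); [|auto|lia].
    rewrite subst_id. now apply omega_B. }
  apply (Hmod (FNot p)) with (rho := TVar); [now right|].
  apply (Hent _ _ (term_congruence B HB Hcon)). intros q Hq. apply Hmod. now left.
Qed.

(** * Blocks of quantifiers *)

Definition appenv {D} (l : list D) (rho : nat -> D) : nat -> D := fold_right scons rho l.

Lemma appenv_lt {D} (l : list D) rho d x : x < length l -> appenv l rho x = nth x l d.
Proof.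
  revert x. induction l as [|a l IH]; cbn; intros x Hx; [lia|].
  destruct x; cbn; auto. apply IH. lia.
Qed.

Lemma appenv_add {D} (l : list D) rho x : appenv l rho (length l + x) = rho x.
Proof. induction l; cbn; auto. Qed.

Lemma appenv_app {D} (l l' : list D) rho : appenv (l ++ l') rho = appenv l (appenv l' rho).
Proof. apply fold_right_app. Qed.

Lemma map_seq_add {D} (f : nat -> D) a n : map f (seq a n) = map (fun i => f (a + i)) (seq 0 n).
Proof.
  revert a f. induction n as [|n IH]; intros a f; cbn; auto.
  rewrite Nat.add_0_r. f_equal. rewrite (IH (S a)), (IH 1). apply map_ext.
  intros i. f_equal. lia.
Qed.

Lemma map_appenv_seq {D} (l l' : list D) rho a n : length l = a -> length l' = n ->
  map (appenv (l ++ l') rho) (seq a n) = l'.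
Proof.
  intros <- <-. rewrite map_seq_add, appenv_app.
  rewrite (map_ext _ (appenv l' rho)) by (intros; apply appenv_add).
  induction l'; cbn; auto. f_equal. rewrite map_seq_add. exact IHl'.
Qed.

Lemma map_appenv_seq0 {D} (l : list D) rho n : length l = n ->
  map (appenv l rho) (seq 0 n) = l.
Proof. exact (map_appenv_seq [] l rho 0 n eq_refl). Qed.

(** The innermost quantifier binds variable 0 and so takes the head of the list; peeling the block
    from the inside, by [Nat.iter_succ_r], makes both match. *)
Lemma satE_foralls M E n : forall p rho,
  satE M E rho (foralls n p) <-> forall l, length l = n -> satE M E (appenv l rho) p.
Proof.
  unfold foralls. induction n as [|n IH]; intros p rho.
  - cbn. split; [|intros H; apply (H []); auto]. intros H [|] Hl; [exact H|discriminate].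
  - rewrite Nat.iter_succ_r, IH. cbn. split.
    + intros H [|d l] Hl; [discriminate|]. apply (H l). now injection Hl.
    + intros H l Hl d. apply (H (d :: l)). cbn. congruence.
Qed.

Lemma satE_exs M E n : forall p rho,
  satE M E rho (exs n p) <-> exists l, length l = n /\ satE M E (appenv l rho) p.
Proof.
  unfold exs. induction n as [|n IH]; intros p rho.
  - cbn. split; [intros H; exists []; auto|]. intros ([|] & Hl & H); [exact H|discriminate].
  - rewrite Nat.iter_succ_r, IH. cbn. split.
    + intros (l & Hl & d & H). exists (d :: l). cbn. split; [congruence|auto].
    + intros ([|d l] & Hl & H); [discriminate|]. exists l. split; [now injection Hl|].
      exists d. exact H.
Qed.

Lemma satE_conj_list M E rho l :
  satE M E rho (conj_list l) <-> forall p, In p l -> satE M E rho p.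
Proof.
  induction l as [|p l IH]; cbn; [tauto|]. rewrite IH. split.
  - intros [H1 H2] q [<-|Hq]; auto.
  - auto.
Qed.

Lemma closed_foralls n : forall k p, closed (n + k) p = true -> closed k (foralls n p) = true.
Proof.
  induction n as [|n IH]; intros k p H; cbn; auto. apply IH.
  replace (n + S k) with (S n + k) by lia. exact H.
Qed.

Lemma closed_exs n : forall k p, closed (n + k) p = true -> closed k (exs n p) = true.
Proof.
  induction n as [|n IH]; intros k p H; cbn; auto. apply IH.
  replace (n + S k) with (S n + k) by lia. exact H.
Qed.

Lemma wf_foralls sg n p : wf_form sg (foralls n p) = wf_form sg p.
Proof. induction n; cbn; auto. Qed.

Lemma wf_exs sg n p : wf_form sg (exs n p) = wf_form sg p.
Proof. induction n; cbn; auto. Qed.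

Lemma formula_in_conj sg k l : (forall p, In p l -> formula_in sg k p) ->
  formula_in sg k (conj_list l).
Proof.
  intros H. induction l as [|p l IH]; [split; reflexivity|].
  destruct (H p (or_introl eq_refl)) as [H1 H2].
  destruct IH as [H3 H4]; [intros; apply H; now right|].
  split; cbn; now rewrite ?H1, ?H2, ?H3, ?H4.
Qed.

(** * Flat formulas and relational structures *)

(** The normal form produced by [unwind] and fixed by it; on these formulas [tr_unwound] has its
    intended meaning. *)
Fixpoint flat (p : form) : bool :=
  match p with
  | FBot => true
  | FEq (TVar _) u => is_var u
  | FEq (TFun _ ts) u => forallb is_var ts && is_var u
  | FRel _ ts => forallb is_var ts
  | FAnd p q | FOr p q | FImp p q => flat p && flat q
  | FAll p | FEx p => flat p
  end.

(** This is all that a translation supplies directly: a function symbol is just a relation until the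
    identity axioms make its graph total and functional. *)
Record rstruct := RStruct {
  rdom : Type;
  req : rdom -> rdom -> Prop;
  rgraph : nat -> list rdom -> rdom -> Prop;
  rrel : nat -> list rdom -> Prop
}.

(* Meant for flat formulas: a function symbol is read through its graph. *)
Fixpoint satR (S : rstruct) (rho : nat -> rdom S) (p : form) : Prop :=
  match p with
  | FBot => False
  | FEq (TVar x) u => req S (rho x) (rho (var_of u))
  | FEq (TFun f ts) u => rgraph S f (map rho (map var_of ts)) (rho (var_of u))
  | FRel r ts => rrel S r (map rho (map var_of ts))
  | FAnd p q => satR S rho p /\ satR S rho q
  | FOr p q => satR S rho p \/ satR S rho q
  | FImp p q => satR S rho p -> satR S rho q
  | FAll p => forall d, satR S (scons d rho) p
  | FEx p => exists d, satR S (scons d rho) p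
  end.

Lemma satR_foralls S n : forall p rho,
  satR S rho (foralls n p) <-> forall l, length l = n -> satR S (appenv l rho) p.
Proof.
  unfold foralls. induction n as [|n IH]; intros p rho.
  - cbn. split; [|intros H; apply (H []); auto]. intros H [|] Hl; [exact H|discriminate].
  - rewrite Nat.iter_succ_r, IH. cbn. split.
    + intros H [|d l] Hl; [discriminate|]. apply (H l). now injection Hl.
    + intros H l Hl d. apply (H (d :: l)). cbn. congruence.
Qed.

Lemma map_var_of_vars a n : map var_of (vars a n) = seq a n.
Proof. unfold vars. rewrite map_map. apply map_id. Qed.

Lemma satR_eqs S rho a b n :
  satR S rho (eqs a b n) <-> Forall2 (req S) (map rho (seq a n)) (map rho (seq b n)).
Proof.
  unfold eqs. rewrite (map_seq_add rho a), (map_seq_add rho b).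
  induction (seq 0 n) as [|i l IH]; cbn; [intuition|].
  cbn in IH. rewrite IH. split.
  - intros [H1 H2]; auto.
  - intros H; inversion H; auto.
Qed.

Record identity_facts (sg : signature) (S : rstruct) : Prop := {
  if_refl : forall x, req S x x;
  if_sym : forall x y, req S x y -> req S y x;
  if_trans : forall x y z, req S x y -> req S y z -> req S x z;
  if_rel : forall r xs ys, nth_error (rel_ar sg) r = Some (length xs) ->
    Forall2 (req S) xs ys -> rrel S r xs -> rrel S r ys;
  if_total : forall f xs, nth_error (fun_ar sg) f = Some (length xs) ->
    exists y, rgraph S f xs y;
  if_unique : forall f xs y z, nth_error (fun_ar sg) f = Some (length xs) ->
    rgraph S f xs y -> rgraph S f xs z -> req S y z;
  if_congr : forall f xs ys y z, nth_error (fun_ar sg) f = Some (length xs) ->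
    Forall2 (req S) xs ys -> req S y z -> rgraph S f xs y -> rgraph S f ys z
}.

Lemma in_with_index l i n : In (i, n) (with_index l) <-> nth_error l i = Some n.
Proof.
  unfold with_index.
  enough (forall a, In (i, n) (combine (seq a (length l)) l) <->
            a <= i /\ nth_error l (i - a) = Some n) as H.
  { rewrite H, Nat.sub_0_r. intuition lia. }
  induction l as [|x l IH]; intros a; cbn.
  - split; [tauto|]. now intros [_ H]; destruct (i - a).
  - rewrite IH. destruct (Nat.eq_dec i a) as [->|Hne].
    + rewrite Nat.sub_diag. cbn. split.
      * intros [H|[H _]]; [|lia]. injection H as ->. auto.
      * intros [_ H]. injection H as ->. auto.
    + split.
      * intros [H|[H1 H2]]; [congruence|]. split; [lia|].
        replace (i - a) with (S (i - S a)) by lia. exact H2.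
      * intros [H1 H2]. right. split; [lia|].
        replace (i - a) with (S (i - S a)) in H2 by lia. exact H2.
Qed.

Lemma in_id_axioms sg p : In p (id_axioms sg) <->
  p = id_refl \/ p = id_sym \/ p = id_trans \/
  (exists r n, nth_error (rel_ar sg) r = Some n /\ p = id_rel r n) \/
  (exists f n, nth_error (fun_ar sg) f = Some n /\
     (p = id_fun_total f n \/ p = id_fun_unique f n \/ p = id_fun_congr f n)).
Proof.
  unfold id_axioms. rewrite !in_app_iff, in_map_iff, in_flat_map. cbn [In]. split.
  - intros [H|[([r n] & <- & H)|([f n] & H & H')]].
    + intuition.
    + apply in_with_index in H. do 3 right. left. eauto.
    + apply in_with_index in H. do 4 right. exists f, n. cbn in H'. intuition.
  - intros [->|[->|[->|[(r & n & H & ->)|(f & n & H & H')]]]]; auto 6.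
    + right; left. exists (r, n). split; auto. now apply in_with_index.
    + right; right. exists (f, n). split; [now apply in_with_index|]. cbn. intuition.
Qed.

Lemma split_length {D} (l : list D) a b : length l = a + b ->
  exists l1 l2, l = l1 ++ l2 /\ length l1 = a /\ length l2 = b.
Proof.
  intros H. exists (firstn a l), (skipn a l). rewrite firstn_skipn, length_firstn, length_skipn.
  repeat split; lia.
Qed.

Lemma Forall2_len {A B} (R : A -> B -> Prop) l l' : Forall2 R l l' -> length l = length l'.
Proof. induction 1; cbn; auto. Qed.

Section IdAxioms.
Variable S0 : rstruct.
Variable rho : nat -> rdom S0.

Lemma satR_id_rel r n : satR S0 rho (id_rel r n) <->
  forall xs ys, length xs = n -> Forall2 (req S0) xs ys -> rrel S0 r xs -> rrel S0 r ys.
Proof.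
  unfold id_rel. rewrite satR_foralls. cbn [satR].
  split.
  - intros H xs ys <- Hxy Hr. pose proof (Forall2_len _ _ _ Hxy) as Hl.
    specialize (H (xs ++ ys)). rewrite length_app in H.
    rewrite !map_var_of_vars, satR_eqs in H.
    replace (map (appenv (xs ++ ys) rho) (seq 0 (length xs))) with xs in H.
    + rewrite map_appenv_seq in H by auto. apply H; auto.
    + symmetry. rewrite appenv_app. apply map_appenv_seq0; auto.
  - intros H l Hl. apply split_length in Hl as (xs & ys & -> & H1 & H2).
    rewrite !map_var_of_vars, satR_eqs.
    replace (map (appenv (xs ++ ys) rho) (seq 0 n)) with xs.
    + rewrite map_appenv_seq by auto. intros []; eauto.
    + symmetry. rewrite appenv_app. apply map_appenv_seq0; auto.
Qed.

Lemma satR_id_fun_total f n : satR S0 rho (id_fun_total f n) <->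
  forall xs, length xs = n -> exists y, rgraph S0 f xs y.
Proof.
  unfold id_fun_total. rewrite satR_foralls. cbn [satR].
  split; intros H xs Hx; destruct (H xs Hx) as [y Hy]; exists y; revert Hy;
    rewrite map_var_of_vars, (map_appenv_seq [y]) with (l' := xs) (rho := rho); auto;
    exact (map_appenv_seq [y] xs rho 1 n eq_refl Hx).
Qed.

Lemma satR_id_fun_unique f n : satR S0 rho (id_fun_unique f n) <->
  forall xs y z, length xs = n -> rgraph S0 f xs y -> rgraph S0 f xs z -> req S0 y z.
Proof.
  unfold id_fun_unique. rewrite satR_foralls. cbn [satR].
  assert (Hm : forall xs y z, length xs = n ->
    map (appenv (y :: z :: xs) rho) (map var_of (vars 2 n)) = xs).
  { intros xs y z Hx. rewrite map_var_of_vars.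
    exact (map_appenv_seq [y; z] xs rho 2 n eq_refl Hx). }
  split.
  - intros H xs y z Hx H1 H2. specialize (H (y :: z :: xs)). rewrite Hm in H by auto.
    apply H; cbn; auto.
  - intros H [|y [|z xs]] Hl; try discriminate. injection Hl as Hl. rewrite Hm by auto.
    intros []; eapply H; eauto.
Qed.

Lemma satR_id_fun_congr f n : satR S0 rho (id_fun_congr f n) <->
  forall xs ys y z, length xs = n -> Forall2 (req S0) xs ys -> req S0 y z ->
    rgraph S0 f xs y -> rgraph S0 f ys z.
Proof.
  unfold id_fun_congr. rewrite satR_foralls. cbn [satR].
  assert (Hx : forall xs ys y z, length xs = n -> length ys = n ->
    map (appenv (y :: z :: xs ++ ys) rho) (seq 2 n) = xs).
  { intros xs ys y z H1 H2. change (y :: z :: xs ++ ys) with ([y; z] ++ xs ++ ys).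
    rewrite app_assoc, appenv_app. apply (map_appenv_seq [y; z] xs); auto. }
  assert (Hy : forall xs ys y z, length xs = n -> length ys = n ->
    map (appenv (y :: z :: xs ++ ys) rho) (seq (2 + n) n) = ys).
  { intros xs ys y z H1 H2. apply (map_appenv_seq (y :: z :: xs) ys rho); cbn; auto. }
  split.
  - intros H xs ys y z Hl Hxy Hyz Hg. pose proof (Forall2_len _ _ _ Hxy) as Hl'.
    specialize (H (y :: z :: xs ++ ys)). rewrite !map_var_of_vars, satR_eqs, Hx, Hy in H by congruence.
    apply H; cbn; auto. rewrite length_app. lia.
  - intros H [|y [|z l]] Hl; try discriminate. injection Hl as Hl.
    apply split_length in Hl as (xs & ys & -> & H1 & H2).
    rewrite !map_var_of_vars, satR_eqs, Hx, Hy by auto. cbn.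
    intros (H3 & H4 & H5). eauto.
Qed.

Lemma satR_id_axioms sg :
  (forall p, In p (id_axioms sg) -> satR S0 rho p) <-> identity_facts sg S0.
Proof.
  split.
  - intros H.
    assert (Hr : satR S0 rho id_refl) by (apply H, in_id_axioms; auto).
    assert (Hs : satR S0 rho id_sym) by (apply H, in_id_axioms; auto).
    assert (Ht : satR S0 rho id_trans) by (apply H, in_id_axioms; auto).
    cbn in Hr, Hs, Ht. split.
    + exact Hr.
    + exact Hs.
    + intros x y z H1 H2. exact (Ht x y z (conj H1 H2)).
    + intros r xs ys Hn. apply (proj1 (satR_id_rel r (length xs))); auto.
      apply H, in_id_axioms. do 3 right. left. eauto.
    + intros f xs Hn. apply (proj1 (satR_id_fun_total f (length xs))); auto.
      apply H, in_id_axioms. do 4 right. eauto 6.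
    + intros f xs y z Hn. apply (proj1 (satR_id_fun_unique f (length xs))); auto.
      apply H, in_id_axioms. do 4 right. eauto 6.
    + intros f xs ys y z Hn. apply (proj1 (satR_id_fun_congr f (length xs))); auto.
      apply H, in_id_axioms. do 4 right. eauto 6.
  - intros HI p Hp.
    apply in_id_axioms in Hp as [->|[->|[->|[(r & n & Hn & ->)|(f & n & Hn & Hp)]]]].
    + exact (if_refl _ _ HI).
    + cbn. exact (if_sym _ _ HI).
    + cbn. intros x y z []. eapply (if_trans _ _ HI); eauto.
    + apply satR_id_rel. intros xs ys <-. now apply (if_rel _ _ HI).
    + destruct Hp as [->|[->| ->]].
      * apply satR_id_fun_total. intros xs <-. now apply (if_total _ _ HI).
      * apply satR_id_fun_unique. intros xs y z <-. now apply (if_unique _ _ HI).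
      * apply satR_id_fun_congr. intros xs ys y z <-. now apply (if_congr _ _ HI).
Qed.

End IdAxioms.

Lemma forallb_var_vars a n : forallb is_var (vars a n) = true.
Proof. apply forallb_forall. intros t Ht. now apply in_map_iff in Ht as (x & <- & _). Qed.

Lemma flat_foralls n p : flat (foralls n p) = flat p.
Proof. induction n; cbn; auto. Qed.

Lemma flat_exs n p : flat (exs n p) = flat p.
Proof. induction n; cbn; auto. Qed.

Lemma flat_conj_list l : (forall p, In p l -> flat p = true) -> flat (conj_list l) = true.
Proof.
  induction l as [|p l IH]; auto. intros H. change (flat p && flat (conj_list l) = true).
  rewrite H, IH; cbn; auto. intros q Hq. apply H. now right.
Qed.

Lemma eqs_flat a b n : flat (eqs a b n) = true.
Proof.
  apply flat_conj_list. intros p Hp. now apply in_map_iff in Hp as (i & <- & _).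
Qed.

Lemma id_axioms_flat sg p : In p (id_axioms sg) -> flat p = true.
Proof.
  intros Hp. apply in_id_axioms in Hp as [->|[->|[->|[(r & n & Hn & ->)|(f & n & Hn & Hp)]]]];
    auto.
  - unfold id_rel. rewrite flat_foralls. cbn. now rewrite eqs_flat, !forallb_var_vars.
  - destruct Hp as [->|[->| ->]].
    + unfold id_fun_total. rewrite flat_foralls. cbn. now rewrite !forallb_var_vars.
    + unfold id_fun_unique. rewrite flat_foralls. cbn. now rewrite !forallb_var_vars.
    + unfold id_fun_congr. rewrite flat_foralls. cbn. now rewrite eqs_flat, !forallb_var_vars.
Qed.

Lemma wf_vars sg a n : forallb (wf_tm sg) (vars a n) = true.
Proof. apply forallb_forall. intros t Ht. now apply in_map_iff in Ht as (x & <- & _). Qed.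

Lemma closed_vars k a n : a + n <= k -> forallb (closed_tm k) (vars a n) = true.
Proof.
  intros H. apply forallb_forall. intros t Ht. apply in_map_iff in Ht as (x & <- & Hx).
  apply in_seq in Hx. apply Nat.ltb_lt. lia.
Qed.

Lemma length_vars a n : length (vars a n) = n.
Proof. unfold vars. now rewrite length_map, length_seq. Qed.

Lemma has_arity_spec ar i n : has_arity ar i n = true <-> nth_error ar i = Some n.
Proof.
  unfold has_arity. destruct (nth_error ar i) as [m|].
  - rewrite Nat.eqb_eq. split; congruence.
  - split; discriminate.
Qed.

Lemma eqs_formula_in sg k a b n : a + n <= k -> b + n <= k -> formula_in sg k (eqs a b n).
Proof.
  intros Ha Hb. apply formula_in_conj. intros p Hp. apply in_map_iff in Hp as (i & <- & Hi).
  apply in_seq in Hi. split; cbn; auto. rewrite andb_true_iff, !Nat.ltb_lt. lia.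
Qed.

Lemma id_axioms_sentence sg p : In p (id_axioms sg) -> sentence sg p.
Proof.
  intros Hp. apply in_id_axioms in Hp as [->|[->|[->|[(r & n & Hn & ->)|(f & n & Hn & Hp)]]]];
    try (split; reflexivity).
  - destruct (eqs_formula_in sg (n + n) 0 n n) as [E1 E2]; try lia.
    split; unfold id_rel; [rewrite wf_foralls|apply closed_foralls; rewrite Nat.add_0_r]; cbn;
      rewrite ?E1, ?E2, ?length_vars, ?wf_vars, ?closed_vars by lia; auto.
    apply has_arity_spec in Hn. now rewrite Hn.
  - apply has_arity_spec in Hn. destruct Hp as [->|[->| ->]].
    + split; unfold id_fun_total;
        [rewrite wf_foralls|apply closed_foralls; rewrite Nat.add_0_r]; cbn;
        rewrite ?length_vars, ?wf_vars, ?closed_vars, ?Hn by lia; auto.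
    + split; unfold id_fun_unique;
        [rewrite wf_foralls|apply closed_foralls; rewrite Nat.add_0_r]; cbn;
        rewrite ?length_vars, ?wf_vars, ?closed_vars, ?Hn by lia; auto.
    + destruct (eqs_formula_in sg (2 + (n + n)) 2 (2 + n) n) as [E1 E2]; try lia.
      split; unfold id_fun_congr;
        [rewrite wf_foralls|apply closed_foralls; rewrite Nat.add_0_r].
      * cbn. cbn in E1. rewrite E1, ?length_vars, ?wf_vars, ?closed_vars, ?Hn by lia; auto.
      * cbn [closed]. rewrite E2. cbn [closed_tm].
        rewrite !closed_vars by lia. cbn. auto.
Qed.

Definition rs_of (M : structure) (E : dom M -> dom M -> Prop) : rstruct :=
  RStruct (dom M) E (fun f xs y => E (ifun M f xs) y) (irel M).

Lemma map_eval_var M rho ts : forallb is_var ts = true ->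
  map (eval M rho) ts = map rho (map var_of ts).
Proof.
  induction ts as [|[x|f us] ts IH]; cbn; intros H; try discriminate; auto.
  f_equal; auto.
Qed.

Lemma satE_satR M E p : forall rho, flat p = true ->
  satE M E rho p <-> satR (rs_of M E) rho p.
Proof.
  induction p; intros rho; cbn; rewrite ?andb_true_iff; try tauto.
  - destruct s as [x|f ts]; destruct t as [y|g us]; cbn; rewrite ?andb_false_r, ?andb_true_r;
      try discriminate; [tauto|].
    intros H. rewrite map_eval_var; tauto.
  - intros H. rewrite map_eval_var; tauto.
  - intros []. rewrite IHp1, IHp2; tauto.
  - intros []. rewrite IHp1, IHp2; tauto.
  - intros []. rewrite IHp1, IHp2; tauto.
  - intros Hf. split; intros H d; specialize (H d); apply IHp in H; auto.
  - intros Hf. split; intros [d H]; exists d; apply IHp in H; auto.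
Qed.

Lemma id_axioms_valid M E sg p : congruence M E -> In p (id_axioms sg) ->
  forall rho, satE M E rho p.
Proof.
  intros HE Hp rho. apply satE_satR; [eapply id_axioms_flat; eauto|].
  apply (proj2 (satR_id_axioms (rs_of M E) rho sg)); auto.
  destruct HE as [h1 h2 h3 h4 h5]. split; cbn; eauto.
Qed.

(** * Unwinding *)

(** Names the local fixpoint inside [unw_eq], so that properties of argument lists can be stated and
    proved by induction. *)
Definition unw_args (s : nat) : nat -> list tm -> list form :=
  fix args (i : nat) (us : list tm) : list form :=
    match us with
    | [] => []
    | u :: us => unw_eq s u i :: args (S i) us
    end.

Lemma unw_eq_fun s f ts y : unw_eq s (TFun f ts) y =
  if forallb is_var ts then FEq (TFun f (map (shift_tm s) ts)) (TVar y)
  else exs (length ts) (FAnd (conj_list (unw_args (s + length ts) 0 ts))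
                    (FEq (TFun f (vars 0 (length ts))) (TVar (y + length ts)))).
Proof. reflexivity. Qed.

Lemma unw_rel_args r ts : unw_rel r ts =
  if forallb is_var ts then FRel r ts
  else exs (length ts) (FAnd (conj_list (unw_args (length ts) 0 ts)) (FRel r (vars 0 (length ts)))).
Proof.
  unfold unw_rel. destruct (forallb is_var ts); auto. do 3 f_equal.
  generalize (length ts) at 1 3 as s. generalize 0 as i.
  induction ts as [|u us IH]; intros i s; cbn; auto. f_equal. apply IH.
Qed.

Lemma shift_tm_0 t : shift_tm 0 t = t.
Proof.
  unfold shift_tm. rewrite <- (subst_tm_id t) at 2. f_equal. extensionality x.
  now rewrite Nat.add_0_r.
Qed.

Lemma unwind_flat p : flat p = true -> unwind p = p.
Proof.
  induction p; cbn [flat unwind]; rewrite ?andb_true_iff; auto.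
  - destruct s as [x|f ts]; destruct t as [y|g us]; cbn [flat is_var unw_id]; rewrite ?andb_false_r, ?andb_true_r;
      intros H; try discriminate.
    + cbn. now rewrite Nat.add_0_r.
    + rewrite unw_eq_fun, H. do 2 f_equal.
      rewrite <- (map_id ts) at 2. apply map_ext, shift_tm_0.
  - intros H. unfold unw_rel. now rewrite H.
  - intros []; f_equal; auto.
  - intros []; f_equal; auto.
  - intros []; f_equal; auto.
  - intros; f_equal; auto.
  - intros; f_equal; auto.
Qed.

Lemma shift_is_var s ts : forallb is_var ts = true -> forallb is_var (map (shift_tm s) ts) = true.
Proof.
  induction ts as [|[x|f us] ts IH]; cbn; intros H; try discriminate; auto.
Qed.

Lemma unw_eq_flat t : forall s y, flat (unw_eq s t y) = true.
Proof.
  induction t as [x|f ts IH] using tm_nested_ind; intros s y; auto.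
  rewrite unw_eq_fun. destruct (forallb is_var ts) eqn:Hv.
  - cbn. now rewrite shift_is_var.
  - rewrite flat_exs. cbn. rewrite forallb_var_vars, !andb_true_r.
    apply flat_conj_list. generalize (s + length ts) as s'. generalize 0 as i. clear Hv.
    induction IH; cbn; intros i s' p; [tauto|]. intros [<-|Hp]; eauto.
Qed.

Lemma unw_args_flat us : forall s i p, In p (unw_args s i us) -> flat p = true.
Proof.
  induction us; cbn; intros s i p; [tauto|]. intros [<-|Hp]; eauto using unw_eq_flat.
Qed.

Lemma flat_unwind p : flat (unwind p) = true.
Proof.
  induction p; cbn [flat unwind]; rewrite ?IHp1, ?IHp2, ?IHp; auto.
  - destruct t; cbn [unw_id flat]; rewrite ?unw_eq_flat; auto.
  - rewrite unw_rel_args. destruct (forallb is_var ts) eqn:Hv; auto.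
    rewrite flat_exs. cbn. rewrite forallb_var_vars, andb_true_r.
    apply flat_conj_list, unw_args_flat.
Qed.

Section UnwindSat.
Variables (M : structure) (E : dom M -> dom M -> Prop).
Hypothesis HE : congruence M E.

Let unw_ok (t : tm) : Prop := forall s y rho,
  satE M E rho (unw_eq s t y) <-> E (eval M (fun x => rho (x + s)) t) (rho y).

Let unw_args_sat us : Forall unw_ok us -> forall s i rho,
  satE M E rho (conj_list (unw_args s i us)) <->
  Forall2 E (map (eval M (fun x => rho (x + s))) us) (map rho (seq i (length us))).
Proof.
  induction 1 as [|u us Hu Hus IH]; intros s i rho; cbn; [intuition|].
  cbn in IH. rewrite (Hu s i rho), IH. split.
  - intros []; auto.
  - intros H; inversion H; auto.
Qed.

Let args_env (ts : list tm) l s rho : length l = length ts ->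
  map (eval M (fun x => appenv l rho (x + (s + length ts)))) ts =
  map (eval M (fun x => rho (x + s))) ts.
Proof.
  intros Hl. apply map_ext. intros t. f_equal. extensionality x.
  rewrite <- Hl. replace (x + (s + length l)) with (length l + (x + s)) by lia.
  apply appenv_add.
Qed.

(** The quantified argument values are only [E]-equal to the true ones, so one direction rests on
    the congruence of the function symbol; for the other, the true values are the witnesses. *)
Lemma unw_eq_sat t : forall s y rho,
  satE M E rho (unw_eq s t y) <-> E (eval M (fun x => rho (x + s)) t) (rho y).
Proof.
  induction t as [x|f ts IH] using tm_nested_ind; intros s y rho; [reflexivity|].
  rewrite unw_eq_fun. destruct (forallb is_var ts) eqn:Hv.
  - cbn. rewrite map_map. erewrite map_ext; [reflexivity|]. intros t.
    unfold shift_tm. rewrite eval_subst. reflexivity.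
  - rewrite satE_exs. cbn [satE]. split.
    + intros (l & Hl & H1 & H2). rewrite (unw_args_sat ts IH) in H1.
      rewrite args_env in H1 by auto.
      rewrite map_appenv_seq0 in H1 by auto.
      cbn in H2. rewrite map_eval_var, map_var_of_vars in H2 by apply forallb_var_vars.
      rewrite map_appenv_seq0 in H2 by auto.
      rewrite <- Hl, Nat.add_comm, appenv_add in H2.
      apply (cg_trans _ _ HE) with (ifun M f l); auto. now apply (cg_fun _ _ HE).
    + intros H. exists (map (eval M (fun x => rho (x + s))) ts). rewrite length_map. split; auto.
      split.
      * rewrite (unw_args_sat ts IH), args_env by apply length_map.
        rewrite map_appenv_seq0 by apply length_map.
        generalize (map (eval M (fun x => rho (x + s))) ts). intros l.
        induction l; constructor; auto. apply (cg_refl _ _ HE).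
      * cbn. rewrite map_eval_var, map_var_of_vars by apply forallb_var_vars.
        rewrite map_appenv_seq0 by apply length_map.
        rewrite Nat.add_comm.
        rewrite <- (length_map (eval M (fun x => rho (x + s))) ts), appenv_add.
        exact H.
Qed.

Lemma unw_args_satE us s i rho : satE M E rho (conj_list (unw_args s i us)) <->
  Forall2 E (map (eval M (fun x => rho (x + s))) us) (map rho (seq i (length us))).
Proof. apply unw_args_sat. apply Forall_forall. intros t _. exact (unw_eq_sat t). Qed.

Lemma unwind_sat p : forall rho, satE M E rho (unwind p) <-> satE M E rho p.
Proof.
  assert (He0 : forall rho t, eval M (fun x => rho (x + 0)) t = eval M rho t).
  { intros rho t. f_equal. extensionality x. now rewrite Nat.add_0_r. }
  induction p; intros rho; cbn [unwind satE]; rewrite ?IHp1, ?IHp2; try tauto.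
  - destruct t as [y|g us]; cbn [unw_id].
    + rewrite unw_eq_sat, He0. reflexivity.
    + cbn [satE]. split.
      * intros (d & H1 & H2). rewrite unw_eq_sat in H1, H2.
        cbn [scons] in H1, H2.
        replace (fun x => scons d rho (x + 1)) with rho in H1, H2
          by (extensionality x; now rewrite Nat.add_1_r).
        eapply (cg_trans _ _ HE); eauto. now apply (cg_sym _ _ HE).
      * intros H. exists (eval M rho (TFun g us)). rewrite !unw_eq_sat. cbn [scons].
        replace (fun x => scons _ rho (x + 1)) with rho
          by (extensionality x; now rewrite Nat.add_1_r).
        split; auto. apply (cg_refl _ _ HE).
  - rewrite unw_rel_args. destruct (forallb is_var ts) eqn:Hv; [reflexivity|].
    rewrite satE_exs. cbn [satE]. split.
    + intros (l & Hl & H1 & H2). rewrite unw_args_satE in H1.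
      rewrite (args_env ts l 0) in H1 by auto.
      rewrite map_appenv_seq0 in H1 by auto.
      rewrite map_eval_var, map_var_of_vars, map_appenv_seq0 in H2
        by (auto using forallb_var_vars).
      apply (cg_rel _ _ HE) with l; auto.
      rewrite (map_ext _ (eval M rho) (He0 rho)) in H1.
      clear -H1 HE. induction H1; constructor; auto. now apply (cg_sym _ _ HE).
    + intros H. exists (map (eval M rho) ts). rewrite length_map. split; auto. split.
      * rewrite unw_args_satE, (args_env ts _ 0) by apply length_map.
        rewrite map_appenv_seq0 by apply length_map.
        rewrite (map_ext _ (eval M rho) (He0 rho)).
        generalize (map (eval M rho) ts). intros l.
        induction l; constructor; auto. apply (cg_refl _ _ HE).
      * rewrite map_eval_var, map_var_of_vars, map_appenv_seq0
          by (auto using forallb_var_vars, length_map). exact H.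
  - split; intros H d; apply IHp, H.
  - split; intros [d H]; exists d; apply IHp, H.
Qed.

End UnwindSat.

Lemma unw_eq_formula_in sg k t : forall s y K, wf_tm sg t = true -> closed_tm k t = true ->
  k + s <= K -> y < K -> formula_in sg K (unw_eq s t y).
Proof.
  induction t as [x|f ts IH] using tm_nested_ind; intros s y K Hw Hc HK Hy.
  - split; auto. cbn in *. rewrite andb_true_iff, !Nat.ltb_lt in *. lia.
  - rewrite unw_eq_fun. cbn in Hw, Hc. apply andb_true_iff in Hw as [Ha Hw].
    destruct (forallb is_var ts) eqn:Hv.
    + split; cbn.
      * rewrite length_map, Ha, andb_true_r. cbn. rewrite forallb_forall in *. intros t Ht.
        apply in_map_iff in Ht as (u & <- & Hu). apply wf_subst_tm; auto.
      * apply andb_true_iff. split; [|now apply Nat.ltb_lt].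
        rewrite forallb_forall in *. intros t Ht.
        apply in_map_iff in Ht as (u & <- & Hu). apply closed_tm_mono with (k + s); auto.
        apply closed_shift_tm. auto.
    + assert (Hargs : formula_in sg (length ts + K)
        (conj_list (unw_args (s + length ts) 0 ts))).
      { apply formula_in_conj.
        assert (Hi : forall i, i + length ts <= length ts + K -> forall p,
          In p (unw_args (s + length ts) i ts) -> formula_in sg (length ts + K) p).
        { assert (HK' : k + (s + length ts) <= length ts + K) by lia.
          revert HK'. generalize (s + length ts) as s'. generalize (length ts + K) as K'.
          clear Ha Hv HK Hy. intros K' s' HK'. induction IH as [|t ts Ht _ IH]; cbn; [tauto|].
          cbn in Hw, Hc. rewrite andb_true_iff in Hw, Hc.
          intros i Hi p [<-|Hp]; [apply Ht; try tauto; lia|].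
          apply (IH (proj2 Hw) (proj2 Hc) (S i)); auto; lia. }
        apply Hi. lia. }
      destruct Hargs as [H1 H2]. split.
      * rewrite wf_exs. cbn [wf_form wf_tm]. now rewrite H1, length_vars, Ha, wf_vars.
      * apply closed_exs. cbn [closed closed_tm]. rewrite H2, closed_vars by lia.
        cbn. apply Nat.ltb_lt. lia.
Qed.

Lemma unw_args_formula_in sg k K s us : forall i, forallb (wf_tm sg) us = true ->
  forallb (closed_tm k) us = true -> k + s <= K -> i + length us <= K ->
  forall p, In p (unw_args s i us) -> formula_in sg K p.
Proof.
  induction us as [|u us IH]; cbn; [tauto|]. intros i Hw Hc HK Hi p.
  rewrite andb_true_iff in Hw, Hc. destruct Hw, Hc. intros [<-|Hp].
  - apply unw_eq_formula_in with k; auto. lia.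
  - apply (IH (S i)); auto. lia.
Qed.

Lemma unwind_formula_in sg p : forall k, formula_in sg k p -> formula_in sg k (unwind p).
Proof.
  assert (H2 : forall k p q, formula_in sg k p -> formula_in sg k q ->
    wf_form sg p && wf_form sg q = true /\ closed k p && closed k q = true).
  { intros k p1 q1 [h1 h2] [h3 h4]. now rewrite h1, h2, h3, h4. }
  induction p; intros k [Hw Hc]; cbn [wf_form closed] in Hw, Hc;
    rewrite ?andb_true_iff in Hw; rewrite ?andb_true_iff in Hc; cbn [unwind].
  - now split.
  - destruct Hw as [Hw1 Hw2], Hc as [Hc1 Hc2]. destruct t as [y|g us]; cbn [unw_id].
    + cbn in Hc2. apply Nat.ltb_lt in Hc2. apply unw_eq_formula_in with k; auto; lia.
    + apply (H2 (S k)); apply unw_eq_formula_in with k; auto; lia.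
  - destruct Hw as [Ha Hw]. rewrite unw_rel_args.
    destruct (forallb is_var ts) eqn:Hv.
    + split; cbn; now rewrite ?Ha, ?Hw.
    + destruct (formula_in_conj sg (length ts + k) (unw_args (length ts) 0 ts)) as [h1 h2].
      { apply unw_args_formula_in with k; auto; lia. }
      split.
      * rewrite wf_exs. cbn [wf_form]. now rewrite h1, length_vars, Ha, wf_vars.
      * apply closed_exs. cbn [closed]. now rewrite h2, closed_vars by lia.
  - apply (H2 k); [apply IHp1|apply IHp2]; split; tauto.
  - apply (H2 k); [apply IHp1|apply IHp2]; split; tauto.
  - apply (H2 k); [apply IHp1|apply IHp2]; split; tauto.
  - apply (IHp (S k)). now split.
  - apply (IHp (S k)). now split.
Qed.

(** * Realizing a relational structure *)

Section Realize.
Variables (sg : signature) (S0 : rstruct) (d0 : rdom S0).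
Hypothesis HI : identity_facts sg S0.

(** Choice makes functions out of graphs. The identity axioms say nothing about symbols applied to
    the wrong number of arguments; these get the value [d0] or are false, so that [congruence],
    which ranges over all lists, still holds. *)
Definition realize : structure := Structure (rdom S0)
  (fun f xs => if excluded_middle_informative (nth_error (fun_ar sg) f = Some (length xs))
               then epsilon (inhabits d0) (rgraph S0 f xs) else d0)
  (fun r xs => nth_error (rel_ar sg) r = Some (length xs) /\ rrel S0 r xs).

Lemma realize_graph f xs y : nth_error (fun_ar sg) f = Some (length xs) ->
  req S0 (ifun realize f xs) y <-> rgraph S0 f xs y.
Proof.
  intros Hn. cbn. destruct (excluded_middle_informative _); [|tauto].
  assert (Hg : rgraph S0 f xs (epsilon (inhabits d0) (rgraph S0 f xs))).
  { apply epsilon_spec. now apply (if_total _ _ HI). }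
  split.
  - intros He. apply (if_congr _ _ HI) with xs (epsilon (inhabits d0) (rgraph S0 f xs)); auto.
    clear -HI. induction xs; constructor; auto. apply (if_refl _ _ HI).
  - intros Hy. now apply (if_unique _ _ HI) with f xs.
Qed.

Lemma realize_congruence : congruence realize (req S0).
Proof.
  split.
  - exact (if_refl _ _ HI).
  - exact (if_sym _ _ HI).
  - exact (if_trans _ _ HI).
  - intros f xs ys Hxy. pose proof (Forall2_len _ _ _ Hxy) as Hl.
    destruct (classic (nth_error (fun_ar sg) f = Some (length xs))) as [Hn|Hn].
    + apply realize_graph; auto.
      assert (Hn' : nth_error (fun_ar sg) f = Some (length ys)) by (rewrite <- Hl; exact Hn).
      apply (if_congr _ _ HI) with ys (ifun realize f ys); [exact Hn'| | |].
      * clear -Hxy HI. induction Hxy; constructor; auto. now apply (if_sym _ _ HI).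
      * apply (if_refl _ _ HI).
      * apply realize_graph; [exact Hn'|]. apply (if_refl _ _ HI).
    + cbn. destruct (excluded_middle_informative _) as [e|_]; [now destruct Hn|].
      destruct (excluded_middle_informative _) as [e|_]; [|apply (if_refl _ _ HI)].
      destruct Hn. exact (eq_trans e (f_equal Some (eq_sym Hl))).
  - intros r xs ys Hxy [Hn Hr]. split.
    + exact (eq_trans Hn (f_equal Some (Forall2_len _ _ _ Hxy))).
    + now apply (if_rel _ _ HI) with xs.
Qed.

Lemma realize_sat p : forall rho, flat p = true -> wf_form sg p = true ->
  satE realize (req S0) rho p <-> satR S0 rho p.
Proof.
  induction p; intros rho; cbn [flat wf_form satR]; rewrite ?andb_true_iff.
  - reflexivity.
  - destruct s as [x|f ts]; destruct t as [y|g us]; cbn [is_var wf_tm satE eval var_of];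
      rewrite ?andb_false_r, ?andb_true_r; try discriminate; [tauto|].
    rewrite andb_true_iff. intros Hv [[Ha _] _]. apply has_arity_spec in Ha.
    rewrite map_eval_var by auto. apply realize_graph. now rewrite !length_map.
  - intros Hv [Ha _]. apply has_arity_spec in Ha. cbn [satE]. rewrite map_eval_var by auto.
    cbn. rewrite !length_map. tauto.
  - intros [] []. cbn [satE]. rewrite IHp1, IHp2; tauto.
  - intros [] []. cbn [satE]. rewrite IHp1, IHp2; tauto.
  - intros [] []. cbn [satE]. rewrite IHp1, IHp2; tauto.
  - intros Hf Hw. split; intros H d; specialize (H d); apply IHp in H; auto.
  - intros Hf Hw. split; intros [d H]; exists d; apply IHp in H; auto.
Qed.

End Realize.

(** * The internal model of a translation *)

Section Internal.
Variables (src tgt : signature) (T : translation).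
Hypothesis HT : wf_translation src tgt T.
Notation m := (tr_dim T).

Lemma tr_dim_pos : 1 <= m.
Proof. apply HT. Qed.

Lemma tr_inst_formula_in n k p xs : formula_in tgt (n * m + tr_npar T) p -> length xs = n ->
  (forall x, In x xs -> x < k) -> formula_in tgt (k * m + tr_npar T) (tr_inst T k p xs).
Proof.
  intros [Hw Hc] Hl Hx. pose proof tr_dim_pos as Hm. unfold tr_inst. split.
  - apply wf_subst; auto. intros v. now destruct (v <? _).
  - eapply closed_subst; eauto. intros v Hv. rewrite Hl.
    destruct (Nat.ltb_spec v (n * m)); cbn; apply Nat.ltb_lt; [|lia].
    assert (Hd : v / m < n) by (apply Nat.Div0.div_lt_upper_bound; lia).
    assert (Hn : nth (v / m) xs 0 < k) by (apply Hx, nth_In; lia).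
    pose proof (Nat.mod_upper_bound v m). nia.
Qed.

Lemma Forall2_nth_error {A B} (R : A -> B -> Prop) l l' i x d : Forall2 R l l' ->
  nth_error l i = Some x -> R x (nth i l' d).
Proof.
  intros H. revert i. induction H; intros [|i]; cbn; intros He; try discriminate; auto.
  congruence.
Qed.

Lemma tr_fun_ok f n : nth_error (fun_ar src) f = Some n ->
  formula_in tgt (S n * m + tr_npar T) (nth f (tr_fun T) FBot).
Proof.
  intros H. destruct HT as (_ & _ & _ & _ & Hf & _).
  apply (Forall2_nth_error _ _ _ _ _ FBot Hf H).
Qed.

Lemma tr_rel_ok r n : nth_error (rel_ar src) r = Some n ->
  formula_in tgt (n * m + tr_npar T) (nth r (tr_rel T) FBot).
Proof.
  intros H. destruct HT as (_ & _ & _ & _ & _ & Hf).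
  apply (Forall2_nth_error _ _ _ _ _ FBot Hf H).
Qed.

Lemma closed_var_of k ts : forallb is_var ts = true -> forallb (closed_tm k) ts = true ->
  forall x, In x (map var_of ts) -> x < k.
Proof.
  intros Hv Hc x Hx. apply in_map_iff in Hx as (t & <- & Ht).
  rewrite forallb_forall in Hv, Hc. specialize (Hv t Ht). specialize (Hc t Ht).
  destruct t; [now apply Nat.ltb_lt|discriminate].
Qed.

Lemma tr_unwound_formula_in p : forall k, flat p = true -> formula_in src k p ->
  formula_in tgt (k * m + tr_npar T) (tr_unwound T k p).
Proof.
  assert (H2 : forall k p q, formula_in tgt k p -> formula_in tgt k q ->
    wf_form tgt p && wf_form tgt q = true /\ closed k p && closed k q = true).
  { intros k p1 q1 [h1 h2] [h3 h4]. now rewrite h1, h2, h3, h4. }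
  assert (Hd : forall k, formula_in tgt (S k * m + tr_npar T) (tr_inst T (S k) (tr_dom T) [0])).
  { intros k. apply tr_inst_formula_in with 1; auto; [apply HT|].
    intros x [<-|[]]. lia. }
  induction p; intros k; cbn [flat]; intros Hf [Hw Hc]; cbn [wf_form closed] in Hw, Hc;
    rewrite ?andb_true_iff in Hw; rewrite ?andb_true_iff in Hc;
    rewrite ?andb_true_iff in Hf; cbn [tr_unwound].
  - now split.
  - destruct s as [x|f ts]; destruct t as [y|g us]; cbn in Hf;
      rewrite ?andb_true_iff in Hf; try (now destruct Hf); try discriminate.
    + apply tr_inst_formula_in with 2; auto; [apply HT|]. cbn in Hc. rewrite !Nat.ltb_lt in Hc.
      cbn. intros z [<-|[<-|[]]]; tauto.
    + cbn in Hw, Hc. rewrite andb_true_iff in Hw. destruct Hw as [[Ha Hw] _].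
      apply has_arity_spec in Ha. destruct Hc as [Hc1 Hc2]. apply Nat.ltb_lt in Hc2.
      apply tr_inst_formula_in with (S (length ts)).
      * now apply tr_fun_ok.
      * rewrite length_app, length_map. cbn. lia.
      * intros z Hz. apply in_app_or in Hz as [Hz|[<-|[]]]; auto.
        apply closed_var_of with ts; tauto.
  - destruct Hw as [Ha Hw]. apply has_arity_spec in Ha.
    apply tr_inst_formula_in with (length ts); [now apply tr_rel_ok|apply length_map|].
    now apply closed_var_of.
  - apply (H2 (k * m + tr_npar T)); [apply IHp1|apply IHp2]; try tauto; split; tauto.
  - apply (H2 (k * m + tr_npar T)); [apply IHp1|apply IHp2]; try tauto; split; tauto.
  - apply (H2 (k * m + tr_npar T)); [apply IHp1|apply IHp2]; try tauto; split; tauto.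
  - destruct (IHp (S k) Hf (conj Hw Hc)) as [h1 h2]. destruct (Hd k) as [h3 h4]. split.
    + rewrite wf_foralls. cbn [wf_form]. now rewrite h1, h3.
    + apply closed_foralls. rewrite Nat.add_assoc. cbn [closed].
      change (m + k * m) with (S k * m). now rewrite h2, h4.
  - destruct (IHp (S k) Hf (conj Hw Hc)) as [h1 h2]. destruct (Hd k) as [h3 h4]. split.
    + rewrite wf_exs. cbn [wf_form]. now rewrite h1, h3.
    + apply closed_exs. rewrite Nat.add_assoc. cbn [closed].
      change (m + k * m) with (S k * m). now rewrite h2, h4.
Qed.

Lemma translate_sentence p : sentence src p -> sentence tgt (translate T p).
Proof.
  intros Hp. destruct (tr_unwound_formula_in (unwind p) 0) as [h1 h2].
  { apply flat_unwind. } { now apply unwind_formula_in. }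
  destruct HT as (_ & [h3 h4] & _). cbn in h2, h4. split; cbn.
  - now rewrite wf_exs, wf_foralls, h3; cbn; rewrite h3, h1.
  - rewrite closed_exs, closed_foralls; auto; rewrite Nat.add_0_r; auto.
    cbn. now rewrite h4, h2.
Qed.

Section Model.
Variables (M : structure) (E : dom M -> dom M -> Prop) (par : nat -> dom M).

(** The layout of [tr_inst]: [r i] is the tuple of source variable i as a function of the
    coordinate, and the parameters follow the [k] blocks. *)
Definition genv (k : nat) (r : nat -> nat -> dom M) (v : nat) : dom M :=
  if v <? k * m then r (v / m) (v mod m) else par (v - k * m).

Lemma genv_ext k r r' : (forall i, i < k -> r i = r' i) -> genv k r = genv k r'.
Proof.
  intros H. extensionality v. unfold genv. destruct (Nat.ltb_spec v (k * m)); auto.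
  rewrite H; auto. pose proof tr_dim_pos. apply Nat.Div0.div_lt_upper_bound; lia.
Qed.

Lemma genv_0 r : genv 0 r = par.
Proof.
  extensionality v. unfold genv. cbn. destruct (Nat.ltb_spec v 0); [lia|].
  now rewrite Nat.sub_0_r.
Qed.

Lemma tr_inst_sat k p xs r : (forall x, In x xs -> x < k) ->
  satE M E (genv k r) (tr_inst T k p xs) <->
  satE M E (genv (length xs) (fun i => r (nth i xs 0))) p.
Proof.
  intros Hx. pose proof tr_dim_pos as Hm. unfold tr_inst. rewrite satE_subst.
  replace (fun x => eval M (genv k r) _) with (genv (length xs) (fun i => r (nth i xs 0)));
    [reflexivity|].
  extensionality v. unfold genv at 1. destruct (Nat.ltb_spec v (length xs * m)) as [Hv|Hv]; cbn;
    unfold genv.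
  - assert (Hd : v / m < length xs) by (apply Nat.Div0.div_lt_upper_bound; lia).
    assert (Hn : nth (v / m) xs 0 < k) by (apply Hx, nth_In; lia).
    pose proof (Nat.mod_upper_bound v m ltac:(lia)) as Hu.
    rewrite (proj2 (Nat.ltb_lt _ _)) by nia.
    rewrite Nat.div_add_l, (Nat.div_small (v mod m)), Nat.add_0_r by lia.
    rewrite Nat.add_comm, Nat.Div0.mod_add, (Nat.mod_small (v mod m)) by lia. reflexivity.
  - rewrite (proj2 (Nat.ltb_ge _ _)) by lia. f_equal. lia.
Qed.

Lemma genv_S k r l : length l = m ->
  appenv l (genv k r) = genv (S k) (scons (fun v => nth v l (par 0)) r).
Proof.
  intros Hl. pose proof tr_dim_pos as Hm. extensionality v. unfold genv at 2.
  destruct (Nat.lt_ge_cases v m) as [Hv|Hv].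
  - rewrite (proj2 (Nat.ltb_lt _ _)) by (cbn; lia).
    rewrite (appenv_lt _ _ (par 0)) by lia. rewrite Nat.div_small, Nat.mod_small by lia.
    reflexivity.
  - replace v with (length l + (v - m)) at 1 by lia. rewrite appenv_add. unfold genv.
    assert (Hd : v / m = S ((v - m) / m)).
    { replace v with (1 * m + (v - m)) at 1 by lia. rewrite Nat.div_add_l by lia. lia. }
    assert (Hr : v mod m = (v - m) mod m).
    { replace v with ((v - m) + 1 * m) at 1 by lia. now rewrite Nat.Div0.mod_add. }
    rewrite Hd, Hr. cbn [scons].
    destruct (Nat.ltb_spec (v - m) (k * m)), (Nat.ltb_spec v (S k * m)); cbn in *; try lia; auto.
    f_equal. lia.
Qed.

Lemma genv_tuple k r t :
  genv (S k) (scons t r) = appenv (map t (seq 0 m)) (genv k r).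
Proof.
  rewrite genv_S by now rewrite length_map, length_seq.
  extensionality v. unfold genv. destruct (Nat.ltb_spec v (S k * m)); auto.
  destruct (v / m) eqn:Hv; cbn [scons]; auto.
  pose proof tr_dim_pos as Hm.
  pose proof (Nat.mod_upper_bound v m ltac:(lia)) as Hu.
  rewrite (nth_indep _ _ (t 0)) by now rewrite length_map, length_seq.
  rewrite map_nth, seq_nth by auto. reflexivity.
Qed.

Definition in_dom (t : nat -> dom M) : Prop := satE M E (genv 1 (fun _ => t)) (tr_dom T).

(** An element is an infinite sequence of which only the first [m] entries are ever read. Sequences
    agreeing there may be different elements, which is harmless: elements are compared by [tr_eq]
    only. *)
Definition tuple : Type := {t : nat -> dom M | in_dom t}.

Definition lookup (xs : list tuple) (i : nat) : nat -> dom M :=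
  nth i (map (@proj1_sig _ _) xs) (fun _ => par 0).

Definition internal : rstruct := RStruct tuple
  (fun x y => satE M E (genv 2 (lookup [x; y])) (tr_eq T))
  (fun f xs y => satE M E (genv (S (length xs)) (lookup (xs ++ [y]))) (nth f (tr_fun T) FBot))
  (fun r xs => satE M E (genv (length xs) (lookup xs)) (nth r (tr_rel T) FBot)).

Lemma tr_inst_internal k p xs (r : nat -> tuple) n : (forall x, In x xs -> x < k) ->
  length xs = n ->
  satE M E (genv k (fun x => proj1_sig (r x))) (tr_inst T k p xs) <->
  satE M E (genv n (lookup (map r xs))) p.
Proof.
  intros Hx <-. rewrite tr_inst_sat by auto.
  replace (genv (length xs) (fun i => proj1_sig (r (nth i xs 0)))) with
    (genv (length xs) (lookup (map r xs))); [reflexivity|].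
  apply genv_ext. intros i Hi. unfold lookup. rewrite map_map.
  rewrite (nth_indep _ _ (proj1_sig (r 0))) by now rewrite length_map.
  now rewrite (map_nth (fun x => proj1_sig (r x))).
Qed.

(** A relativized block of [m] quantifiers runs exactly through the initial parts of the elements of
    [tuple]. *)
Lemma tr_unwound_sat p : forall k (r : nat -> tuple), flat p = true -> closed k p = true ->
  satE M E (genv k (fun x => proj1_sig (r x))) (tr_unwound T k p) <-> satR internal r p.
Proof.
  assert (Hsc : forall (d : tuple) r, (fun x => proj1_sig (scons d r x)) =
    scons (proj1_sig d) (fun x => proj1_sig (r x))).
  { intros d r. extensionality x. now destruct x. }
  assert (Hdom : forall k t r, satE M E (genv (S k) (scons t r)) (tr_inst T (S k) (tr_dom T) [0])
    <-> in_dom t).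
  { intros k t r. rewrite tr_inst_sat.
    - unfold in_dom. rewrite (genv_ext (length [0]) _ (fun _ => t)); [reflexivity|].
      intros [|i] Hi; cbn in *; auto. lia.
    - intros x [<-|[]]. lia. }
  induction p as [|s t|r0 ts|p1 IHp1 p2 IHp2|p1 IHp1 p2 IHp2|p1 IHp1 p2 IHp2|p IHp|p IHp];
    intros k r; cbn [flat closed]; intros Hf Hc;
    rewrite ?andb_true_iff in Hf; rewrite ?andb_true_iff in Hc; cbn [tr_unwound satR].
  - reflexivity.
  - destruct s as [x|f ts]; destruct t as [y|g us]; cbn in Hf;
      rewrite ?andb_true_iff in Hf; try (now destruct Hf); try discriminate;
      cbn in Hc; rewrite ?Nat.ltb_lt in Hc.
    + rewrite (tr_inst_internal k _ _ r 2); auto; [reflexivity|].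
      cbn. intros z [<-|[<-|[]]]; tauto.
    + rewrite (tr_inst_internal k _ _ r (S (length ts))).
      * cbn [rgraph internal]. rewrite map_app, !length_map. reflexivity.
      * intros z Hz. apply in_app_or in Hz as [Hz|[<-|[]]]; [|tauto].
        apply closed_var_of with ts; tauto.
      * rewrite length_app, length_map. cbn. lia.
  - rewrite (tr_inst_internal k _ _ r (length ts)).
    + cbn [rrel internal]. now rewrite !length_map.
    + now apply closed_var_of.
    + apply length_map.
  - cbn [satE]. rewrite IHp1, IHp2; tauto.
  - cbn [satE]. rewrite IHp1, IHp2; tauto.
  - cbn [satE]. rewrite IHp1, IHp2; tauto.
  - rewrite satE_foralls. cbn [satE]. split.
    + intros H d. apply (IHp (S k)); auto. rewrite Hsc, genv_tuple.
      apply H; [now rewrite length_map, length_seq|]. rewrite <- genv_tuple. apply Hdom.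
      apply (proj2_sig d).
    + intros H l Hl Hd. rewrite genv_S in * by auto. apply Hdom in Hd.
      specialize (H (exist _ _ Hd)). apply (IHp (S k)) in H; auto. now rewrite Hsc in H.
  - rewrite satE_exs. cbn [satE]. split.
    + intros (l & Hl & Hd & H). rewrite genv_S in * by auto. apply Hdom in Hd.
      exists (exist _ _ Hd). apply (IHp (S k)); auto. now rewrite Hsc.
    + intros [d H]. exists (map (proj1_sig d) (seq 0 m)).
      rewrite length_map, length_seq, <- genv_tuple. split; auto. split.
      * apply Hdom, (proj2_sig d).
      * rewrite <- Hsc. now apply (IHp (S k)).
Qed.

End Model.

(** The translated existential sentence yields an element of the domain, required as default value
    by [realize]; the translated identity axioms are its [identity_facts]. The parameters are fixed,
    so every choice of them has its own model. *)
Theorem internal_model M E par p0 : satE M E par (tr_unwound T 0 (FEx p0)) ->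
  (forall q, In q (id_axioms src) -> satE M E par (tr_unwound T 0 q)) ->
  exists K EK, congruence K EK /\
    forall p, sentence src p ->
      satE M E par (tr_unwound T 0 (unwind p)) <-> forall rho, satE K EK rho p.
Proof.
  intros Hp0 Hid.
  assert (Hne : exists t, in_dom M E par t).
  { cbn [tr_unwound] in Hp0. apply satE_exs in Hp0 as (l & Hl & Hd & _).
    exists (fun v => nth v l (par 0)). unfold in_dom.
    rewrite <- (genv_0 M par (fun _ _ => par 0)), genv_S in Hd by auto.
    rewrite tr_inst_sat in Hd by (intros x [<-|[]]; lia). revert Hd.
    rewrite (genv_ext _ _ _ _ (fun _ v => nth v l (par 0))); auto.
    intros [|i] Hi; cbn in *; auto; lia. }
  destruct Hne as [t0 Ht0]. set (S0 := internal M E par).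
  set (d0 := exist _ t0 Ht0 : rdom S0).
  assert (Hsem : forall p (r : nat -> tuple M E par), flat p = true -> closed 0 p = true ->
    satE M E par (tr_unwound T 0 p) <-> satR S0 r p).
  { intros p r Hf Hc. unfold S0. rewrite <- (tr_unwound_sat M E par p 0 r) by auto.
    now rewrite genv_0. }
  assert (HI : identity_facts src S0).
  { apply (satR_id_axioms S0 (fun _ => d0)). intros q Hq. apply Hsem.
    - eapply id_axioms_flat; eauto.
    - eapply id_axioms_sentence; eauto.
    - now apply Hid. }
  exists (realize src S0 d0), (req S0).
  pose proof (realize_congruence src S0 d0 HI) as HK.
  split; [exact HK|].
  intros p Hp. pose proof (unwind_formula_in src p 0 Hp) as [Hw Hc].
  pose proof (flat_unwind p) as Hf. split.
  - intros H rho. apply (unwind_sat _ _ HK).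
    apply realize_sat; auto. now apply Hsem.
  - intros H. apply (Hsem _ (fun _ => d0)); auto. apply (realize_sat src S0 d0 HI); auto.
    apply (unwind_sat _ _ HK). apply H.
Qed.

Lemma translate_sat M E rho p : sentence src p ->
  satE M E rho (translate T p) <->
  (exists par, satE M E par (tr_par T)) /\
  forall par, satE M E par (tr_par T) -> satE M E par (tr_unwound T 0 (unwind p)).
Proof.
  intros Hp. destruct (tr_unwound_formula_in (unwind p) 0) as [_ Hc].
  { apply flat_unwind. } { now apply unwind_formula_in. }
  destruct HT as (_ & [_ Hcp] & _). cbn in Hc, Hcp. unfold translate. cbn [satE].
  rewrite satE_exs, satE_foralls. cbn [satE].
  assert (Hpar : forall par q, closed (tr_npar T) q = true ->
    satE M E (appenv (map par (seq 0 (tr_npar T))) rho) q <-> satE M E par q).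
  { intros par q Hq. apply satE_closed with (tr_npar T); auto. intros x Hx.
    rewrite (appenv_lt _ _ (par 0)) by now rewrite length_map, length_seq.
    rewrite map_nth, seq_nth; auto. }
  assert (Hlen : forall par : nat -> dom M, length (map par (seq 0 (tr_npar T))) = tr_npar T)
    by (intros; now rewrite length_map, length_seq).
  split; intros [H1 H2]; split.
  - destruct H1 as (l & Hl & H1). eauto.
  - intros par Hpa. apply (Hpar par); auto. apply H2; auto. now apply Hpar.
  - destruct H1 as [par H1]. exists (map par (seq 0 (tr_npar T))). split; auto. now apply Hpar.
  - intros l Hl Hpa. now apply H2.
Qed.

End Internal.

(** * Certified initial segments *)

Lemma sat_satE M p : forall rho, sat M rho p <-> satE M eq rho p.
Proof.
  induction p; intros rho; cbn; rewrite ?IHp1, ?IHp2; try tauto.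
  - split; intros H d; apply IHp, H.
  - split; intros [d H]; exists d; apply IHp, H.
Qed.

Lemma sat_closed M p k rho rho' : closed k p = true ->
  (forall x, x < k -> rho x = rho' x) -> sat M rho p <-> sat M rho' p.
Proof. intros. rewrite !sat_satE. eapply satE_closed; eauto. Qed.

Section Arith.
Variables (K : structure) (E : dom K -> dom K -> Prop).
Hypothesis HE : congruence K E.

Notation "x == y" := (E x y) (at level 70, no associativity).
Notation zro := (ifun K 0 []).
Notation suc x := (ifun K 1 [x]).
Notation add x y := (ifun K 2 [x; y]).
Notation mul x y := (ifun K 3 [x; y]).
Notation le x y := (irel K 0 [x; y]).

#[local] Instance E_equiv : Equivalence E.
Proof. split; red; apply HE. Qed.
#[local] Instance suc_proper : Proper (E ==> E) (fun x => suc x).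
Proof. intros x y H. apply (cg_fun _ _ HE). auto. Qed.
#[local] Instance fun2_proper f : Proper (E ==> E ==> E) (fun x y => ifun K f [x; y]).
Proof. intros x y H x' y' H'. apply (cg_fun _ _ HE). auto. Qed.
#[local] Instance rel2_proper r : Proper (E ==> E ==> iff) (fun x y => irel K r [x; y]).
Proof.
  intros x y H x' y' H'. split; apply (cg_rel _ _ HE); auto.
  constructor; [now symmetry|]. constructor; auto. now symmetry.
Qed.

Lemma suc_E x y : x == y -> suc x == suc y.
Proof. apply suc_proper. Qed.
Lemma fun2_E f x y x' y' : x == y -> x' == y' -> ifun K f [x; x'] == ifun K f [y; y'].
Proof. intros H H'. now apply fun2_proper. Qed.
Lemma le_E x y x' y' : x == y -> x' == y' -> le x x' <-> le y y'.
Proof. intros H H'. now apply rel2_proper. Qed.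

Definition sucs (n : nat) (x : dom K) : dom K := Nat.iter n (fun x => suc x) x.
Definition nm (n : nat) : dom K := sucs n zro.

Lemma eval_num rho n : eval K rho (num n) = nm n.
Proof.
  induction n as [|n IH]; [reflexivity|].
  change (suc (eval K rho (num n)) = suc (nm n)). now rewrite IH.
Qed.

Lemma sucs_E n x y : x == y -> sucs n x == sucs n y.
Proof. intros H. induction n; cbn; auto. now apply suc_E. Qed.

Lemma sucs_nm i k : sucs i (nm k) = nm (i + k).
Proof. unfold nm, sucs. now rewrite Nat.iter_add. Qed.

(* [K] computes correctly with the numerals up to [n]; in particular sums and
   products overshooting [n] are told apart from the numerals up to [n]. *)
Record good (n : nat) : Prop := {
  g_add : forall i j, i <= n -> j <= n -> add (nm i) (nm j) == nm (i + j);
  g_mul : forall i j, i <= n -> j <= n -> mul (nm i) (nm j) == nm (i * j);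
  g_le : forall j x, j <= n -> le x (nm j) <-> exists i, i <= j /\ x == nm i;
  g_inj : forall a k, a <= n * n + n + 1 -> k <= n -> nm a == nm k -> a = k
}.

Lemma good_eq n a k : good n -> a <= n * n + n + 1 -> k <= n -> nm a == nm k <-> a = k.
Proof.
  intros HG Ha Hk. split; [now apply (g_inj n HG)|]. intros ->. reflexivity.
Qed.

Lemma good_le n i j : good n -> i <= n -> j <= n -> le (nm i) (nm j) <-> i <= j.
Proof.
  intros HG Hi Hj. rewrite (g_le n HG) by auto. split.
  - intros (i' & H1 & H2). apply (g_inj n HG) in H2; lia.
  - intros H. exists i. split; auto. reflexivity.
Qed.

(** An atom of a pure formula applies at most one function symbol, so its value on numbers up to n
    is at most n*n+n+1, the range in which [g_inj] separates numerals. Purity is essential: nested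
    terms could leave this range. *)
Lemma pure_absolute n p : good n -> pure_delta0 p -> forall rho sg,
  (forall x, sg x <= n /\ rho x == nm (sg x)) ->
  satE K E rho p <-> sat nat_structure sg p.
Proof.
  intros HG. induction 1; intros rho sg Hr; cbn.
  - tauto.
  - destruct (Hr x) as [h1 h2], (Hr y) as [h3 h4]. rewrite h2, h4.
    apply (good_eq n); auto; lia.
  - destruct (Hr x) as [h1 h2]. rewrite h2. apply (good_eq n 0); auto; lia.
  - destruct (Hr x) as [h1 h2], (Hr y) as [h3 h4].
    rewrite <- (good_eq n) by (auto; lia). rewrite h4. cbn.
    assert (H : suc (rho x) == suc (nm (sg x))) by now apply suc_E.
    now rewrite H.
  - destruct (Hr x) as [h1 h2], (Hr y) as [h3 h4], (Hr z) as [h5 h6].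
    rewrite <- (good_eq n) by (auto; nia). rewrite h6.
    assert (H : add (rho x) (rho y) == nm (sg x + sg y)).
    { etransitivity; [now apply fun2_E; eauto|]. now apply (g_add n). }
    now rewrite H.
  - destruct (Hr x) as [h1 h2], (Hr y) as [h3 h4], (Hr z) as [h5 h6].
    rewrite <- (good_eq n) by (auto; nia). rewrite h6.
    assert (H : mul (rho x) (rho y) == nm (sg x * sg y)).
    { etransitivity; [now apply fun2_E; eauto|]. now apply (g_mul n). }
    now rewrite H.
  - destruct (Hr x) as [h1 h2], (Hr y) as [h3 h4].
    rewrite (le_E _ _ _ _ h2 h4). now apply (good_le n).
  - rewrite IHpure_delta0_1, IHpure_delta0_2; eauto. tauto.
  - rewrite IHpure_delta0_1, IHpure_delta0_2; eauto. tauto.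
  - rewrite IHpure_delta0_1, IHpure_delta0_2; eauto. tauto.
  - rewrite Nat.add_1_r. cbn. destruct (Hr y) as [h1 h2]. split.
    + intros Hs i Hi. rewrite <- (IHpure_delta0 (scons (nm i) rho)).
      * apply Hs. rewrite (le_E (nm i) (nm i) _ _ ltac:(reflexivity) h2).
        apply (good_le n); auto; lia.
      * intros [|x]; cbn; auto. split; [lia|reflexivity].
    + intros Hs d Hd. rewrite (le_E d d _ _ ltac:(reflexivity) h2) in Hd.
      apply (g_le n HG) in Hd as (i & Hi & Hd); auto.
      apply (IHpure_delta0 _ (scons i sg)).
      * intros [|x]; cbn; auto. split; [lia|auto].
      * apply Hs. lia.
  - rewrite Nat.add_1_r. cbn. destruct (Hr y) as [h1 h2]. split.
    + intros (d & Hd & Hs). rewrite (le_E d d _ _ ltac:(reflexivity) h2) in Hd.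
      apply (g_le n HG) in Hd as (i & Hi & Hd); auto. exists i. split; auto.
      revert Hs. apply IHpure_delta0. intros [|x]; cbn; auto. split; [lia|auto].
    + intros (i & Hi & Hs). exists (nm i). split.
      * rewrite (le_E (nm i) (nm i) _ _ ltac:(reflexivity) h2).
        apply (good_le n); auto; lia.
      * revert Hs. apply IHpure_delta0. intros [|x]; cbn; auto. split; [lia|reflexivity].
Qed.

Record certified (v : dom K) : Prop := {
  c_zero : le zro v;
  c_suc : forall x, le x v /\ ~ x == v -> le (suc x) v;
  c_le0 : forall x, le x zro <-> x == zro;
  c_leS : forall x, le x v /\ ~ x == v -> forall y, le y (suc x) <-> le y x \/ y == suc x;
  c_neq : forall x y z, le x v -> le y v -> le z v -> ~ suc (add (mul x y) z) == zro;
  c_inj : forall x y z w, le x v -> le y v -> le z v -> le w v ->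
    suc (add (mul x y) z) == suc w -> add (mul x y) z == w;
  c_add0 : forall x y, le x v -> le y v -> add (mul x y) zro == mul x y;
  c_addS : forall x y z, le x v -> le y v -> le z v ->
    add (mul x y) (suc z) == suc (add (mul x y) z);
  c_mul0 : forall x, le x v -> mul x zro == zro;
  c_mulS : forall x y, le x v -> le y v -> mul x (suc y) == add (mul x y) x
}.

Lemma cert_sat v rho : satE K E (scons v rho) cert <-> certified v.
Proof.
  cbn. split.
  - intros (h1 & h2 & h3 & h4 & h5 & h6 & h7 & h8 & h9 & h10 & _).
    split; [exact h1|exact h2|exact h3|exact h4| | | | |exact h9|].
    + intros x y z Hx Hy Hz. exact (h5 x Hx y Hy z Hz).
    + intros x y z w Hx Hy Hz Hw. exact (h6 x Hx y Hy z Hz w Hw).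
    + intros x y Hx Hy. exact (h7 x Hx y Hy).
    + intros x y z Hx Hy Hz. exact (h8 x Hx y Hy z Hz).
    + intros x y Hx Hy. exact (h10 x Hx y Hy).
  - intros [h1 h2 h3 h4 h5 h6 h7 h8 h9 h10].
    split; [exact h1|]. split; [exact h2|]. split; [exact h3|]. split; [exact h4|].
    repeat match goal with |- _ /\ _ => split end; auto.
    intros x Hx y Hy z Hz. now apply h5.
Qed.

Section Cert.
Variables (v : dom K) (n : nat).
Hypothesis HC : certified v.
Hypothesis Hbelow : forall i, i < n -> le (nm i) v /\ ~ nm i == v.

Lemma cert_below i : i <= n -> le (nm i) v.
Proof.
  intros Hi. destruct i as [|i]; [apply (c_zero v HC)|].
  apply (c_suc v HC). now apply Hbelow.
Qed.

(** The certificate governs only sums whose left summand is a product, so the recursion for addition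
    is carried out for these. *)
Lemma cert_add x y j : le x v -> le y v -> j <= n ->
  add (mul x y) (nm j) == sucs j (mul x y).
Proof.
  intros Hx Hy. induction j as [|j IH]; intros Hj; [now apply (c_add0 v HC)|].
  etransitivity; [apply (c_addS v HC x y (nm j)); auto; apply cert_below; lia|].
  apply suc_E, IH. lia.
Qed.

Lemma cert_mul i j : i <= n -> j <= n -> mul (nm i) (nm j) == nm (i * j).
Proof.
  intros Hi. induction j as [|j IH]; intros Hj.
  - rewrite Nat.mul_0_r. apply (c_mul0 v HC). now apply cert_below.
  - etransitivity; [apply (c_mulS v HC (nm i) (nm j)); apply cert_below; lia|].
    etransitivity; [apply cert_add; auto; apply cert_below; lia|].
    etransitivity; [apply sucs_E, IH; lia|]. rewrite sucs_nm.
    replace (i + i * j) with (i * S j) by lia. reflexivity.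
Qed.

Lemma cert_muladd i j k : i <= n -> j <= n -> k <= n ->
  add (mul (nm i) (nm j)) (nm k) == nm (i * j + k).
Proof.
  intros Hi Hj Hk.
  etransitivity; [apply cert_add; auto using cert_below|].
  etransitivity; [apply sucs_E, cert_mul; auto|]. rewrite sucs_nm.
  rewrite Nat.add_comm. reflexivity.
Qed.

(** Division by [n]. Through this the certificate reaches numerals beyond [v]: the terms (x×y)+z
    with arguments up to n cover a segment containing all sums and products of such arguments. *)
Lemma muladd_rep a : a <= n * n + n ->
  exists i j k, i <= n /\ j <= n /\ k <= n /\ a = i * j + k.
Proof.
  (* For positive n the quotient would be n+1 in this boundary case, one too many. *)
  intros Ha. destruct (Nat.eq_dec a (n * n + n)) as [->|Hne]; [exists n, n, n; lia|].
  assert (Hn : n <> 0) by (intros ->; lia).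
  exists (a / n), n, (a mod n).
  pose proof (Nat.div_mod a n Hn). pose proof (Nat.mod_upper_bound a n Hn).
  repeat split; try nia.
Qed.

(** Successors of values (x×y)+z are nonzero and can be cancelled against successors of elements
    below [v]. By [muladd_rep] these values include the numerals up to n*n+n, and one more successor
    gives the bound n*n+n+1 in [g_inj]. *)
Lemma cert_good : good n.
Proof.
  split.
  (* Since the left summand has to be a product, zero is read as zero times zero and [S i] as [S i]
     times one; the latter uses 1 <= n, which holds as [S i <= n]. *)
  - intros i j Hi Hj. destruct i as [|i].
    + etransitivity; [apply fun2_E; [symmetry; apply (c_mul0 v HC zro), (c_zero v HC)|reflexivity]|].
      exact (cert_muladd 0 0 j ltac:(lia) ltac:(lia) Hj).
    + assert (H1 : mul (nm (S i)) (nm 1) == nm (S i)).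
      { rewrite <- (Nat.mul_1_r (S i)) at 2. apply cert_mul; lia. }
      etransitivity; [apply fun2_E; [symmetry; apply H1|reflexivity]|].
      rewrite <- (Nat.mul_1_r (S i)) at 2. apply cert_muladd; lia.
  - intros i j. apply cert_mul.
  - intros j x Hj. revert x. induction j as [|j IH]; intros x.
    + rewrite (c_le0 v HC). split.
      * intros H. exists 0. auto.
      * intros (i & Hi & H). now replace i with 0 in H by lia.
    + change (nm (S j)) with (suc (nm j)). rewrite (c_leS v HC) by (apply Hbelow; lia).
      rewrite IH by lia. split.
      * intros [(i & Hi & H)|H]; [exists i|exists (S j)]; auto.
      * intros (i & Hi & H). destruct (Nat.eq_dec i (S j)) as [->|]; [now right|].
        left. exists i. split; [lia|auto].
  - intros a. induction a as [|a IH]; intros [|k] Ha Hk H; auto.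
    + exfalso. symmetry in H. apply (c_neq v HC zro zro (nm k)); try apply (c_zero v HC).
      * apply cert_below. lia.
      * etransitivity; [apply suc_E, (cert_muladd 0 0 k); lia|]. exact H.
    + exfalso. destruct (muladd_rep a) as (x & y & z & Hx & Hy & Hz & ->); [lia|].
      apply (c_neq v HC (nm x) (nm y) (nm z)); auto using cert_below.
      etransitivity; [apply suc_E, cert_muladd; auto|]. exact H.
    + destruct (muladd_rep a) as (x & y & z & Hx & Hy & Hz & Heq); [lia|].
      assert (Hxyz := cert_muladd x y z Hx Hy Hz). rewrite <- Heq in Hxyz.
      f_equal.
      apply IH; try lia. etransitivity; [symmetry; apply Hxyz|].
      apply (c_inj v HC); auto using cert_below; [apply cert_below; lia|].
      etransitivity; [apply suc_E, Hxyz|]. exact H.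
Qed.

End Cert.

Lemma satE_disj_nums rho n :
  satE K E rho (disj_list (map (fun i => FEq (TVar 0) (num i)) (seq 0 (S n)))) <->
  exists i, i <= n /\ rho 0 == nm i.
Proof.
  enough (H : forall l, satE K E rho (disj_list (map (fun i => FEq (TVar 0) (num i)) l)) <->
    exists i, In i l /\ rho 0 == nm i).
  { rewrite H. split; intros (i & Hi & He); exists i; split; auto;
      [apply in_seq in Hi|apply in_seq]; lia. }
  induction l as [|j l IH].
  - cbn. split; [tauto|]. intros (i & [] & _).
  - change (rho 0 == eval K rho (num j) \/
      satE K E rho (disj_list (map (fun i => FEq (TVar 0) (num i)) l)) <->
      exists i, In i (j :: l) /\ rho 0 == nm i).
    rewrite IH, eval_num. split.
    + intros [H|(i & Hi & H)]; [exists j|exists i]; cbn; auto.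
    + intros (i & [<-|Hi] & H); eauto.
Qed.

Lemma certified_false m rho : pure_delta0 m -> closed 1 m = true ->
  ~ true_in_N (FEx m) -> satE K E rho (certified_p m) ->
  forall q, R0p_axiom q -> forall rho', satE K E rho' q.
Proof.
  intros Hm Hc Hf [_ (v & Hv & Hmv & HP)] q Hq rho'.
  apply cert_sat in Hv. cbn in HP.
  (* Strong induction works because [cert_below] and [cert_good] at n use the claim strictly below n
     only; so [good n] is at hand when [v] is supposed to be the numeral n. *)
  assert (Hst : forall n, le (nm n) v /\ ~ nm n == v).
  { intros n. induction n as [n IH] using lt_wf_ind. split; [now apply cert_below with n|].
    intros Hn. apply Hf. exists n.
    apply (sat_closed nat_structure m 1 _ (fun _ => n)); auto; [intros [|x] Hx; [auto|lia]|].
    apply (pure_absolute n m) with (rho := fun _ => v); auto.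
    - now apply cert_good with v.
    - intros x. split; auto. now symmetry.
    - revert Hmv. apply satE_closed with 1; auto. intros [|x] Hx; [auto|lia]. }
  assert (HG : forall n, good n) by (intros n; apply (cert_good v n); auto).
  destruct Hq as [m' n|m' n|m' n Hne|n|m' n Hle|n]; cbn [satE];
    cbn [eval tadd tmul map fle fP satE]; rewrite ?eval_num.
  - apply (g_add (m' + n)); auto; lia.
  - apply (g_mul (m' + n)); auto; lia.
  - cbn. rewrite !eval_num. intros H. apply Hne. apply (g_inj (m' + n)); auto; nia.
  - intros d. rewrite eval_num. intros Hd. apply satE_disj_nums. now apply (g_le n) in Hd.
  - apply (good_le (m' + n)); auto; lia.
  - apply HP. apply Hst.
Qed.

Lemma R0p_good rho : (forall q, R0p_axiom q -> satE K E rho q) -> forall n, good n.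
Proof.
  intros H n. split.
  - intros i j _ _. specialize (H _ (R0_add i j)). cbn in H. now rewrite !eval_num in H.
  - intros i j _ _. specialize (H _ (R0_mul i j)). cbn in H. now rewrite !eval_num in H.
  - intros j x _. split.
    + specialize (H _ (R0_bound j) x). cbn [satE fle eval map] in H.
      rewrite eval_num, satE_disj_nums in H. exact H.
    + intros (i & Hi & Hx). specialize (H _ (R0_le i j Hi)). cbn in H.
      rewrite !eval_num in H. apply (le_E x (nm i) (nm j) (nm j)); auto. reflexivity.
  - intros a k _ _ Hak. destruct (Nat.eq_dec a k) as [|Hne]; auto.
    specialize (H _ (R0_neq a k Hne)). cbn in H. rewrite !eval_num in H. tauto.
Qed.

Lemma certified_true m rho : pure_delta0 m -> closed 1 m = true -> true_in_N (FEx m) ->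
  (forall q, R0p_axiom q -> satE K E rho q) -> satE K E rho (certified_p m).
Proof.
  intros Hm Hc [n Hn] HR. pose proof (R0p_good rho HR) as HG.
  assert (Hadd : forall i j, add (nm i) (nm j) == nm (i + j))
    by (intros i j; apply (g_add (i + j)); auto; lia).
  assert (Hmul : forall i j, mul (nm i) (nm j) == nm (i * j))
    by (intros i j; apply (g_mul (i + j)); auto; lia).
  assert (Hle : forall j x, le x (nm j) <-> exists i, i <= j /\ x == nm i)
    by (intros j x; apply (g_le j); auto).
  assert (Hinj : forall i j, nm i == nm j -> i = j)
    by (intros i j; apply (g_inj (i + j)); auto; nia).
  assert (Hma : forall x y z i j k, x == nm i -> y == nm j -> z == nm k ->
    add (mul x y) z == nm (i * j + k)).
  { intros x y z i j k Hx Hy Hz. etransitivity; [|apply Hadd].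
    apply fun2_E; auto. etransitivity; [|apply Hmul]. now apply fun2_E. }
  assert (HmS : forall x y i j, x == nm i -> y == nm j -> mul x y == nm (i * j)).
  { intros x y i j Hx Hy. etransitivity; [|apply Hmul]. now apply fun2_E. }
  assert (HS : forall x i, x == nm i -> suc x == nm (S i)) by (intros; now apply suc_E).
  assert (H0 : zro == nm 0) by reflexivity.
  cbn [satE certified_p]. split.
  - apply satE_conj_list. intros p Hp. eapply id_axioms_valid; eauto.
  (* The numeral of a true witness of the matrix. By [Hle] everything below it is a numeral, so each
     clause of the certificate reduces to a fact about numerals. *)
  - exists (nm n). split; [|split].
    + apply cert_sat. split.
      * apply Hle. exists 0. split; [lia|auto].
      * intros x [Hx Hne]. apply Hle in Hx as (i & Hi & Hx). apply Hle. exists (S i).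
        split; [|auto]. enough (i <> n) by lia. intros ->. auto.
      * intros x. rewrite (Hle 0 x). split.
        -- intros (i & Hi & Hx). now replace i with 0 in Hx by lia.
        -- intros Hx. exists 0. auto.
      * intros x [Hx _] y. apply Hle in Hx as (i & Hi & Hx). apply HS in Hx as HSx.
        rewrite (le_E y y _ _ ltac:(reflexivity) HSx), (le_E y y _ _ ltac:(reflexivity) Hx).
        rewrite !Hle. split.
        -- intros (j & Hj & Hy). destruct (Nat.eq_dec j (S i)) as [->|].
           ++ right. etransitivity; [exact Hy|]. now symmetry.
           ++ left. exists j. split; [lia|auto].
        -- intros [(j & Hj & Hy)|Hy]; [exists j|exists (S i)]; split; auto.
           etransitivity; [exact Hy|auto].
      * intros x y z Hx Hy Hz Heq.
        apply Hle in Hx as (i & _ & Hx), Hy as (j & _ & Hy), Hz as (k & _ & Hz).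
        specialize (HS _ _ (Hma _ _ _ _ _ _ Hx Hy Hz)).
        enough (S (i * j + k) = 0) by discriminate. apply Hinj.
        etransitivity; [symmetry; exact HS|]. exact Heq.
      * intros x y z w Hx Hy Hz Hw Heq.
        apply Hle in Hx as (i & _ & Hx), Hy as (j & _ & Hy), Hz as (k & _ & Hz),
          Hw as (l & _ & Hw).
        pose proof (Hma _ _ _ _ _ _ Hx Hy Hz) as H1.
        assert (H2 : S (i * j + k) = S l).
        { apply Hinj. etransitivity; [symmetry; apply HS, H1|].
          etransitivity; [exact Heq|]. now apply HS. }
        injection H2 as H2. rewrite H2 in H1. etransitivity; [exact H1|]. now symmetry.
      * intros x y Hx Hy. apply Hle in Hx as (i & _ & Hx), Hy as (j & _ & Hy).
        etransitivity; [now apply (Hma x y zro i j 0)|]. rewrite Nat.add_0_r. symmetry. auto.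
      * intros x y z Hx Hy Hz.
        apply Hle in Hx as (i & _ & Hx), Hy as (j & _ & Hy), Hz as (k & _ & Hz).
        etransitivity; [apply (Hma x y (suc z) i j (S k)); auto|].
        symmetry. rewrite Nat.add_succ_r. auto.
      * intros x Hx. apply Hle in Hx as (i & _ & Hx).
        etransitivity; [now apply (HmS x zro i 0)|]. rewrite Nat.mul_0_r. reflexivity.
      * intros x y Hx Hy. apply Hle in Hx as (i & _ & Hx), Hy as (j & _ & Hy).
        etransitivity; [apply (HmS x (suc y) i (S j)); auto|]. symmetry.
        replace (i * S j) with (i * j + i) by lia. auto.
    + apply (satE_closed K E m 1 _ (fun _ => nm n)); auto; [intros [|x] Hx; [auto|lia]|].
      apply (pure_absolute n m (HG n) Hm _ (fun _ => n)).
      * intros x. split; auto. reflexivity.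
      * revert Hn. apply sat_closed with 1; auto. intros [|x] Hx; [auto|lia].
    + cbn. intros d Hd. apply Hle in Hd as (i & _ & Hd).
      pose proof (HR _ (R0p_P i)) as HP. cbn in HP. rewrite eval_num in HP. revert HP.
      apply (cg_rel _ _ HE). constructor; auto. now symmetry.
Qed.

End Arith.

Lemma num_closed_wf n sg k : nth_error (fun_ar sg) 0 = Some 0 -> nth_error (fun_ar sg) 1 = Some 1 ->
  wf_tm sg (num n) = true /\ closed_tm k (num n) = true.
Proof.
  intros H0 H1. apply has_arity_spec in H0, H1.
  induction n as [|n [IH1 IH2]]; [cbn; now rewrite H0|].
  change (num (S n)) with (tsucc (num n)). cbn. now rewrite H1, IH1, IH2.
Qed.

Lemma formula_in_disj sg k l : (forall p, In p l -> formula_in sg k p) ->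
  formula_in sg k (disj_list l).
Proof.
  intros H. induction l as [|p l IH]; [split; reflexivity|].
  destruct (H p (or_introl eq_refl)) as [H1 H2].
  destruct IH as [H3 H4]; [intros; apply H; now right|].
  split; cbn; now rewrite ?H1, ?H2, ?H3, ?H4.
Qed.

Lemma R0p_sentence q : R0p_axiom q -> sentence sig_ap q.
Proof.
  assert (Hw : forall n, wf_tm sig_ap (num n) = true)
    by (intros; now apply (num_closed_wf n sig_ap 0)).
  assert (Hc : forall n k, closed_tm k (num n) = true)
    by (intros; now apply (num_closed_wf n sig_ap k)).
  assert (Hs : forall n k, shift_tm k (num n) = num n).
  { intros n k. unfold shift_tm. rewrite <- (subst_tm_id (num n)) at 2.
    apply subst_tm_closed with 0; auto. lia. }
  destruct 1 as [m n|m n|m n Hne|n|m n Hle|n]; unfold sentence, formula_in;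
    cbn [wf_form wf_tm closed closed_tm tadd tmul fle fP FNot forallb length];
    rewrite ?Hw, ?Hc; try (split; reflexivity).
  destruct (formula_in_disj sig_ap 1 (map (fun i => FEq (TVar 0) (num i)) (seq 0 (S n))))
    as [h1 h2].
  - intros p Hp. apply in_map_iff in Hp as (i & <- & _). split; cbn; now rewrite ?Hw, ?Hc.
  - rewrite h1, h2. split; reflexivity.
Qed.

Lemma pure_wf p : pure_delta0 p -> wf_form sig_ap p = true.
Proof. induction 1; cbn; rewrite ?IHpure_delta0_1, ?IHpure_delta0_2; auto. Qed.

Lemma pure_flat p : pure_delta0 p -> flat p = true.
Proof. induction 1; cbn; rewrite ?IHpure_delta0_1, ?IHpure_delta0_2; auto. Qed.

Lemma certified_p_sentence m : pure_delta0 m -> closed 1 m = true ->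
  sentence sig_ap (certified_p m).
Proof.
  intros Hm Hc. unfold certified_p.
  destruct (formula_in_conj sig_ap 0 (id_axioms sig_ap)) as [h1 h2];
    [intros; now apply id_axioms_sentence|].
  assert (Hcert : formula_in sig_ap 1 cert) by (split; reflexivity).
  destruct Hcert as [h3 h4].
  split; cbn [wf_form closed].
  - rewrite h1, h3, (pure_wf m Hm). reflexivity.
  - rewrite h2, h4, Hc. reflexivity.
Qed.

(** * Coding finite sets by divisibility *)

Lemma divide_fact m n : 1 <= m <= n -> Nat.divide m (fact n).
Proof.
  induction n as [|n IH]; intros Hm; [lia|].
  destruct (Nat.eq_dec m (S n)) as [->|Hne].
  - exists (fact n). cbn. lia.
  - change (fact (S n)) with (S n * fact n). apply Nat.divide_mul_r, IH. lia.
Qed.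

(** A common divisor is coprime to N!, and it divides N!(y-x), hence y-x. But y-x divides N!, so the
    divisor is 1. *)
Lemma beta_coprime_lt N x y : x < y -> y <= N ->
  Nat.gcd (S (S x * fact N)) (S (S y * fact N)) = 1.
Proof.
  intros Hxy Hy. set (a := fact N). set (g := Nat.gcd _ _).
  assert (Hx : Nat.divide g (S (S x * a))) by apply Nat.gcd_divide_l.
  assert (Hy' : Nat.divide g (S (S y * a))) by apply Nat.gcd_divide_r.
  assert (H1 : forall u, Nat.divide u a -> Nat.divide u g -> u = 1).
  { intros u Hu Hg. apply Nat.divide_1_r. apply (Nat.divide_add_cancel_r u (S x * a)).
    - now apply Nat.divide_mul_r.
    - rewrite Nat.add_1_r. now apply Nat.divide_trans with g. }
  assert (Hga : Nat.gcd g a = 1).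
  { apply H1; [apply Nat.gcd_divide_r|apply Nat.gcd_divide_l]. }
  assert (Hd : Nat.divide g (a * (y - x))).
  { apply (Nat.divide_add_cancel_r g (S (S x * a))); auto.
    replace (S (S x * a) + a * (y - x)) with (S (S y * a)) by nia. exact Hy'. }
  apply Nat.gauss in Hd; auto.
  apply H1; [|apply Nat.divide_refl].
  apply Nat.divide_trans with (y - x); auto. apply divide_fact. lia.
Qed.

Lemma beta_coprime N x y : x <> y -> x <= N -> y <= N ->
  Nat.gcd (S (S x * fact N)) (S (S y * fact N)) = 1.
Proof.
  intros Hne Hx Hy. destruct (Nat.lt_ge_cases x y).
  - now apply beta_coprime_lt.
  - rewrite Nat.gcd_comm. apply beta_coprime_lt; lia.
Qed.

(** The code c is the product of the moduli 1+(x+1)N! of the members. The modulus of a non-member is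
    coprime to every factor, so it does not divide c. This is Gödel's beta function without
    remainders; x+1 in place of x keeps the modulus of 0 from being 1. *)
Lemma set_code (X : list nat) N : (forall x, In x X -> x <= N) ->
  exists a c, forall x, x <= N -> (exists w, w * S (S x * a) = c) <-> In x X.
Proof.
  intros HX. set (a := fact N). set (d := fun x => S (S x * a)).
  exists a, (fold_right (fun x acc => d x * acc) 1 X). intros x Hx. split.
  - intros Hw. assert (Hw' : Nat.divide (d x) (fold_right (fun x acc => d x * acc) 1 X))
      by (destruct Hw as [w Hw]; now exists w). clear Hw.
    induction X as [|y X IH]; cbn [fold_right In] in *.
    + apply Nat.divide_1_r in Hw'. unfold d in Hw'. pose proof (lt_O_fact N). fold a in H.
      cbn in Hw'. lia.
    + destruct (Nat.eq_dec x y) as [->|Hne]; auto. right. apply IH; auto.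
      apply Nat.gauss in Hw'; auto. apply beta_coprime; auto.
  - intros Hi. clear HX. induction X as [|y X IH]; cbn [fold_right In] in *; [tauto|].
    destruct Hi as [->|Hi].
    + exists (fold_right (fun x acc => d x * acc) 1 X). unfold d. lia.
    + destruct (IH Hi) as [w Hw]. exists (d y * w). rewrite <- Hw. unfold d. lia.
Qed.

(** * Horn programs over the natural numbers *)

Inductive ht : Type :=
| HV (i : nat)
| HC (n : nat)
| HAdd (s t : ht)
| HMul (s t : ht)
| HPair (s t : ht).

Fixpoint ev (e : nat -> nat) (t : ht) : nat :=
  match t with
  | HV i => e i
  | HC n => n
  | HAdd s t => ev e s + ev e t
  | HMul s t => ev e s * ev e t
  | HPair s t => cpair (ev e s) (ev e t)
  end.

Fixpoint hbound (n : nat) (t : ht) : bool :=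
  match t with
  | HV i => i <? n
  | HC _ => true
  | HAdd s t | HMul s t | HPair s t => hbound n s && hbound n t
  end.

(* A fact is a list of numbers, by convention a predicate tag followed by the
   arguments. *)
Definition atom := list ht.
Definition clause : Type := atom * list atom.

Inductive horn (P : list clause) : list nat -> Prop :=
| horn_rule c e : In c P ->
    (forall a, In a (snd c) -> horn P (map (ev e) a)) ->
    horn P (map (ev e) (fst c)).

Definition clause_bound (n : nat) (c : clause) : bool :=
  forallb (hbound n) (fst c) && forallb (forallb (hbound n)) (snd c).

(** Turns an atom into a single term whose value is the number of the fact, so that a set of facts
    becomes a set of numbers. *)
Definition enc (a : atom) : ht := fold_right (fun t u => HAdd (HC 1) (HPair t u)) (HC 0) a.

Lemma ev_enc e a : ev e (enc a) = gn_list (map (ev e) a).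
Proof. induction a; cbn; auto. Qed.

Lemma hbound_enc n a : hbound n (enc a) = forallb (hbound n) a.
Proof. induction a as [|t a IH]; cbn; auto. unfold enc in IH. now rewrite IH. Qed.

(** Doubling removes the division by 2 from Cantor pairing, whose graph is then one equation between
    arithmetical terms. *)
Lemma cpair_spec a b z : z = cpair a b <-> z + z = b + b + (a + b) * S (a + b).
Proof.
  pose proof (Cantor.to_nat_spec a b) as H. unfold cpair.
  rewrite (Nat.add_comm b a) in H. lia.
Qed.

Lemma cpair_ge a b : a <= cpair a b /\ b <= cpair a b.
Proof. pose proof (Cantor.to_nat_non_decreasing a b). unfold cpair. lia. Qed.

(** * Bounded formulas expressing Horn derivability *)

Notation satN := (sat nat_structure).

Lemma satN_ex_le x rho p : satN rho (ex_le (TVar x) p) <->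
  exists d, d <= rho x /\ satN (scons d rho) p.
Proof. cbn. rewrite Nat.add_1_r. reflexivity. Qed.

Lemma satN_all_le x rho p : satN rho (all_le (TVar x) p) <->
  forall d, d <= rho x -> satN (scons d rho) p.
Proof. cbn. rewrite Nat.add_1_r. reflexivity. Qed.

(* In a scope entered through [k] quantifiers the variables k, ..., k+4 hold
   the bound N on the coded set, its code (c, a), the global bound b, and the
   query z. *)

Definition bex (k : nat) (p : form) : form := ex_le (TVar (k + 3)) p.

Fixpoint bexs (n k : nat) (p : form) : form :=
  match n with 0 => p | S n => bex k (bexs n (S k) p) end.

Definition fpair (x f y : nat) : form :=
  FEq (tadd (TVar y) (TVar y))
      (tadd (tadd (TVar f) (TVar f))
            (tmul (tadd (TVar x) (TVar f)) (tsucc (tadd (TVar x) (TVar f))))).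

(** Says that variable [y] is the value of [t], the clause variables starting at [e]. Intermediate
    values are sought below the global bound only, so the formula is bounded, and it is sound always
    but complete only for large bounds. *)
Fixpoint fval (t : ht) (e k y : nat) : form :=
  match t with
  | HV i => FEq (TVar y) (TVar (e + i))
  | HC n => FEq (TVar y) (num n)
  | HAdd s t => bex k (bex (S k)
      (FAnd (fval s (2 + e) (2 + k) 1) (FAnd (fval t (2 + e) (2 + k) 0)
        (FEq (TVar (2 + y)) (tadd (TVar 1) (TVar 0))))))
  | HMul s t => bex k (bex (S k)
      (FAnd (fval s (2 + e) (2 + k) 1) (FAnd (fval t (2 + e) (2 + k) 0)
        (FEq (TVar (2 + y)) (tmul (TVar 1) (TVar 0))))))
  | HPair s t => bex k (bex (S k)
      (FAnd (fval s (2 + e) (2 + k) 1) (FAnd (fval t (2 + e) (2 + k) 0)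
        (fpair 1 0 (2 + y)))))
  end.

Fixpoint valb (B : nat) (e : nat -> nat) (t : ht) (y : nat) : Prop :=
  match t with
  | HV i => y = e i
  | HC n => y = n
  | HAdd s t => exists u, u <= B /\ exists w, w <= B /\
      valb B e s u /\ valb B e t w /\ y = u + w
  | HMul s t => exists u, u <= B /\ exists w, w <= B /\
      valb B e s u /\ valb B e t w /\ y = u * w
  | HPair s t => exists u, u <= B /\ exists w, w <= B /\
      valb B e s u /\ valb B e t w /\ y = cpair u w
  end.

Lemma satN_fpair rho x f y : satN rho (fpair x f y) <-> rho y = cpair (rho x) (rho f).
Proof. rewrite cpair_spec. reflexivity. Qed.

Lemma evalN_num rho n : eval nat_structure rho (num n) = n.
Proof.
  induction n as [|n IH]; auto.
  change (S (eval nat_structure rho (num n)) = S n). now rewrite IH.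
Qed.

Lemma satN_fval t : forall rho e k y,
  satN rho (fval t e k y) <-> valb (rho (k + 3)) (fun i => rho (e + i)) t (rho y).
Proof.
  induction t; intros rho e k y; cbn [fval valb].
  - reflexivity.
  - cbn [sat]. now rewrite evalN_num.
  - unfold bex. rewrite satN_ex_le. setoid_rewrite satN_ex_le. cbn [sat].
    setoid_rewrite IHt1. setoid_rewrite IHt2. reflexivity.
  - unfold bex. rewrite satN_ex_le. setoid_rewrite satN_ex_le. cbn [sat].
    setoid_rewrite IHt1. setoid_rewrite IHt2. reflexivity.
  - unfold bex. rewrite satN_ex_le. setoid_rewrite satN_ex_le. cbn [sat].
    setoid_rewrite IHt1. setoid_rewrite IHt2. setoid_rewrite satN_fpair. reflexivity.
Qed.

Lemma valb_sound B e t : forall y, valb B e t y -> y = ev e t.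
Proof.
  induction t; cbn; auto; intros y (u & _ & w & _ & Hu & Hw & ->);
    apply IHt1 in Hu; apply IHt2 in Hw; congruence.
Qed.

Lemma valb_ext n B e e' t : hbound n t = true -> (forall i, i < n -> e i = e' i) ->
  forall y, valb B e t y -> valb B e' t y.
Proof.
  intros Hb He. induction t; cbn in *; rewrite ?andb_true_iff in Hb; auto; intros y.
  - rewrite He; auto. now apply Nat.ltb_lt.
  - destruct Hb. intros (u & Hu & w & Hw & H1 & H2 & ->). exists u. split; auto.
    exists w. split; auto.
  - destruct Hb. intros (u & Hu & w & Hw & H1 & H2 & ->). exists u. split; auto.
    exists w. split; auto.
  - destruct Hb. intros (u & Hu & w & Hw & H1 & H2 & ->). exists u. split; auto.
    exists w. split; auto.
Qed.

(** Bounds are produced as thresholds beyond which everything holds, so that finitely many of them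
    are met by their sum. *)
Lemma valb_complete e t : exists B0, forall B, B0 <= B -> valb B e t (ev e t).
Proof.
  induction t as [i|n|s [b1 H1] t [b2 H2]|s [b1 H1] t [b2 H2]|s [b1 H1] t [b2 H2]]; cbn;
    try (exists 0; auto; fail);
    exists (b1 + b2 + ev e s + ev e t); intros B HB; exists (ev e s); (split; [lia|]);
    exists (ev e t); (split; [lia|]); (split; [apply H1; lia|]); (split; [apply H2; lia|auto]).
Qed.

Lemma satN_bexs n : forall k p rho, satN rho (bexs n k p) <->
  exists l, length l = n /\ (forall u, In u l -> u <= rho (k + 3)) /\ satN (appenv l rho) p.
Proof.
  induction n as [|n IH]; intros k p rho; cbn [bexs].
  - split; [intros H; exists []; cbn; tauto|].
    intros ([|] & Hl & _ & H); [exact H|discriminate].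
  - unfold bex. rewrite satN_ex_le. split.
    + intros (d & Hd & H). apply IH in H as (l & Hl & Hb & H). exists (l ++ [d]).
      rewrite length_app, appenv_app. cbn. split; [lia|]. split; auto.
      intros u Hu. apply in_app_or in Hu as [Hu|[<-|[]]]; auto.
    + intros (l & Hl & Hb & H). destruct (exists_last (l := l)) as (l' & d & ->).
      { intros ->. discriminate. }
      rewrite length_app in Hl. cbn in Hl. rewrite appenv_app in H. exists d. split.
      * apply Hb, in_or_app. cbn; auto.
      * apply IH. exists l'. split; [lia|]. split; auto.
        intros u Hu. apply Hb, in_or_app. auto.
Qed.

Definition fmem (k x : nat) : form :=
  FAnd (fle (TVar x) (TVar k))
       (bex k (FEq (tmul (TVar 0) (tsucc (tmul (tsucc (TVar (S x))) (TVar (S k + 2)))))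
                   (TVar (S k + 1)))).

(** On entry variable 0 is the rank. The quantifiers add the number of the fact, at 1, and its pair
    with the rank, at 0; the rank moves to 2. *)
Definition fatom (a : atom) (e k : nat) : form :=
  bex k (bex (S k) (FAnd (fval (enc a) (2 + e) (2 + k) 1)
                         (FAnd (fpair 2 1 0) (fmem (2 + k) 0)))).

(* Every fact in the coded set carries a rank, and is derived from facts of
   smaller rank. *)
Definition fprem (e k : nat) (a : atom) : form :=
  bex k (FAnd (fle (tsucc (TVar 0)) (TVar 2)) (fatom a (1 + e) (1 + k))).

(** On entry variable 0 is an element of the coded set, so the set data start at 1. Inside, 0 is the
    fact, 1 its rank, the clause variables start at 2, the element is at nv+2 and the set data start
    at nv+3. *)
Definition fclause (nv : nat) (c : clause) : form :=
  bexs nv 1 (bex (nv + 1) (bex (nv + 2)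
    (FAnd (fval (enc (fst c)) 2 (nv + 3) 0)
    (FAnd (fpair 1 0 (nv + 2))
          (conj_list (map (fprem 2 (nv + 3)) (snd c))))))).

(** On entry 0 is b and 1 is z. The quantifiers add a, c and N in this order, which gives the layout
    N, c, a, b, z. The tag 0 is that of the main predicate. All quantifiers are bounded by b or N,
    so b is the only number to be searched for. *)
Definition fprogram (nv : nat) (P : list clause) : form :=
  ex_le (TVar 0) (ex_le (TVar 1) (ex_le (TVar 2)
    (FAnd (bex 0 (fatom [HC 0; HV 0] 5 1))
          (all_le (TVar 0) (FImp (fmem 1 0) (disj_list (map (fclause nv) P))))))).

Definition mem_code (B N c a x : nat) : Prop :=
  x <= N /\ exists w, w <= B /\ w * S (S x * a) = c.

Lemma satN_fmem rho k x : satN rho (fmem k x) <->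
  mem_code (rho (k + 3)) (rho k) (rho (k + 1)) (rho (k + 2)) (rho x).
Proof. unfold fmem, bex. cbn [sat]. rewrite satN_ex_le. reflexivity. Qed.

Definition has_fact (B N c a : nat) (e : nat -> nat) (r : nat) (A : atom) : Prop :=
  exists f, f <= B /\ exists y, y <= B /\
    valb B e (enc A) f /\ y = cpair r f /\ mem_code B N c a y.

Lemma satN_fatom A rho e k : satN rho (fatom A e k) <->
  has_fact (rho (k + 3)) (rho k) (rho (k + 1)) (rho (k + 2)) (fun i => rho (e + i)) (rho 0) A.
Proof.
  unfold fatom, has_fact, bex. rewrite satN_ex_le. setoid_rewrite satN_ex_le. cbn [sat].
  setoid_rewrite satN_fval. setoid_rewrite satN_fpair. setoid_rewrite satN_fmem. reflexivity.
Qed.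

Definition supported (B N c a : nat) (e : nat -> nat) (C : clause) (x : nat) : Prop :=
  exists r, r <= B /\ exists f, f <= B /\ valb B e (enc (fst C)) f /\ x = cpair r f /\
    forall A, In A (snd C) -> exists r', r' <= B /\ S r' <= r /\ has_fact B N c a e r' A.

Lemma satN_conj_list rho l : satN rho (conj_list l) <-> forall p, In p l -> satN rho p.
Proof.
  rewrite sat_satE, satE_conj_list. setoid_rewrite sat_satE. reflexivity.
Qed.

Lemma satN_disj_list rho l : satN rho (disj_list l) <-> exists p, In p l /\ satN rho p.
Proof.
  induction l as [|p l IH].
  - cbn. split; [tauto|]. now intros (p & [] & _).
  - change (satN rho p \/ satN rho (disj_list l) <-> exists q, In q (p :: l) /\ satN rho q).
    rewrite IH. split.
    + intros [H|(q & Hq & H)]; [exists p|exists q]; cbn; auto.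
    + intros (q & [<-|Hq] & H); eauto.
Qed.

Lemma satN_fclause nv C rho : satN rho (fclause nv C) <->
  exists l, length l = nv /\ (forall u, In u l -> u <= rho 4) /\
    supported (rho 4) (rho 1) (rho 2) (rho 3) (appenv l rho) C (rho 0).
Proof.
  unfold fclause. rewrite satN_bexs.
  enough (forall l, length l = nv ->
    (satN (appenv l rho) (bex (nv + 1) (bex (nv + 2)
    (FAnd (fval (enc (fst C)) 2 (nv + 3) 0)
    (FAnd (fpair 1 0 (nv + 2))
          (conj_list (map (fprem 2 (nv + 3)) (snd C))))))) <->
     supported (rho 4) (rho 1) (rho 2) (rho 3) (appenv l rho) C (rho 0))) as H.
  { split; intros (l & Hl & Hb & Hs); exists l; (split; [auto|]); (split; [exact Hb|]);
      now apply H. }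
  intros l <-. unfold bex. rewrite satN_ex_le. setoid_rewrite satN_ex_le. cbn [sat].
  setoid_rewrite satN_fval. setoid_rewrite satN_fpair. setoid_rewrite satN_conj_list.
  assert (Hs : forall x, appenv l rho (length l + x) = rho x) by (intros; apply appenv_add).
  assert (Hs' : forall d f j x, scons f (scons d (appenv l rho)) (length l + S (S x) + j) = rho (x + j)).
  { intros d f j x. replace (length l + S (S x) + j) with (S (S (length l + (x + j)))) by lia.
    apply Hs. }
  unfold supported.
  replace (appenv l rho (length l + 1 + 3)) with (rho 4)
    by (rewrite <- Nat.add_assoc; symmetry; apply Hs).
  assert (H2 : forall d, scons d (appenv l rho) (length l + 2 + 3) = rho 4).
  { intros d. replace (length l + 2 + 3) with (S (length l + 4)) by lia. apply Hs. }
  setoid_rewrite H2.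
  assert (Hprem : forall d f,
    (forall p, In p (map (fprem 2 (length l + 3)) (snd C)) -> satN (scons f (scons d (appenv l rho))) p)
    <-> (forall A, In A (snd C) -> exists r', r' <= rho 4 /\ S r' <= d /\
           has_fact (rho 4) (rho 1) (rho 2) (rho 3) (appenv l rho) r' A)).
  { intros d f.
    assert (Ha : forall A, satN (scons f (scons d (appenv l rho))) (fprem 2 (length l + 3) A) <->
      exists r', r' <= rho 4 /\ S r' <= d /\
           has_fact (rho 4) (rho 1) (rho 2) (rho 3) (appenv l rho) r' A).
    { intros A. unfold fprem, bex. rewrite satN_ex_le. cbn [sat].
      setoid_rewrite satN_fatom. rewrite Hs'.
      replace (1 + (length l + 3)) with (S (length l + 3)) by lia.
      cbn [Nat.add scons]. rewrite !Hs'.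
      replace (scons f (scons d (appenv l rho)) (length l + 3)) with (rho 1); [reflexivity|].
      rewrite <- (Nat.add_0_r (length l + 3)). rewrite Hs'. reflexivity. }
    split.
    - intros H A HA. apply Ha, H, in_map, HA.
    - intros H p Hp. apply in_map_iff in Hp as (A & <- & HA). apply Ha, H, HA. }
  setoid_rewrite Hprem.
  assert (H3 : forall d f, scons f (scons d (appenv l rho)) (length l + 3 + 3) = rho 4).
  { intros d f. apply Hs'. }
  assert (H4 : forall d f, scons f (scons d (appenv l rho)) (length l + 2) = rho 0).
  { intros d f. rewrite <- (Nat.add_0_r (length l + 2)). apply Hs'. }
  setoid_rewrite H3. setoid_rewrite H4. reflexivity.
Qed.

Lemma satN_fprogram nv P b z rho : satN (scons b (scons z rho)) (fprogram nv P) <->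
  exists a, a <= b /\ exists c, c <= b /\ exists N, N <= b /\
  (exists r, r <= b /\ has_fact b N c a (fun i => scons z rho i) r [HC 0; HV 0]) /\
  forall x, x <= N -> mem_code b N c a x -> exists C, In C P /\
    exists l, length l = nv /\ (forall u, In u l -> u <= b) /\
      supported b N c a
        (appenv l (scons x (scons N (scons c (scons a (scons b (scons z rho))))))) C x.
Proof.
  unfold fprogram. rewrite satN_ex_le. setoid_rewrite satN_ex_le. setoid_rewrite satN_ex_le.
  unfold bex. cbn [sat]. setoid_rewrite satN_ex_le. setoid_rewrite satN_all_le.
  setoid_rewrite satN_fatom. cbn [sat]. setoid_rewrite satN_fmem.
  setoid_rewrite satN_disj_list.
  assert (Hcl : forall sg, (exists p, In p (map (fclause nv) P) /\ satN sg p) <->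
    exists C, In C P /\ satN sg (fclause nv C)).
  { intros sg. split.
    - intros (p & Hp & H). apply in_map_iff in Hp as (C & <- & HC). eauto.
    - intros (C & HC & H). exists (fclause nv C). auto using in_map. }
  setoid_rewrite Hcl. setoid_rewrite satN_fclause. reflexivity.
Qed.

(** * Membership of these formulas in Delta_0 *)

Definition d0_in (K : nat) (p : form) : Prop := formula_in sig_a K p /\ delta0 p.

Lemma d0_and K p q : d0_in K p -> d0_in K q -> d0_in K (FAnd p q).
Proof.
  intros [[h1 h2] h3] [[h4 h5] h6]. split; [split; cbn|now constructor]; now rewrite ?h1, ?h2, ?h4, ?h5.
Qed.

Lemma d0_imp K p q : d0_in K p -> d0_in K q -> d0_in K (FImp p q).
Proof.
  intros [[h1 h2] h3] [[h4 h5] h6]. split; [split; cbn|now constructor]; now rewrite ?h1, ?h2, ?h4, ?h5.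
Qed.

Lemma d0_ex_le K x p : x < K -> d0_in (S K) p -> d0_in K (ex_le (TVar x) p).
Proof.
  intros Hx [[h1 h2] h3]. split; [split; cbn|now constructor]; rewrite ?h1, ?h2; auto.
  rewrite !(proj2 (Nat.ltb_lt _ _)) by lia. auto.
Qed.

Lemma d0_all_le K x p : x < K -> d0_in (S K) p -> d0_in K (all_le (TVar x) p).
Proof.
  intros Hx [[h1 h2] h3]. split; [split; cbn|now constructor]; rewrite ?h1, ?h2; auto.
  rewrite !(proj2 (Nat.ltb_lt _ _)) by lia. auto.
Qed.

Lemma d0_bex K k p : k + 3 < K -> d0_in (S K) p -> d0_in K (bex k p).
Proof. apply d0_ex_le. Qed.

Lemma d0_bexs n : forall K k p, k + 3 < K -> d0_in (n + K) p -> d0_in K (bexs n k p).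
Proof.
  induction n as [|n IH]; intros K k p Hk Hp; cbn [bexs]; auto.
  apply d0_bex; auto. apply IH; [lia|]. now replace (n + S K) with (S n + K) by lia.
Qed.

Lemma d0_fpair K x f y : x < K -> f < K -> y < K -> d0_in K (fpair x f y).
Proof.
  intros. split; [split; cbn; auto|constructor].
  rewrite !(proj2 (Nat.ltb_lt _ _)) by lia. auto.
Qed.

Lemma d0_fval t : forall e k y K nv, hbound nv t = true -> e + nv <= K -> k + 3 < K -> y < K ->
  d0_in K (fval t e k y).
Proof.
  induction t; intros e k y K nv Hb He Hk Hy; cbn [hbound] in Hb; rewrite ?andb_true_iff in Hb;
    cbn [fval];
    try (do 2 (apply d0_bex; [lia|]); apply d0_and; [apply IHt1 with nv; try lia; tauto|];
         apply d0_and; [apply IHt2 with nv; try lia; tauto|]; try (apply d0_fpair; lia);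
         (split; [split; cbn; auto|constructor]); now rewrite (proj2 (Nat.ltb_lt _ _)) by lia).
  - apply Nat.ltb_lt in Hb. split; [split; auto|constructor]. cbn.
    now rewrite !(proj2 (Nat.ltb_lt _ _)) by lia.
  - destruct (num_closed_wf n sig_a K eq_refl eq_refl) as [h1 h2].
    split; [split|constructor]; cbn; rewrite ?h1, ?h2, ?andb_true_r; auto.
    now apply Nat.ltb_lt.
Qed.

Lemma d0_fmem K k x : k + 3 < K -> x < K -> d0_in K (fmem k x).
Proof.
  intros. apply d0_and; [|apply d0_bex; auto]; (split; [split; cbn; auto|constructor]);
    rewrite !(proj2 (Nat.ltb_lt _ _)) by lia; auto.
Qed.

Lemma d0_fatom K nv A e k : forallb (hbound nv) A = true -> e + nv <= K -> k + 3 < K -> 0 < K ->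
  d0_in K (fatom A e k).
Proof.
  intros. apply d0_bex; auto. apply d0_bex; [lia|]. apply d0_and.
  - apply d0_fval with nv; try lia. now rewrite hbound_enc.
  - apply d0_and; [apply d0_fpair; lia|apply d0_fmem; lia].
Qed.

Lemma d0_conj K l : (forall p, In p l -> d0_in K p) -> d0_in K (conj_list l).
Proof.
  induction l as [|p l IH]; intros H; [split; [split; auto|repeat constructor]|].
  apply d0_and; [apply H; now left|apply IH; intros; apply H; now right].
Qed.

Lemma d0_disj K l : (forall p, In p l -> d0_in K p) -> d0_in K (disj_list l).
Proof.
  induction l as [|p l IH]; intros H; [split; [split; auto|repeat constructor]|].
  destruct (H p (or_introl eq_refl)) as [[h1 h2] h3].
  destruct IH as [[h4 h5] h6]; [intros; apply H; now right|].
  split; [split|now constructor]; cbn; now rewrite ?h1, ?h2, ?h4, ?h5.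
Qed.

Lemma d0_fclause K nv C : clause_bound nv C = true -> 4 < K -> d0_in K (fclause nv C).
Proof.
  intros HC HK. unfold clause_bound in HC. apply andb_true_iff in HC as [H1 H2].
  rewrite forallb_forall in H2.
  apply d0_bexs; auto. apply d0_bex; [lia|]. apply d0_bex; [lia|].
  apply d0_and; [apply d0_fval with nv; try lia; now rewrite hbound_enc|].
  apply d0_and; [apply d0_fpair; lia|]. apply d0_conj. intros p Hp.
  apply in_map_iff in Hp as (A & <- & HA).
  apply d0_bex; [lia|]. apply d0_and.
  - split; [split; cbn; auto|constructor].
  - apply d0_fatom with nv; auto; lia.
Qed.

Lemma d0_fprogram nv P : forallb (clause_bound nv) P = true -> d0_in 2 (fprogram nv P).
Proof.
  intros HP. rewrite forallb_forall in HP. unfold fprogram.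
  do 3 (apply d0_ex_le; [lia|]). apply d0_and.
  - apply d0_bex; [lia|]. apply d0_fatom with 1; auto; lia.
  - apply d0_all_le; [lia|]. apply d0_imp; [apply d0_fmem; lia|].
    apply d0_disj. intros p Hp. apply in_map_iff in Hp as (C & <- & HC).
    apply d0_fclause; auto.
Qed.

(** * Ranked sets of facts and derivability *)

Definition fact_code (rf : nat * list nat) : nat := cpair (fst rf) (gn_list (snd rf)).

Lemma has_fact_sound B N c a e r A : has_fact B N c a e r A ->
  mem_code B N c a (fact_code (r, map (ev e) A)).
Proof.
  intros (f & _ & y & _ & Hf & -> & H). apply valb_sound in Hf. rewrite ev_enc in Hf.
  now subst f.
Qed.

Definition ranked (P : list clause) (L : list (nat * list nat)) (rf : nat * list nat) : Prop :=
  exists C e, In C P /\ snd rf = map (ev e) (fst C) /\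
    forall A, In A (snd C) -> exists r', r' < fst rf /\ In (r', map (ev e) A) L.

Lemma ranked_incl P L L' rf : incl L L' -> ranked P L rf -> ranked P L' rf.
Proof.
  intros HL (C & e & HC & Hf & H). exists C, e. split; auto. split; auto.
  intros A HA. destruct (H A HA) as (r' & Hr & Hi). eauto.
Qed.

(** The sets for the premises are joined, and the conclusion is added with a rank above those of all
    premises. Supports survive in a larger set, by [ranked_incl]. *)
Lemma horn_ranked P f : horn P f -> exists L r, In (r, f) L /\ forall rf, In rf L -> ranked P L rf.
Proof.
  induction 1 as [C e HC Hp IH].
  assert (HL : forall As, incl As (snd C) -> exists L n, (forall rf, In rf L -> ranked P L rf) /\
    forall A, In A As -> exists r, r < n /\ In (r, map (ev e) A) L).
  { induction As as [|A As IHA]; intros Hi; [exists [], 0; split; intros _ []|].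
    destruct IHA as (L & n & HL & Hn); [intros x Hx; apply Hi; now right|].
    destruct (IH A) as (L' & r & Hr & HL'); [apply Hi; now left|].
    exists (L ++ L'), (n + S r). split.
    - intros rf Hrf. apply in_app_or in Hrf as [Hrf|Hrf]; [apply ranked_incl with L|apply ranked_incl with L'];
        auto using incl_appl, incl_appr, incl_refl.
    - intros A' [<-|HA']; [exists r|destruct (Hn A' HA') as (r' & Hr' & Hin); exists r'];
        (split; [lia|apply in_or_app; auto]). }
  destruct (HL (snd C) (incl_refl _)) as (L & n & HLr & Hn).
  exists ((n, map (ev e) (fst C)) :: L), n. split; [now left|].
  intros rf [<-|Hrf].
  - exists C, e. split; auto. split; auto. intros A HA.
    destruct (Hn A HA) as (r & Hr & Hin). exists r. split; auto. now right.
  - apply ranked_incl with L; auto. apply incl_tl, incl_refl.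
Qed.

Lemma eventually_list {A} (Q : A -> nat -> Prop) (l : list A) :
  (forall x, In x l -> exists b, forall B, b <= B -> Q x B) ->
  exists b, forall B, b <= B -> forall x, In x l -> Q x B.
Proof.
  induction l as [|x l IH]; intros H; [exists 0; intros B _ y []|].
  destruct IH as [b Hb]; [intros; apply H; now right|].
  destruct (H x (or_introl eq_refl)) as [b' Hb']. exists (b + b').
  intros B HB y [<-|Hy]; [apply Hb'|apply Hb]; auto; lia.
Qed.

Theorem horn_sigma1 P nv : forallb (clause_bound nv) P = true ->
  forall z rho, (exists b, satN (scons b (scons z rho)) (fprogram nv P)) <-> horn P [0; z].
Proof.
  intros HP z rho. rewrite forallb_forall in HP. split.
  - intros (b & H). apply satN_fprogram in H as (a & _ & c & _ & N & _ & (r & _ & Hr) & Hcl).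
    apply has_fact_sound in Hr. cbn in Hr.
    assert (Hall : forall r f, mem_code b N c a (fact_code (r, f)) -> horn P f).
    (* Induction on the rank; facts without ranks could support one another in a circle. *)
    { clear r Hr. intros r. induction r as [r IH] using lt_wf_ind. intros f Hf.
      destruct (Hcl _ (proj1 Hf) Hf) as (C & HC & l & _ & _ & r' & _ & f' & _ & Hv & Hx & Hprem).
      apply valb_sound in Hv. rewrite ev_enc in Hv. subst f'.
      apply cpair_inj in Hx as [<- Hx]. apply gn_list_inj in Hx. cbn in Hx. rewrite Hx.
      apply horn_rule; auto. intros A HA. destruct (Hprem A HA) as (r' & _ & Hr' & Hf').
      apply has_fact_sound in Hf'. apply IH with r'; auto. }
    eapply Hall; eauto.
  - intros H. apply horn_ranked in H as (L & r & Hin & HL).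
    set (N := list_max (map fact_code L)).
    assert (HN : forall rf, In rf L -> fact_code rf <= N).
    { intros rf Hrf. assert (Hm := proj1 (list_max_le (map fact_code L) N) (le_n _)).
      rewrite Forall_forall in Hm. apply Hm. now apply in_map. }
    destruct (set_code (map fact_code L) N) as (a & c & Hac).
    { intros x Hx. apply in_map_iff in Hx as (rf & <- & Hrf). auto. }
    assert (Hmem : forall B rf, a + c + N <= B -> In rf L -> mem_code B N c a (fact_code rf)).
    { intros B rf HB Hrf. split; [auto|].
      destruct (proj2 (Hac _ (HN rf Hrf)) (in_map _ _ _ Hrf)) as [w Hw].
      (* The cofactor is at most c, as the other factor is a successor. *)
      exists w. split; auto. nia. }
    assert (Hfact : forall e r A, In (r, map (ev e) A) L ->
      exists b, forall B, b <= B -> has_fact B N c a e r A).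
    { intros e r0 A Hi. destruct (valb_complete e (enc A)) as [b Hb].
      exists (b + a + c + N). intros B HB. specialize (HN _ Hi).
      destruct (cpair_ge r0 (gn_list (map (ev e) A))) as [h1 h2]. unfold fact_code in HN. cbn in HN.
      exists (gn_list (map (ev e) A)). split; [lia|].
      exists (cpair r0 (gn_list (map (ev e) A))). split; [lia|]. split.
      - rewrite <- ev_enc. apply Hb. lia.
      - split; auto. apply (Hmem B (r0, map (ev e) A)); auto. lia. }
    assert (Hsup : exists b, forall B, b <= B -> forall rf, In rf L ->
      exists C e, In C P /\ (forall u, In u (map e (seq 0 nv)) -> u <= B) /\
        supported B N c a e C (fact_code rf)).
    { apply eventually_list. intros [r0 f] Hrf. destruct (HL _ Hrf) as (C & e & HC & Hf & Hprem).
      cbn in Hf. subst f.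
      destruct (valb_complete e (enc (fst C))) as [b1 Hb1].
      destruct (eventually_list (fun A B => exists r', r' <= B /\ S r' <= r0 /\
        has_fact B N c a e r' A) (snd C)) as [b2 Hb2].
      { intros A HA. destruct (Hprem A HA) as (r' & Hr' & Hi).
        destruct (Hfact e r' A Hi) as [b Hb]. exists (b + r0). cbn in Hr'.
        intros B HB. exists r'. split; [lia|]. split; [lia|]. apply Hb. lia. }
      exists (b1 + b2 + N + list_max (map e (seq 0 nv))). intros B HB. exists C, e.
      split; auto. split.
      { intros u Hu. assert (Hm := proj1 (list_max_le (map e (seq 0 nv)) _) (le_n _)).
        rewrite Forall_forall in Hm. specialize (Hm u Hu). lia. }
      specialize (HN _ Hrf). unfold fact_code in HN. cbn in HN.
      destruct (cpair_ge r0 (gn_list (map (ev e) (fst C)))) as [h1 h2].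
      exists r0. split; [lia|]. exists (gn_list (map (ev e) (fst C))). split; [lia|].
      split; [rewrite <- ev_enc; apply Hb1; lia|]. split; auto. apply Hb2. lia. }
    destruct Hsup as [b1 Hb1].
    destruct (Hfact (fun i => scons z rho i) r [HC 0; HV 0] Hin) as [b2 Hb2].
    assert (Hr : r <= N).
    { specialize (HN _ Hin). unfold fact_code in HN. cbn in HN.
      destruct (cpair_ge r (gn_list [0; z])) as [h1 h2]. cbn in *. lia. }
    exists (b1 + b2 + a + c + N). apply satN_fprogram.
    exists a. split; [lia|]. exists c. split; [lia|]. exists N. split; [lia|]. split.
    { exists r. split; [lia|]. apply Hb2. lia. }
    intros x Hx (_ & w & _ & Hw).
    assert (Hi : In x (map fact_code L)) by (apply Hac; eauto).
    apply in_map_iff in Hi as (rf & <- & Hrf).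
    destruct (Hb1 (b1 + b2 + a + c + N) ltac:(lia) rf Hrf) as (C & e & HC & Hu & Hs).
    exists C. split; auto. exists (map e (seq 0 nv)).
    split; [now rewrite length_map, length_seq|]. split; auto.
    (* The formula is evaluated in an environment that keeps only the first nv values of [e]; by
       [clause_bound] the clause mentions no others. *)
    set (e' := appenv (map e (seq 0 nv)) _).
    assert (He : forall i, i < nv -> e i = e' i).
    { intros i Hi. unfold e'. rewrite (appenv_lt _ _ (e 0)) by now rewrite length_map, length_seq.
      rewrite map_nth, seq_nth; auto. }
    specialize (HP C HC). unfold clause_bound in HP. apply andb_true_iff in HP as [HP1 HP2].
    rewrite forallb_forall in HP2.
    destruct Hs as (r0 & Hr0 & f & Hf & Hv & Hxf & Hprem).
    exists r0. split; auto. exists f. split; auto. split.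
    { apply valb_ext with (n := nv) (e := e); auto. now rewrite hbound_enc. }
    split; auto. intros A HA. destruct (Hprem A HA) as (r' & Hr' & Hlt & g & Hg & y & Hy & Hv' & H').
    exists r'. split; auto. split; auto. exists g. split; auto. exists y. split; auto.
    split; auto. apply valb_ext with (n := nv) (e := e); auto. rewrite hbound_enc. auto.
Qed.

(** * A Horn program for interpretability *)

Notation x0 := (HV 0).
Notation x1 := (HV 1).
Notation x2 := (HV 2).
Notation x3 := (HV 3).
Notation x4 := (HV 4).
Notation x5 := (HV 5).
Notation x6 := (HV 6).
Notation x7 := (HV 7).
Notation x8 := (HV 8).
Notation x9 := (HV 9).
Notation x10 := (HV 10).
Notation x11 := (HV 11).

Definition hS (t : ht) : ht := HAdd (HC 1) t.
Definition hnil : ht := HC 0.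
Definition hcons (s t : ht) : ht := hS (HPair s t).
Definition hvar (t : ht) : ht := HPair (HC 0) t.
Definition hfun (f ts : ht) : ht := HPair (HC 1) (HPair f ts).
Definition hbot : ht := HPair (HC 0) (HC 0).
Definition heq (s t : ht) : ht := HPair (HC 1) (HPair s t).
Definition hrel (r ts : ht) : ht := HPair (HC 2) (HPair r ts).
Definition hand (p q : ht) : ht := HPair (HC 3) (HPair p q).
Definition hor (p q : ht) : ht := HPair (HC 4) (HPair p q).
Definition himp (p q : ht) : ht := HPair (HC 5) (HPair p q).
Definition hall (p : ht) : ht := HPair (HC 6) p.
Definition hex (p : ht) : ht := HPair (HC 7) p.
Definition hnot (p : ht) : ht := himp p hbot.
Definition hiff (p q : ht) : ht := hand (himp p q) (himp q p).

(* Codes for the substitutions that occur in [derives] and [tr_inst]. *)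
Inductive sb : Type :=
| SbShift (n : nat)
| SbInst (t : tm)
| SbUp (s : sb)
| SbTr (m : nat) (xs : list nat) (k : nat).

Fixpoint sb_fun (s : sb) : nat -> tm :=
  match s with
  | SbShift n => fun x => TVar (x + n)
  | SbInst t => fun x => match x with 0 => t | S y => TVar y end
  | SbUp s => up (sb_fun s)
  | SbTr m xs k => fun v =>
      if v <? length xs * m then TVar (nth (v / m) xs 0 * m + v mod m)
      else TVar (k * m + (v - length xs * m))
  end.

Fixpoint gn_sb (s : sb) : nat :=
  match s with
  | SbShift n => cpair 0 n
  | SbInst t => cpair 1 (gn_tm t)
  | SbUp s => cpair 2 (gn_sb s)
  | SbTr m xs k => cpair 3 (cpair m (cpair (gn_list xs) k))
  end.

Definition hshift (n : ht) : ht := HPair (HC 0) n.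
Definition hinst (t : ht) : ht := HPair (HC 1) t.
Definition hup (s : ht) : ht := HPair (HC 2) s.
Definition htr (m xs k : ht) : ht := HPair (HC 3) (HPair m (HPair xs k)).

Notation gnl := (fun l : list form => gn_list (map gn_form l)).
Notation gnt := (fun l : list tm => gn_list (map gn_tm l)).

Definition pMain z : atom := [HC 0; z].
Definition pApp s x t : atom := [HC 1; s; x; t].
Definition pSubT s t u : atom := [HC 2; s; t; u].
Definition pSubL s t u : atom := [HC 3; s; t; u].
Definition pSubF s p q : atom := [HC 4; s; p; q].
Definition pShL G H : atom := [HC 5; G; H].
Definition pMem x l : atom := [HC 6; x; l].
Definition pDer G p : atom := [HC 7; G; p].
Definition pNth l i x : atom := [HC 8; l; i; x].
Definition pLen l n : atom := [HC 9; l; n].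
Definition pWfT sg k t : atom := [HC 10; sg; k; t].
Definition pWfL sg k l n : atom := [HC 11; sg; k; l; n].
Definition pWfF sg k p : atom := [HC 12; sg; k; p].
Definition pVarL ts xs : atom := [HC 13; ts; xs].
Definition pAlls n p q : atom := [HC 14; n; p; q].
Definition pExs n p q : atom := [HC 15; n; p; q].
Definition pTrU T k p q : atom := [HC 16; T; k; p; q].
Definition pSnoc l x m : atom := [HC 17; l; x; m].
Definition pVars a n l : atom := [HC 18; a; n; l].
Definition pEqs a b n p : atom := [HC 19; a; b; n; p].
Definition pTrS T p q : atom := [HC 20; T; p; q].
Definition pChk Q T p : atom := [HC 21; Q; T; p].
Definition pChkRel Q T r l : atom := [HC 22; Q; T; r; l].
Definition pChkFun Q T f l : atom := [HC 23; Q; T; f; l].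
Definition pChkAx Q T sg l : atom := [HC 24; Q; T; sg; l].
Definition pWfAr sg o m n ar l : atom := [HC 25; sg; o; m; n; ar; l].
Definition pWfTr sA sW T : atom := [HC 26; sA; sW; T].
Definition pComp c n r : atom := [HC 27; c; n; r].
Definition pPos c a n : atom := [HC 28; c; a; n].
Definition pNum n g : atom := [HC 29; n; g].

Definition cl_list : list clause := [
  (pMem x0 (hcons x0 x1), []);
  (pMem x0 (hcons x1 x2), [pMem x0 x2]);
  (pNth (hcons x0 x1) (HC 0) x0, []);
  (pNth (hcons x0 x1) (hS x2) x3, [pNth x1 x2 x3]);
  (pLen hnil (HC 0), []);
  (pLen (hcons x0 x1) (hS x2), [pLen x1 x2]);
  (pSnoc hnil x0 (hcons x0 hnil), []);
  (pSnoc (hcons x0 x1) x2 (hcons x0 x3), [pSnoc x1 x2 x3]);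
  (pVarL hnil hnil, []);
  (pVarL (hcons (hvar x0) x1) (hcons x0 x2), [pVarL x1 x2]);
  (pVars x0 (HC 0) hnil, []);
  (pVars x0 (hS x1) (hcons (hvar x0) x2), [pVars (hS x0) x1 x2]);
  (pNum (HC 0) (hfun (HC 0) hnil), []);
  (pNum (hS x0) (hfun (HC 1) (hcons x1 hnil)), [pNum x0 x1])
].

(** Division with remainder is done by patterns. In the first clause for [htr] the dimension is x0 +
    S x1, which makes x0 a remainder, and the variable is x4 times the dimension plus x0, with
    quotient x4. In the second, x4 is the length of the list and x5 the number of the parameter. *)
Definition cl_app : list clause := [
  (pApp (hshift x0) x1 (hvar (HAdd x1 x0)), []);
  (pApp (hinst x0) (HC 0) x0, []);
  (pApp (hinst x0) (hS x1) (hvar x1), []);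
  (pApp (hup x0) (HC 0) (hvar (HC 0)), []);
  (pApp (hup x0) (hS x1) x3, [pApp x0 x1 x2; pSubT (hshift (HC 1)) x2 x3]);
  (pApp (htr (HAdd x0 (hS x1)) x2 x3) (HAdd (HMul x4 (HAdd x0 (hS x1))) x0)
        (hvar (HAdd (HMul x5 (HAdd x0 (hS x1))) x0)), [pNth x2 x4 x5]);
  (pApp (htr x0 x2 x3) (HAdd (HMul x4 x0) x5) (hvar (HAdd (HMul x3 x0) x5)), [pLen x2 x4])
].

Definition cl_sub : list clause := [
  (pSubT x0 (hvar x1) x2, [pApp x0 x1 x2]);
  (pSubT x0 (hfun x1 x2) (hfun x1 x3), [pSubL x0 x2 x3]);
  (pSubL x0 hnil hnil, []);
  (pSubL x0 (hcons x1 x2) (hcons x3 x4), [pSubT x0 x1 x3; pSubL x0 x2 x4]);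
  (pSubF x0 hbot hbot, []);
  (pSubF x0 (heq x1 x2) (heq x3 x4), [pSubT x0 x1 x3; pSubT x0 x2 x4]);
  (pSubF x0 (hrel x1 x2) (hrel x1 x3), [pSubL x0 x2 x3]);
  (pSubF x0 (hand x1 x2) (hand x3 x4), [pSubF x0 x1 x3; pSubF x0 x2 x4]);
  (pSubF x0 (hor x1 x2) (hor x3 x4), [pSubF x0 x1 x3; pSubF x0 x2 x4]);
  (pSubF x0 (himp x1 x2) (himp x3 x4), [pSubF x0 x1 x3; pSubF x0 x2 x4]);
  (pSubF x0 (hall x1) (hall x2), [pSubF (hup x0) x1 x2]);
  (pSubF x0 (hex x1) (hex x2), [pSubF (hup x0) x1 x2]);
  (pShL hnil hnil, []);
  (pShL (hcons x0 x1) (hcons x2 x3), [pSubF (hshift (HC 1)) x0 x2; pShL x1 x3])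
].

(* A premise [pSubF (hshift (HC 1)) p _] only asserts that p codes a formula. *)
Definition cl_der : list clause := [
  (pDer x0 x1, [pMem x1 x0]);
  (pDer x0 x1, [pSubF (hshift (HC 1)) x1 x2; pDer (hcons (hnot x1) x0) hbot]);
  (pDer x0 (hand x1 x2), [pDer x0 x1; pDer x0 x2]);
  (pDer x0 x1, [pDer x0 (hand x1 x2)]);
  (pDer x0 x2, [pDer x0 (hand x1 x2)]);
  (pDer x0 (hor x1 x2), [pSubF (hshift (HC 1)) x2 x3; pDer x0 x1]);
  (pDer x0 (hor x1 x2), [pSubF (hshift (HC 1)) x1 x3; pDer x0 x2]);
  (pDer x0 x3, [pDer x0 (hor x1 x2); pDer (hcons x1 x0) x3; pDer (hcons x2 x0) x3]);
  (pDer x0 (himp x1 x2), [pSubF (hshift (HC 1)) x1 x3; pDer (hcons x1 x0) x2]);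
  (pDer x0 x2, [pDer x0 (himp x1 x2); pDer x0 x1]);
  (pDer x0 (hall x1), [pShL x0 x2; pDer x2 x1]);
  (pDer x0 x3, [pDer x0 (hall x1); pSubT (hshift (HC 1)) x2 x4; pSubF (hinst x2) x1 x3]);
  (pDer x0 (hex x1), [pSubT (hshift (HC 1)) x2 x4; pSubF (hinst x2) x1 x3; pDer x0 x3]);
  (pDer x0 x2, [pDer x0 (hex x1); pShL x0 x3; pSubF (hshift (HC 1)) x2 x4;
                pDer (hcons x1 x3) x4]);
  (pDer x0 (heq x1 x1), [pSubT (hshift (HC 1)) x1 x2]);
  (pDer x0 x5, [pDer x0 (heq x1 x2); pSubF (hinst x1) x3 x4; pDer x0 x4;
                pSubF (hinst x2) x3 x5])
].

(** The two syntactic conditions of [formula_in] are checked together. An inequality x < k is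
    expressed by giving k the form x + S d, and the dimension is a successor because it has to be
    positive. *)
Definition cl_wf : list clause := [
  (pWfT x0 (HAdd x1 (hS x2)) (hvar x1), []);
  (pWfT (HPair x0 x1) x2 (hfun x3 x4), [pNth x0 x3 x5; pWfL (HPair x0 x1) x2 x4 x5]);
  (pWfL x0 x1 hnil (HC 0), []);
  (pWfL x0 x1 (hcons x2 x3) (hS x4), [pWfT x0 x1 x2; pWfL x0 x1 x3 x4]);
  (pWfF x0 x1 hbot, []);
  (pWfF x0 x1 (heq x2 x3), [pWfT x0 x1 x2; pWfT x0 x1 x3]);
  (pWfF (HPair x0 x1) x2 (hrel x3 x4), [pNth x1 x3 x5; pWfL (HPair x0 x1) x2 x4 x5]);
  (pWfF x0 x1 (hand x2 x3), [pWfF x0 x1 x2; pWfF x0 x1 x3]);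
  (pWfF x0 x1 (hor x2 x3), [pWfF x0 x1 x2; pWfF x0 x1 x3]);
  (pWfF x0 x1 (himp x2 x3), [pWfF x0 x1 x2; pWfF x0 x1 x3]);
  (pWfF x0 x1 (hall x2), [pWfF x0 (hS x1) x2]);
  (pWfF x0 x1 (hex x2), [pWfF x0 (hS x1) x2]);
  (pWfAr x0 x1 x2 x3 hnil hnil, []);
  (pWfAr x0 x1 x2 x3 (hcons x4 x5) (hcons x6 x7),
    [pWfF x0 (HAdd (HMul (HAdd x1 x4) x2) x3) x6; pWfAr x0 x1 x2 x3 x5 x7]);
  (pWfTr (HPair x0 x1) x2
     (hcons (hS x3) (hcons x4 (hcons x5 (hcons x6 (hcons x7 (hcons x8 (hcons x9 hnil))))))),
    [pWfF x2 x4 x5; pWfF x2 (HAdd (HMul (HC 1) (hS x3)) x4) x6;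
     pWfF x2 (HAdd (HMul (HC 2) (hS x3)) x4) x7;
     pWfAr x2 (HC 1) (hS x3) x4 x0 x8; pWfAr x2 (HC 0) (hS x3) x4 x1 x9])
].

(** The constants given to [pNth] are positions in [gn_translation]: 0 dimension, 1 number of
    parameters, 2 parameter domain, 3 domain, 4 identity, 5 functions, 6 relations. The clauses
    cover flat formulas only. *)
Definition cl_tr : list clause := [
  (pAlls (HC 0) x0 x0, []);
  (pAlls (hS x0) x1 (hall x2), [pAlls x0 x1 x2]);
  (pExs (HC 0) x0 x0, []);
  (pExs (hS x0) x1 (hex x2), [pExs x0 x1 x2]);
  (pTrU x0 x1 hbot hbot, []);
  (pTrU x0 x1 (heq (hvar x2) (hvar x3)) x4,
    [pNth x0 (HC 0) x5; pNth x0 (HC 4) x6;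
     pSubF (htr x5 (hcons x2 (hcons x3 hnil)) x1) x6 x4]);
  (pTrU x0 x1 (heq (hfun x2 x3) (hvar x4)) x5,
    [pNth x0 (HC 0) x6; pNth x0 (HC 5) x7; pNth x7 x2 x8; pVarL x3 x9; pSnoc x9 x4 x10;
     pSubF (htr x6 x10 x1) x8 x5]);
  (pTrU x0 x1 (hrel x2 x3) x5,
    [pNth x0 (HC 0) x6; pNth x0 (HC 6) x7; pNth x7 x2 x8; pVarL x3 x9;
     pSubF (htr x6 x9 x1) x8 x5]);
  (pTrU x0 x1 (hand x2 x3) (hand x4 x5), [pTrU x0 x1 x2 x4; pTrU x0 x1 x3 x5]);
  (pTrU x0 x1 (hor x2 x3) (hor x4 x5), [pTrU x0 x1 x2 x4; pTrU x0 x1 x3 x5]);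
  (pTrU x0 x1 (himp x2 x3) (himp x4 x5), [pTrU x0 x1 x2 x4; pTrU x0 x1 x3 x5]);
  (pTrU x0 x1 (hall x2) x3,
    [pNth x0 (HC 0) x4; pNth x0 (HC 3) x5; pSubF (htr x4 (hcons (HC 0) hnil) (hS x1)) x5 x6;
     pTrU x0 (hS x1) x2 x7; pAlls x4 (himp x6 x7) x3]);
  (pTrU x0 x1 (hex x2) x3,
    [pNth x0 (HC 0) x4; pNth x0 (HC 3) x5; pSubF (htr x4 (hcons (HC 0) hnil) (hS x1)) x5 x6;
     pTrU x0 (hS x1) x2 x7; pExs x4 (hand x6 x7) x3]);
  (pTrS x0 x1 (hand x2 x3),
    [pNth x0 (HC 1) x4; pNth x0 (HC 2) x5; pExs x4 x5 x2; pTrU x0 (HC 0) x1 x6;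
     pAlls x4 (himp x5 x6) x3])
].

(** The identity axioms are built from the arities and checked one symbol at a time. For an axiom x3
    of the interpreted theory a sentence x5 is guessed, with a derivation of their equivalence;
    since [pChk] translates flat formulas only, this replaces unwinding. *)
Definition cl_chk : list clause := [
  (pEqs x0 x1 (HC 0) (himp hbot hbot), []);
  (pEqs x0 x1 (hS x2) (hand (heq (hvar x0) (hvar x1)) x3), [pEqs (hS x0) (hS x1) x2 x3]);
  (pChk x0 x1 x2, [pTrS x1 x2 x3; pDer (hcons x0 hnil) x3]);
  (pChkRel x0 x1 x2 hnil, []);
  (pChkRel x0 x1 x2 (hcons x3 x4),
    [pVars (HC 0) x3 x5; pVars x3 x3 x6; pEqs (HC 0) x3 x3 x7;
     pAlls (HAdd x3 x3) (himp (hand x7 (hrel x2 x5)) (hrel x2 x6)) x8;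
     pChk x0 x1 x8; pChkRel x0 x1 (hS x2) x4]);
  (pChkFun x0 x1 x2 hnil, []);
  (pChkFun x0 x1 x2 (hcons x3 x4),
    [pVars (HC 1) x3 x5; pAlls x3 (hex (heq (hfun x2 x5) (hvar (HC 0)))) x6; pChk x0 x1 x6;
     pVars (HC 2) x3 x7;
     pAlls (HAdd (HC 2) x3)
       (himp (hand (heq (hfun x2 x7) (hvar (HC 0))) (heq (hfun x2 x7) (hvar (HC 1))))
             (heq (hvar (HC 0)) (hvar (HC 1)))) x8;
     pChk x0 x1 x8;
     pVars (HAdd (HC 2) x3) x3 x9; pEqs (HC 2) (HAdd (HC 2) x3) x3 x10;
     pAlls (HAdd (HC 2) (HAdd x3 x3))
       (himp (hand x10 (hand (heq (hvar (HC 0)) (hvar (HC 1))) (heq (hfun x2 x7) (hvar (HC 0)))))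
             (heq (hfun x2 x9) (hvar (HC 1)))) x11;
     pChk x0 x1 x11; pChkFun x0 x1 (hS x2) x4]);
  (pChkAx x0 x1 x2 hnil, []);
  (pChkAx x0 x1 x2 (hcons x3 x4),
    [pWfF x2 (HC 0) x5; pDer hnil (hiff x3 x5); pChk x0 x1 x5; pChkAx x0 x1 x2 x4])
].

(** A universal evaluator. The bounded universal premise of minimization is not Horn, and [pPos]
    collects it by recursion on the bound. *)
Definition cl_comp : list clause := [
  (pComp (HPair (HC 0) (HC 0)) x0 (HC 0), []);
  (pComp (HPair (HC 1) (HC 0)) x0 (hS x0), []);
  (pComp (HPair (HC 2) (HC 0)) (HPair x0 x1) x0, []);
  (pComp (HPair (HC 3) (HC 0)) (HPair x0 x1) x1, []);
  (pComp (HPair (HC 4) (HPair x0 x1)) x2 (HPair x3 x4), [pComp x0 x2 x3; pComp x1 x2 x4]);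
  (pComp (HPair (HC 5) (HPair x0 x1)) x2 x4, [pComp x1 x2 x3; pComp x0 x3 x4]);
  (pComp (HPair (HC 6) (HPair x0 x1)) (HPair x2 (HC 0)) x3, [pComp x0 x2 x3]);
  (pComp (HPair (HC 6) (HPair x0 x1)) (HPair x2 (hS x3)) x5,
    [pComp (HPair (HC 6) (HPair x0 x1)) (HPair x2 x3) x4;
     pComp x1 (HPair x2 (HPair x3 x4)) x5]);
  (pComp (HPair (HC 7) x0) x1 x2, [pComp x0 (HPair x1 x2) (HC 0); pPos x0 x1 x2]);
  (pPos x0 x1 (HC 0), []);
  (pPos x0 x1 (hS x2), [pPos x0 x1 x2; pComp x0 (HPair x1 x2) (hS x3)])
].

Definition cl_base : list clause :=
  cl_list ++ cl_app ++ cl_sub ++ cl_der ++ cl_wf ++ cl_tr ++ cl_chk ++ cl_comp.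

(** ** Soundness of the program *)

Definition M1 (R : nat -> Prop) (a : list nat) : Prop :=
  match a with [x] => R x | _ => True end.
Definition M2 (R : nat -> nat -> Prop) (a : list nat) : Prop :=
  match a with [x; y] => R x y | _ => True end.
Definition M3 (R : nat -> nat -> nat -> Prop) (a : list nat) : Prop :=
  match a with [x; y; z] => R x y z | _ => True end.
Definition M4 (R : nat -> nat -> nat -> nat -> Prop) (a : list nat) : Prop :=
  match a with [x; y; z; u] => R x y z u | _ => True end.
Definition M6 (R : nat -> nat -> nat -> nat -> nat -> nat -> Prop) (a : list nat) : Prop :=
  match a with [x; y; z; u; v; w] => R x y z u v w | _ => True end.

Definition mApp s x t := forall sg, s = gn_sb sg -> t = gn_tm (sb_fun sg x).
Definition mSubT s t u := forall sg, s = gn_sb sg ->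
  exists t0, t = gn_tm t0 /\ u = gn_tm (subst_tm (sb_fun sg) t0).
Definition mSubL s t u := forall sg, s = gn_sb sg ->
  exists ts, t = gnt ts /\ u = gnt (map (subst_tm (sb_fun sg)) ts).
Definition mSubF s p q := forall sg, s = gn_sb sg ->
  exists p0, p = gn_form p0 /\ q = gn_form (subst (sb_fun sg) p0).
Definition mShL G H := forall L, G = gnl L -> H = gnl (map shift L).
Definition mMem x l := forall L, l = gn_list L -> In x L.
Definition mDer G p := forall L, G = gnl L -> exists p0, p = gn_form p0 /\ derives L p0.
Definition mNth l i x := forall L, l = gn_list L -> nth_error L i = Some x.
Definition mLen l n := forall L, l = gn_list L -> length L = n.
Definition mWfT sg k t := forall Sg, sg = gn_sig Sg ->
  exists t0, t = gn_tm t0 /\ wf_tm Sg t0 = true /\ closed_tm k t0 = true.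
Definition mWfL sg k l n := forall Sg, sg = gn_sig Sg ->
  exists ts, l = gnt ts /\ length ts = n /\ forallb (wf_tm Sg) ts = true /\
    forallb (closed_tm k) ts = true.
Definition mWfF sg k p := forall Sg, sg = gn_sig Sg ->
  exists p0, p = gn_form p0 /\ formula_in Sg k p0.
Definition mVarL ts xs := exists X, ts = gnt (map TVar X) /\ xs = gn_list X.
Definition mAlls n p q := forall p0, p = gn_form p0 -> q = gn_form (foralls n p0).
Definition mExs n p q := forall p0, p = gn_form p0 -> q = gn_form (exs n p0).
Definition mTrU T k p q := forall T0, T = gn_translation T0 ->
  exists p0, p = gn_form p0 /\ flat p0 = true /\ q = gn_form (tr_unwound T0 k p0).
Definition mSnoc l x m := forall L, l = gn_list L -> m = gn_list (L ++ [x]).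
Definition mVars a n l := l = gnt (vars a n).
Definition mEqs a b n p := p = gn_form (eqs a b n).
Definition mTrS T p q := forall T0, T = gn_translation T0 ->
  exists p0, p = gn_form p0 /\ flat p0 = true /\ q = gn_form (translate T0 p0).
Definition mChk Q T p := forall Q0 T0, Q = gn_form Q0 -> T = gn_translation T0 ->
  exists p0, p = gn_form p0 /\ flat p0 = true /\ derives [Q0] (translate T0 p0).
Definition mChkRel Q T r l := forall Q0 T0 L, Q = gn_form Q0 -> T = gn_translation T0 ->
  l = gn_list L -> forall i n, nth_error L i = Some n ->
  derives [Q0] (translate T0 (id_rel (r + i) n)).
Definition mChkFun Q T f l := forall Q0 T0 L, Q = gn_form Q0 -> T = gn_translation T0 ->
  l = gn_list L -> forall i n, nth_error L i = Some n ->
  derives [Q0] (translate T0 (id_fun_total (f + i) n)) /\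
  derives [Q0] (translate T0 (id_fun_unique (f + i) n)) /\
  derives [Q0] (translate T0 (id_fun_congr (f + i) n)).
Definition ax_ok (Q0 : form) (T0 : translation) (Sg : signature) (a : form) : Prop :=
  exists b, sentence Sg b /\ flat b = true /\ derives [] (FIff a b) /\
    derives [Q0] (translate T0 b).
Definition mChkAx Q T sg l := forall Q0 T0 Sg L, Q = gn_form Q0 -> T = gn_translation T0 ->
  sg = gn_sig Sg -> l = gnl L -> forall a, In a L -> ax_ok Q0 T0 Sg a.
Definition mWfAr sg o m n ar l := forall Sg AR, sg = gn_sig Sg -> ar = gn_list AR ->
  exists ps, l = gnl ps /\ Forall2 (fun k p => formula_in Sg ((o + k) * m + n) p) AR ps.
Definition mWfTr sA sW T := forall SA SW, sA = gn_sig SA -> sW = gn_sig SW ->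
  exists T0, T = gn_translation T0 /\ wf_translation SA SW T0.
Definition mComp c n r := forall c0, c = gn_code c0 -> computes c0 n r.
Definition mPos c a n := forall c0, c = gn_code c0 ->
  forall m, m < n -> exists k, computes c0 (cpair a m) (S k).
Definition mNum n g := g = gn_tm (num n).

Section Meaning.
Variable mMain : nat -> Prop.

(** The position in the list is the predicate tag. *)
Definition meanings : list (list nat -> Prop) :=
  [M1 mMain; M3 mApp; M3 mSubT; M3 mSubL; M3 mSubF; M2 mShL; M2 mMem; M2 mDer; M3 mNth;
   M2 mLen; M3 mWfT; M4 mWfL; M3 mWfF; M2 mVarL; M3 mAlls; M3 mExs; M4 mTrU; M3 mSnoc;
   M3 mVars; M4 mEqs; M3 mTrS; M3 mChk; M4 mChkRel; M4 mChkFun; M4 mChkAx; M6 mWfAr;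
   M3 mWfTr; M3 mComp; M3 mPos; M2 mNum].

Definition meaning (f : list nat) : Prop :=
  match f with [] => True | t :: a => nth t meanings (fun _ => True) a end.

(** Curried, so that for a concrete clause it computes to a chain of implications. *)
Definition clause_holds (R : list nat -> Prop) (e : nat -> nat) (c : clause) : Prop :=
  fold_right (fun a (acc : Prop) => R (map (ev e) a) -> acc) (R (map (ev e) (fst c))) (snd c).

Lemma clause_holds_iff R e c : clause_holds R e c <->
  ((forall a, In a (snd c) -> R (map (ev e) a)) -> R (map (ev e) (fst c))).
Proof.
  unfold clause_holds. induction (snd c) as [|a l IH]; cbn.
  - split; auto. intros H. apply H. tauto.
  - rewrite IH. split.
    + intros H H'. apply H; auto.
    + intros H Ha H'. apply H. intros b [<-|Hb]; auto.
Qed.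

Definition valid_clause (c : clause) : Prop := forall e, clause_holds meaning e c.

Lemma horn_meaning P f : Forall valid_clause P -> horn P f -> meaning f.
Proof.
  intros HP. induction 1 as [c e Hc _ IH]. rewrite Forall_forall in HP.
  exact (proj1 (clause_holds_iff _ _ _) (HP c Hc e) IH).
Qed.

End Meaning.

Ltac inv_codes :=
  repeat match goal with
  | H : cpair _ _ = cpair _ _ |- _ => apply cpair_inj in H as [? ?]
  | H : S _ = S _ |- _ => injection H as H
  | H : 0 = S _ |- _ => discriminate H
  | H : S _ = 0 |- _ => discriminate H
  | H : gn_form _ = gn_form _ |- _ => apply gn_form_inj in H
  | H : gn_tm _ = gn_tm _ |- _ => apply gn_tm_inj in H
  | H : gn_list _ = gn_list _ |- _ => apply gn_list_inj in H
  | H : cpair _ _ = gn_form ?p |- _ => is_var p; destruct p; cbn in H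
  | H : cpair _ _ = gn_tm ?t |- _ => is_var t; destruct t; cbn in H
  | H : cpair _ _ = gn_sb ?s |- _ => is_var s; destruct s; cbn in H
  | H : cpair _ _ = gn_code ?s |- _ => is_var s; destruct s; cbn in H
  | H : cpair _ _ = gn_sig ?s |- _ => is_var s; destruct s; cbn in H; unfold gn_sig in H; cbn in H
  | H : S _ = gn_list ?s |- _ => is_var s; destruct s; cbn in H
  | H : 0 = gn_list ?s |- _ => is_var s; destruct s; cbn in H
  | H : S _ = gn_list (map _ ?s) |- _ => is_var s; destruct s; cbn in H
  | H : 0 = gn_list (map _ ?s) |- _ => is_var s; destruct s; cbn in H
  end.

Lemma cl_list_sound mm : Forall (valid_clause mm) cl_list.
Proof.
  unfold cl_list. repeat first [apply Forall_nil | apply Forall_cons; [intros e; cbn|]].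
  - intros L H. inv_codes. subst. now left.
  - intros H L H'. inv_codes. right. apply H. congruence.
  - intros L H. inv_codes. subst. auto.
  - intros H L H'. inv_codes. apply H. congruence.
  - intros L H. inv_codes. auto.
  - intros H L H'. inv_codes. cbn. f_equal. apply H. congruence.
  - intros L H. inv_codes. auto.
  - intros H L H'. inv_codes. subst. cbn. rewrite (H L); auto.
  - exists []. auto.
  - intros (X & H1 & H2). exists (e 0 :: X). cbn. now rewrite H1, H2.
  - reflexivity.
  - unfold mVars. intros ->. reflexivity.
  - reflexivity.
  - unfold mNum. intros ->. reflexivity.
Qed.

Lemma cl_app_sound mm : Forall (valid_clause mm) cl_app.
Proof.
  unfold cl_app. repeat first [apply Forall_nil | apply Forall_cons; [intros e; cbn|]].
  - intros sg H. inv_codes; try discriminate. cbn. congruence.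
  - intros sg H. inv_codes; try discriminate. cbn. congruence.
  - intros sg H. inv_codes; try discriminate. cbn. congruence.
  - intros sg H. inv_codes; try discriminate. cbn. congruence.
  - intros H1 H2 sg H. inv_codes; try discriminate. cbn.
    destruct (H2 (SbShift 1) eq_refl) as (t0 & Ht & ->).
    rewrite (H1 sg) in Ht by auto. apply gn_tm_inj in Ht. now subst.
  - intros H1 sg H. inv_codes; try discriminate. cbn.
    assert (Hn := H1 xs ltac:(auto)).
    assert (Hm : m = e 0 + S (e 1)) by auto. rewrite <- Hm.
    assert (Hi : e 4 < length xs) by (apply nth_error_Some; congruence).
    rewrite (proj2 (Nat.ltb_lt _ _)) by nia.
    rewrite Nat.div_add_l, (Nat.div_small (e 0)), Nat.add_0_r by lia.
    rewrite (Nat.add_comm (e 4 * m)), Nat.Div0.mod_add, (Nat.mod_small (e 0)) by lia.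
    rewrite (nth_error_nth xs (e 4) 0 Hn). reflexivity.
  - intros H1 sg H. inv_codes; try discriminate. cbn.
    assert (Hn := H1 xs ltac:(auto)). assert (Hm : e 0 = m) by auto.
    assert (Hk : e 3 = k) by auto. rewrite Hm, Hk, Hn.
    rewrite (proj2 (Nat.ltb_ge _ _)) by lia. cbn. f_equal. lia.
Qed.

Lemma sb_shift_1 p : subst (sb_fun (SbShift 1)) p = shift p.
Proof. unfold shift. cbn. f_equal. extensionality x. now rewrite Nat.add_1_r. Qed.

Lemma cl_sub_sound mm : Forall (valid_clause mm) cl_sub.
Proof.
  unfold cl_sub. repeat first [apply Forall_nil | apply Forall_cons; [intros e; cbn|]].
  - intros H sg Hs. exists (TVar (e 1)). split; auto. now apply H.
  - intros H sg Hs. destruct (H sg Hs) as (ts & -> & ->). now exists (TFun (e 1) ts).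
  - intros sg Hs. now exists [].
  - intros H H' sg Hs. destruct (H sg Hs) as (t & -> & ->), (H' sg Hs) as (ts & -> & ->).
    now exists (t :: ts).
  - intros sg Hs. now exists FBot.
  - intros H H' sg Hs. destruct (H sg Hs) as (t & -> & ->), (H' sg Hs) as (t' & -> & ->).
    now exists (FEq t t').
  - intros H sg Hs. destruct (H sg Hs) as (ts & -> & ->). now exists (FRel (e 1) ts).
  - intros H H' sg Hs. destruct (H sg Hs) as (t & -> & ->), (H' sg Hs) as (t' & -> & ->).
    now exists (FAnd t t').
  - intros H H' sg Hs. destruct (H sg Hs) as (t & -> & ->), (H' sg Hs) as (t' & -> & ->).
    now exists (FOr t t').
  - intros H H' sg Hs. destruct (H sg Hs) as (t & -> & ->), (H' sg Hs) as (t' & -> & ->).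
    now exists (FImp t t').
  - intros H sg Hs. destruct (H (SbUp sg)) as (p & -> & ->); [cbn; congruence|].
    now exists (FAll p).
  - intros H sg Hs. destruct (H (SbUp sg)) as (p & -> & ->); [cbn; congruence|].
    now exists (FEx p).
  - intros L H. inv_codes. auto.
  - intros H H' L HL. inv_codes. cbn. destruct (H (SbShift 1) eq_refl) as (p & Hp & ->).
    assert (f = p) by (apply gn_form_inj; congruence). subst f.
    specialize (H' L ltac:(auto)). rewrite H'. now rewrite sb_shift_1.
Qed.

Lemma cl_der_sound mm : Forall (valid_clause mm) cl_der.
Proof.
  unfold cl_der. repeat first [apply Forall_nil | apply Forall_cons; [intros e; cbn|]].
  - intros H L HL. apply H in HL. apply in_map_iff in HL as (p & <- & Hp).
    exists p. split; auto. now apply d_ax.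
  - intros H H' L HL. destruct (H (SbShift 1) eq_refl) as (p & Hp & _).
    destruct (H' (FNot p :: L)) as (q & Hq & Hd); [cbn; now rewrite Hp, HL|].
    inv_codes; try discriminate. exists p. split; auto. now apply d_raa.
  - intros H H' L HL. destruct (H L HL) as (p & -> & Hp), (H' L HL) as (q & -> & Hq).
    exists (FAnd p q). split; auto. now apply d_andI.
  - intros H L HL. destruct (H L HL) as (p & Hp & Hd). inv_codes; try discriminate.
    eexists; split; eauto. eapply d_andE1; eauto.
  - intros H L HL. destruct (H L HL) as (p & Hp & Hd). inv_codes; try discriminate.
    eexists; split; eauto. eapply d_andE2; eauto.
  - intros H H' L HL. destruct (H (SbShift 1) eq_refl) as (q & -> & _), (H' L HL) as (p & -> & Hp).
    exists (FOr p q). split; auto. now apply d_orI1.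
  - intros H H' L HL. destruct (H (SbShift 1) eq_refl) as (q & -> & _), (H' L HL) as (p & -> & Hp).
    exists (FOr q p). split; auto. now apply d_orI2.
  - intros H H1 H2 L HL. destruct (H L HL) as (p & Hp & Hd). inv_codes; try discriminate.
    destruct (H1 (p1 :: L)) as (r & Hr & Hd1); [cbn; congruence|].
    destruct (H2 (p2 :: L)) as (r' & Hr' & Hd2); [cbn; congruence|].
    rewrite Hr in Hr'. apply gn_form_inj in Hr'. subst r'.
    exists r. split; auto. eapply d_orE; eauto.
  - intros H H' L HL. destruct (H (SbShift 1) eq_refl) as (p & Hp & _).
    destruct (H' (p :: L)) as (q & Hq & Hd); [cbn; now rewrite Hp, HL|].
    exists (FImp p q). split; [cbn; now rewrite Hp, Hq|]. now apply d_impI.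
  - intros H H' L HL. destruct (H L HL) as (p & Hp & Hd), (H' L HL) as (q & Hq & Hd').
    inv_codes; try discriminate. rewrite Hq in *. inv_codes. subst.
    eexists; split; eauto. eapply d_impE; eauto.
  - intros H H' L HL. destruct (H' (map shift L)) as (p & -> & Hd); [now apply H|].
    exists (FAll p). split; auto. now apply d_allI.
  - intros H H1 H2 L HL. destruct (H L HL) as (p & Hp & Hd), (H1 (SbShift 1) eq_refl) as (t & Ht & _).
    destruct (H2 (SbInst t)) as (q & Hq & ->); [cbn; congruence|].
    inv_codes; try discriminate. rewrite Hq in *. inv_codes. subst.
    eexists; split; eauto. now apply (d_allE L p t).
  - intros H1 H2 H L HL. destruct (H L HL) as (p & Hp & Hd), (H1 (SbShift 1) eq_refl) as (t & Ht & _).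
    destruct (H2 (SbInst t)) as (q & -> & Hq); [cbn; congruence|].
    rewrite Hq in *. inv_codes. exists (FEx q). split; auto. apply d_exI with t. subst. exact Hd.
  - intros H H1 H2 H3 L HL. destruct (H L HL) as (p & Hp & Hd).
    destruct (H2 (SbShift 1) eq_refl) as (q & -> & Hq). inv_codes; try discriminate.
    rewrite sb_shift_1 in Hq.
    destruct (H3 (p :: map shift L)) as (r & Hr & Hd').
    { cbn. rewrite (H1 L HL). congruence. }
    rewrite Hq in Hr. inv_codes. subst. exists q. split; auto. eapply d_exE; eauto.
  - intros H L HL. destruct (H (SbShift 1) eq_refl) as (t & -> & _).
    exists (FEq t t). split; auto. apply d_refl.
  - intros H H1 H2 H3 L HL. destruct (H L HL) as (p & Hp & Hd).
    inv_codes; try discriminate.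
    destruct (H1 (SbInst s)) as (q & Hq & Hq'); [cbn; congruence|].
    destruct (H3 (SbInst t)) as (q' & Hq2 & ->); [cbn; congruence|].
    destruct (H2 L HL) as (r & Hr & Hd').
    rewrite Hq in Hq2. rewrite Hq' in Hr. inv_codes. subst.
    eexists; split; eauto. eapply (d_eqE L s t q'); eauto.
Qed.

Lemma cl_wf_sound mm : Forall (valid_clause mm) cl_wf.
Proof.
  unfold cl_wf. repeat first [apply Forall_nil | apply Forall_cons; [intros e; cbn|]].
  - intros Sg _. exists (TVar (e 1)). repeat split; auto. cbn. apply Nat.ltb_lt. lia.
  - intros H H' Sg HS. destruct (H' Sg HS) as (ts & -> & Hl & Hw & Hc).
    exists (TFun (e 3) ts). split; auto. cbn. split; auto. rewrite Hw, andb_true_r.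
    apply has_arity_spec. rewrite Hl. apply H. inv_codes. auto.
  - intros Sg _. exists []. auto.
  - intros H H' Sg HS. destruct (H Sg HS) as (t & -> & Hw & Hc), (H' Sg HS) as (ts & -> & Hl & Hw' & Hc').
    exists (t :: ts). cbn. rewrite Hw, Hc, Hw', Hc', Hl. auto.
  - intros Sg _. exists FBot. repeat split.
  - intros H H' Sg HS. destruct (H Sg HS) as (t & -> & Hw & Hc), (H' Sg HS) as (u & -> & Hw' & Hc').
    exists (FEq t u). split; auto. split; cbn; now rewrite ?Hw, ?Hc.
  - intros H H' Sg HS. destruct (H' Sg HS) as (ts & -> & Hl & Hw & Hc).
    exists (FRel (e 3) ts). split; auto. split; cbn; auto. rewrite Hw, andb_true_r.
    apply has_arity_spec. rewrite Hl. apply H. inv_codes. auto.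
  - intros H H' Sg HS. destruct (H Sg HS) as (t & -> & Hw & Hc), (H' Sg HS) as (u & -> & Hw' & Hc').
    exists (FAnd t u). split; auto. split; cbn; now rewrite ?Hw, ?Hc.
  - intros H H' Sg HS. destruct (H Sg HS) as (t & -> & Hw & Hc), (H' Sg HS) as (u & -> & Hw' & Hc').
    exists (FOr t u). split; auto. split; cbn; now rewrite ?Hw, ?Hc.
  - intros H H' Sg HS. destruct (H Sg HS) as (t & -> & Hw & Hc), (H' Sg HS) as (u & -> & Hw' & Hc').
    exists (FImp t u). split; auto. split; cbn; now rewrite ?Hw, ?Hc.
  - intros H Sg HS. destruct (H Sg HS) as (t & -> & Hw & Hc). now exists (FAll t).
  - intros H Sg HS. destruct (H Sg HS) as (t & -> & Hw & Hc). now exists (FEx t).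
  - intros Sg AR _ HA. exists []. split; auto. inv_codes. constructor.
  - intros H H' Sg AR HS HA. inv_codes. destruct (H Sg HS) as (p & Hp & Hf).
    destruct (H' Sg AR) as (ps & Hps & Hfs); auto. exists (p :: ps). cbn.
    split; [now rewrite Hp, Hps|]. constructor; auto. subst. exact Hf.
  - intros H1 H2 H3 H4 H5 SA SW HA HW. inv_codes.
    destruct (H1 SW HW) as (par & Hpar & Fpar), (H2 SW HW) as (dm & Hdm & Fdm),
      (H3 SW HW) as (eqf & Heq & Feq).
    destruct (H4 SW fun_ar HW) as (fs & Hfs & Ffs); auto.
    destruct (H5 SW rel_ar HW) as (rs & Hrs & Frs); auto.
    exists (Translation (S (e 3)) (e 4) par dm eqf fs rs). split.
    + unfold gn_translation. cbn. now rewrite Hpar, Hdm, Heq, Hfs, Hrs.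
    + repeat split; cbn in *; try tauto; try lia; try apply Fpar; try apply Fdm; try apply Feq;
        auto.
Qed.

Lemma cl_tr_sound mm : Forall (valid_clause mm) cl_tr.
Proof.
  assert (Hbin : forall (T0 : translation) e (R : form -> form -> form) tag,
    (forall p q, gn_form (R p q) = cpair tag (cpair (gn_form p) (gn_form q))) ->
    (forall k p q, tr_unwound T0 k (R p q) = R (tr_unwound T0 k p) (tr_unwound T0 k q)) ->
    (forall p q, flat (R p q) = flat p && flat q) ->
    mTrU (e 0) (e 1) (e 2) (e 4) -> mTrU (e 0) (e 1) (e 3) (e 5) -> e 0 = gn_translation T0 ->
    exists p0, cpair tag (cpair (e 2) (e 3)) = gn_form p0 /\ flat p0 = true /\
      cpair tag (cpair (e 4) (e 5)) = gn_form (tr_unwound T0 (e 1) p0)).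
  { intros T0 e R tag h1 h2 h3 H H' HT.
    destruct (H T0 HT) as (p & -> & Hf & ->), (H' T0 HT) as (q & -> & Hf' & ->).
    exists (R p q). now rewrite h2, h3, !h1, Hf, Hf'. }
  assert (Hnth : forall T T0, T = gn_translation T0 -> forall i x, mNth T i x ->
    nth_error [tr_dim T0; tr_npar T0; gn_form (tr_par T0); gn_form (tr_dom T0);
           gn_form (tr_eq T0); gn_list (map gn_form (tr_fun T0));
           gn_list (map gn_form (tr_rel T0))] i = Some x).
  { intros T T0 -> i x H. now apply H. }
  unfold cl_tr. repeat first [apply Forall_nil | apply Forall_cons; [intros e; cbn|]].
  - intros p ->. reflexivity.
  - intros H p Hp. cbn. now rewrite (H p Hp).
  - intros p ->. reflexivity.
  - intros H p Hp. cbn. now rewrite (H p Hp).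
  - intros T0 _. now exists FBot.
  - intros H1 H2 H3 T0 HT. apply (Hnth _ _ HT) in H1, H2. cbn in H1, H2.
    injection H1 as H1. injection H2 as H2.
    destruct (H3 (SbTr (tr_dim T0) [e 2; e 3] (e 1))) as (p & Hp & ->); [cbn; congruence|].
    exists (FEq (TVar (e 2)) (TVar (e 3))). repeat split; auto.
    rewrite Hp in H2. inv_codes. subst. reflexivity.
  - intros H1 H2 H3 (X & HX & HX') H4 H5 T0 HT. apply (Hnth _ _ HT) in H1, H2. cbn in H1, H2.
    injection H1 as H1. injection H2 as H2. specialize (H3 _ (eq_sym H2)). specialize (H4 X HX').
    rewrite nth_error_map in H3. destruct (nth_error (tr_fun T0) (e 2)) as [p|] eqn:Hn; [|discriminate].
    injection H3 as H3.
    destruct (H5 (SbTr (tr_dim T0) (X ++ [e 4]) (e 1))) as (p' & Hp & ->); [cbn; congruence|].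
    rewrite Hp in H3. inv_codes. subst p'.
    exists (FEq (TFun (e 2) (map TVar X)) (TVar (e 4))). split; [cbn; now rewrite HX|]. split.
    + cbn. rewrite andb_true_r. apply forallb_forall. intros t Ht.
      now apply in_map_iff in Ht as (x & <- & _).
    + cbn. rewrite (nth_error_nth _ _ FBot Hn), map_map, map_id. reflexivity.
  - intros H1 H2 H3 (X & HX & HX') H5 T0 HT. apply (Hnth _ _ HT) in H1, H2. cbn in H1, H2.
    injection H1 as H1. injection H2 as H2. specialize (H3 _ (eq_sym H2)).
    rewrite nth_error_map in H3. destruct (nth_error (tr_rel T0) (e 2)) as [p|] eqn:Hn; [|discriminate].
    injection H3 as H3.
    destruct (H5 (SbTr (tr_dim T0) X (e 1))) as (p' & Hp & ->); [cbn; congruence|].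
    rewrite Hp in H3. inv_codes. subst p'.
    exists (FRel (e 2) (map TVar X)). split; [cbn; now rewrite HX|]. split.
    + cbn. apply forallb_forall. intros t Ht.
      now apply in_map_iff in Ht as (x & <- & _).
    + cbn. rewrite (nth_error_nth _ _ FBot Hn), map_map, map_id. reflexivity.
  - intros H H' T0 HT. now apply (Hbin T0 e FAnd 3).
  - intros H H' T0 HT. now apply (Hbin T0 e FOr 4).
  - intros H H' T0 HT. now apply (Hbin T0 e FImp 5).
  - intros H1 H2 H3 H4 H5 T0 HT. destruct (H4 T0 HT) as (p & -> & Hf & Hq).
    apply (Hnth _ _ HT) in H1, H2. cbn in H1, H2. injection H1 as H1. injection H2 as H2.
    destruct (H3 (SbTr (tr_dim T0) [0] (S (e 1)))) as (d & Hd & Hd'); [cbn; congruence|].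
    rewrite Hd in H2. inv_codes. subst d.
    exists (FAll p). split; auto. split; auto. cbn. rewrite H1. apply H5. cbn.
    rewrite Hd', Hq. reflexivity.
  - intros H1 H2 H3 H4 H5 T0 HT. destruct (H4 T0 HT) as (p & -> & Hf & Hq).
    apply (Hnth _ _ HT) in H1, H2. cbn in H1, H2. injection H1 as H1. injection H2 as H2.
    destruct (H3 (SbTr (tr_dim T0) [0] (S (e 1)))) as (d & Hd & Hd'); [cbn; congruence|].
    rewrite Hd in H2. inv_codes. subst d.
    exists (FEx p). split; auto. split; auto. cbn. rewrite H1. apply H5. cbn.
    rewrite Hd', Hq. reflexivity.
  - intros H1 H2 H3 H4 H5 T0 HT. destruct (H4 T0 HT) as (p & -> & Hf & Hq).
    apply (Hnth _ _ HT) in H1, H2. cbn in H1, H2. injection H1 as H1. injection H2 as H2.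
    exists p. split; auto. split; auto. unfold translate. rewrite (unwind_flat p Hf). cbn.
    rewrite (H3 (tr_par T0)) by auto. rewrite (H5 (FImp (tr_par T0) (tr_unwound T0 0 p))).
    + now rewrite H1.
    + cbn. now rewrite Hq, <- H2.
Qed.

Lemma eqs_S a b n : eqs a b (S n) = FAnd (FEq (TVar a) (TVar b)) (eqs (S a) (S b) n).
Proof.
  unfold eqs. cbn. rewrite !Nat.add_0_r. f_equal. unfold conj_list. f_equal.
  rewrite (map_seq_add _ 1). apply map_ext. intros i. f_equal; f_equal; lia.
Qed.

Lemma cl_chk_sound mm : Forall (valid_clause mm) cl_chk.
Proof.
  unfold cl_chk. repeat first [apply Forall_nil | apply Forall_cons; [intros e; cbn|]].
  - reflexivity.
  - unfold mEqs. intros ->. now rewrite eqs_S.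
  - intros H1 H2 Q0 T0 HQ HT. destruct (H1 T0 HT) as (p & Hp & Hf & Hq).
    destruct (H2 [Q0]) as (q & Hq' & Hd); [cbn; congruence|].
    rewrite Hq in Hq'. inv_codes. subst q. eauto.
  - intros Q0 T0 L _ _ HL i n. inv_codes. now destruct i.
  - unfold mVars, mEqs. intros H1 H2 H3 H4 H5 H6 Q0 T0 L HQ HT HL i n Hn.
    inv_codes. subst n0. destruct i as [|i]; cbn in Hn.
    + injection Hn as <-. rewrite Nat.add_0_r.
      destruct (H5 Q0 T0 HQ HT) as (p & Hp & _ & Hd).
      rewrite (H4 (FImp (FAnd (eqs 0 (e 3) (e 3)) (FRel (e 2) (vars 0 (e 3))))
                 (FRel (e 2) (vars (e 3) (e 3))))) in Hp.
      * inv_codes. subst p. exact Hd.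
      * cbn. now rewrite H1, H2, H3.
    + rewrite Nat.add_succ_r. apply (H6 Q0 T0 L); auto.
  - intros Q0 T0 L _ _ HL i n. inv_codes. now destruct i.
  - unfold mVars, mEqs. intros H1 H2 H3 H4 H5 H6 H7 H8 H9 H10 H11 Q0 T0 L HQ HT HL i n Hn.
    inv_codes. subst n0. destruct i as [|i]; cbn in Hn.
    + injection Hn as <-. rewrite Nat.add_0_r. split; [|split].
      * destruct (H3 Q0 T0 HQ HT) as (p & Hp & _ & Hd).
        rewrite (H2 (FEx (FEq (TFun (e 2) (vars 1 (e 3))) (TVar 0)))) in Hp.
        -- inv_codes. subst p. exact Hd.
        -- cbn. now rewrite H1.
      * destruct (H6 Q0 T0 HQ HT) as (p & Hp & _ & Hd).
        rewrite (H5 (FImp (FAnd (FEq (TFun (e 2) (vars 2 (e 3))) (TVar 0))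
                              (FEq (TFun (e 2) (vars 2 (e 3))) (TVar 1)))
                        (FEq (TVar 0) (TVar 1)))) in Hp.
        -- inv_codes. subst p. exact Hd.
        -- cbn. now rewrite H4.
      * destruct (H10 Q0 T0 HQ HT) as (p & Hp & _ & Hd).
        rewrite (H9 (FImp (FAnd (eqs 2 (2 + e 3) (e 3))
                (FAnd (FEq (TVar 0) (TVar 1)) (FEq (TFun (e 2) (vars 2 (e 3))) (TVar 0))))
          (FEq (TFun (e 2) (vars (2 + e 3) (e 3))) (TVar 1)))) in Hp.
        -- inv_codes. subst p. exact Hd.
        -- rewrite H8, H7, H4. reflexivity.
    + rewrite Nat.add_succ_r. apply (H11 Q0 T0 L); auto.
  - intros Q0 T0 Sg L _ _ _ HL a Ha. inv_codes. destruct Ha.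
  - intros H1 H2 H3 H4 Q0 T0 Sg L HQ HT HS HL a Ha. inv_codes. destruct Ha as [<-|Ha].
    + destruct (H1 Sg HS) as (b & Hb & Fb), (H3 Q0 T0 HQ HT) as (b' & Hb' & Hf & Hd),
        (H2 [] eq_refl) as (c & Hc & Hd').
      rewrite Hb in Hb'. apply gn_form_inj in Hb'. subst b'.
      exists b. split; auto. split; auto. split; auto.
      change (FIff f b) with (FAnd (FImp f b) (FImp b f)).
      replace (FAnd (FImp f b) (FImp b f)) with c; auto.
      apply gn_form_inj. rewrite <- Hc. cbn. congruence.
    + apply (H4 Q0 T0 Sg L); auto.
Qed.

Lemma cl_comp_sound mm : Forall (valid_clause mm) cl_comp.
Proof.
  unfold cl_comp. repeat first [apply Forall_nil | apply Forall_cons; [intros e; cbn|]].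
  - intros c H. inv_codes; try discriminate. constructor.
  - intros c H. inv_codes; try discriminate. constructor.
  - intros c H. inv_codes; try discriminate. constructor.
  - intros c H. inv_codes; try discriminate. constructor.
  - intros H1 H2 c H. inv_codes; try discriminate. constructor; auto.
  - intros H1 H2 c H. inv_codes; try discriminate. econstructor; eauto.
  - intros H1 c H. inv_codes; try discriminate. constructor; auto.
  - intros H1 H2 c H. inv_codes; try discriminate. econstructor; [|eauto].
    apply H1. cbn. congruence.
  - intros H1 H2 c H. inv_codes; try discriminate. constructor; auto.
  - intros c _ m Hm. lia.
  - intros H1 H2 c H m Hm. destruct (Nat.eq_dec m (e 2)) as [->|]; [eexists; eauto|].
    apply H1; auto. lia.
Qed.

Lemma cl_base_sound mm : Forall (valid_clause mm) cl_base.
Proof.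
  unfold cl_base. repeat (apply Forall_app; split).
  - apply cl_list_sound.
  - apply cl_app_sound.
  - apply cl_sub_sound.
  - apply cl_der_sound.
  - apply cl_wf_sound.
  - apply cl_tr_sound.
  - apply cl_chk_sound.
  - apply cl_comp_sound.
Qed.

(** ** Completeness of the program *)

(** In minimization the recursive occurrences stand under a universal and an existential quantifier,
    where the generated principle provides no hypothesis. *)
Lemma computes_nested_ind (R : code -> nat -> nat -> Prop) :
  (forall n, R CZero n 0) ->
  (forall n, R CSucc n (S n)) ->
  (forall a b, R CFst (cpair a b) a) ->
  (forall a b, R CSnd (cpair a b) b) ->
  (forall c d n a b, R c n a -> R d n b -> R (CPair c d) n (cpair a b)) ->
  (forall c d n m k, R d n m -> R c m k -> R (CComp c d) n k) ->
  (forall c d a r, R c a r -> R (CPrec c d) (cpair a 0) r) ->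
  (forall c d a n i r, R (CPrec c d) (cpair a n) i -> R d (cpair a (cpair n i)) r ->
    R (CPrec c d) (cpair a (S n)) r) ->
  (forall c a n, R c (cpair a n) 0 ->
    (forall m, m < n -> exists k, R c (cpair a m) (S k)) -> R (CMin c) a n) ->
  forall c n r, computes c n r -> R c n r.
Proof.
  intros h1 h2 h3 h4 h5 h6 h7 h8 h9. fix IH 4. intros c n r H. destruct H.
  - apply h1.
  - apply h2.
  - apply h3.
  - apply h4.
  - apply h5; apply IH; assumption.
  - eapply h6; apply IH; eassumption.
  - apply h7; apply IH; assumption.
  - eapply h8; apply IH; eassumption.
  - apply h9; [apply IH; assumption|]. intros m Hm. destruct (H0 m Hm) as [k Hk].
    exists k. apply IH. exact Hk.
Qed.

Section Complete.
Variable P : list clause.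
Hypothesis HP : incl cl_base P.

(** Twelve values suffice, since the clauses use the variables [x0] to [x11]. *)
Definition env12 (a0 a1 a2 a3 a4 a5 a6 a7 a8 a9 a10 a11 : nat) (i : nat) : nat :=
  nth i [a0; a1; a2; a3; a4; a5; a6; a7; a8; a9; a10; a11] 0.

Lemma use_clause Q n : incl Q P -> forall a0 a1 a2 a3 a4 a5 a6 a7 a8 a9 a10 a11,
  match nth_error Q n with
  | Some c => clause_holds (horn P) (env12 a0 a1 a2 a3 a4 a5 a6 a7 a8 a9 a10 a11) c
  | None => True
  end.
Proof.
  intros HQ. intros. destruct (nth_error Q n) as [c|] eqn:Hn; auto.
  apply clause_holds_iff, horn_rule. eapply HQ, nth_error_In, Hn.
Qed.

Lemma base_incl :
  incl cl_list P /\ incl cl_app P /\ incl cl_sub P /\ incl cl_der P /\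
  incl cl_wf P /\ incl cl_tr P /\ incl cl_chk P /\ incl cl_comp P.
Proof.
  repeat split; intros c Hc; apply HP; unfold cl_base; rewrite !in_app_iff; tauto.
Qed.

(** Clause variables are found by unification with the conclusion or later with the premises; a
    variable left undetermined gets the value 0. *)
Ltac rule Q n :=
  let H := fresh in
  let HQ := fresh in
  assert (HQ : incl Q P) by apply base_incl;
  pose proof (use_clause Q n HQ) as H; cbn in H; eapply H; clear H HQ;
  try match goal with |- nat => exact 0 end.

Lemma horn_mem L x : In x L -> horn P [6; x; gn_list L].
Proof.
  induction L as [|y L IH]; cbn; [tauto|]. intros [->|H].
  - rule cl_list 0.
  - rule cl_list 1. auto.

Qed.

Lemma horn_nth L : forall i x, nth_error L i = Some x -> horn P [8; gn_list L; i; x].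
Proof.
  induction L as [|y L IH]; intros [|i] x; cbn; try discriminate.
  - intros [= ->]. rule cl_list 2.
  - intros H. rule cl_list 3. auto.

Qed.

Lemma horn_len L : horn P [9; gn_list L; length L].
Proof.
  induction L as [|y L IH]; cbn; [rule cl_list 4|rule cl_list 5; auto].
Qed.

Lemma horn_snoc L x : horn P [17; gn_list L; x; gn_list (L ++ [x])].
Proof.
  induction L as [|y L IH]; cbn; [rule cl_list 6|rule cl_list 7; auto].
Qed.

Lemma horn_varL X : horn P [13; gnt (map TVar X); gn_list X].
Proof.
  induction X as [|y L IH]; cbn; [rule cl_list 8|rule cl_list 9; auto].
Qed.

Lemma horn_vars n : forall a, horn P [18; a; n; gnt (vars a n)].
Proof.
  induction n as [|n IH]; intros a; cbn; [rule cl_list 10|rule cl_list 11; apply IH].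
Qed.

Lemma horn_num n : horn P [29; n; gn_tm (num n)].
Proof.
  induction n as [|n IH]; [rule cl_list 12|].
  change (gn_tm (num (S n))) with (cpair 1 (cpair 1 (S (cpair (gn_tm (num n)) 0)))).
  rule cl_list 13; auto.
Qed.

Fixpoint sb_ok (s : sb) : Prop :=
  match s with SbUp s => sb_ok s | SbTr m _ _ => 1 <= m | _ => True end.

(** Separated from [horn_app] to break a circle: lifting a substitution shifts a term, and the shift
    needs this lemma only for a substitution whose application is immediate. *)
Lemma horn_subT_of s : (forall x, horn P [1; gn_sb s; x; gn_tm (sb_fun s x)]) ->
  forall t, horn P [2; gn_sb s; gn_tm t; gn_tm (subst_tm (sb_fun s) t)].
Proof.
  intros Hs t. induction t as [x|f ts IH] using tm_nested_ind; cbn.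
  - rule cl_sub 0. apply Hs.
  - rule cl_sub 1. clear f. induction IH as [|t ts Ht _ IH]; cbn.
    + rule cl_sub 2.
    + rule cl_sub 3; auto.

Qed.

Lemma horn_app s : sb_ok s -> forall x, horn P [1; gn_sb s; x; gn_tm (sb_fun s x)].
Proof.
  induction s as [n|t|s IH|m xs k]; cbn; intros Hok x.
  - rule cl_app 0.
  - destruct x as [|x]; cbn; [rule cl_app 1|rule cl_app 2].
  - destruct x as [|x]; cbn; [rule cl_app 3|rule cl_app 4; [now apply IH|]].
    apply (horn_subT_of (SbShift 1)). intros y. cbn. rule cl_app 0.
  - destruct (Nat.ltb_spec x (length xs * m)) as [Hx|Hx].
    + pose proof (Nat.mod_upper_bound x m ltac:(lia)) as Hu.
      assert (Hd : x / m < length xs) by (apply Nat.Div0.div_lt_upper_bound; lia).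
      pose proof (Nat.div_mod x m ltac:(lia)) as Hdm.
      set (j := x mod m) in *. set (i := x / m) in *.
      (* The dimension and the variable are brought into the shape of the clause: remainder plus a
         positive rest, and quotient times dimension plus remainder. *)
      assert (Hm : m = j + S (m - j - 1)) by lia.
      replace x with (i * m + j) by lia. cbn [gn_tm]. revert Hm.
      generalize (m - j - 1) as d. intros d Hm. rewrite Hm.
      rule cl_app 5. apply horn_nth. now apply nth_error_nth'.
    + cbn [gn_tm]. replace x with (length xs * m + (x - length xs * m)) at 1 by lia.
      rule cl_app 6. apply horn_len.

Qed.

Lemma horn_subT s t : sb_ok s -> horn P [2; gn_sb s; gn_tm t; gn_tm (subst_tm (sb_fun s) t)].
Proof. intros H. apply horn_subT_of. now apply horn_app. Qed.

Lemma horn_subF p : forall s, sb_ok s ->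
  horn P [4; gn_sb s; gn_form p; gn_form (subst (sb_fun s) p)].
Proof.
  induction p; intros sg Hs; cbn.
  - rule cl_sub 4.
  - rule cl_sub 5; now apply horn_subT.
  - rule cl_sub 6. induction ts; cbn; [rule cl_sub 2|rule cl_sub 3; auto using horn_subT].
  - rule cl_sub 7; auto.
  - rule cl_sub 8; auto.
  - rule cl_sub 9; auto.
  - rule cl_sub 10. now apply (IHp (SbUp sg)).
  - rule cl_sub 11. now apply (IHp (SbUp sg)).

Qed.

Lemma horn_shift p : horn P [4; cpair 0 1; gn_form p; gn_form (shift p)].
Proof. rewrite <- sb_shift_1. now apply (horn_subF p (SbShift 1)). Qed.

Lemma horn_is_tm t : horn P [2; cpair 0 1; gn_tm t; gn_tm (subst_tm (sb_fun (SbShift 1)) t)].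
Proof. now apply (horn_subT (SbShift 1)). Qed.

Lemma horn_inst t p : horn P [4; cpair 1 (gn_tm t); gn_form p; gn_form (inst1 t p)].
Proof. now apply (horn_subF p (SbInst t)). Qed.

Lemma horn_shL L : horn P [5; gnl L; gnl (map shift L)].
Proof.
  induction L; cbn; [rule cl_sub 12|rule cl_sub 13; auto using horn_shift].
Qed.

Lemma horn_der G p : derives G p -> horn P [7; gnl G; gn_form p].
Proof.
  induction 1; cbn in *.
  - rule cl_der 0. apply horn_mem. now apply in_map.
  - rule cl_der 1; [apply horn_shift|eauto].
  - rule cl_der 2; eauto.
  - rule cl_der 3; eauto.
  - rule cl_der 4; eauto.
  - rule cl_der 5; [apply horn_shift|eauto].
  - rule cl_der 6; [apply horn_shift|eauto].
  - rule cl_der 7; eauto.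
  - rule cl_der 8; [apply horn_shift|eauto].
  - rule cl_der 9; eauto.
  - rule cl_der 10; [apply horn_shL|eauto].
  - rule cl_der 11; [eauto|apply horn_is_tm|apply horn_inst].
  - rule cl_der 12; [apply horn_is_tm|apply horn_inst|eauto].
  - rule cl_der 13; [eauto|apply horn_shL|apply horn_shift|eauto].
  - rule cl_der 14. apply horn_is_tm.
  - rule cl_der 15; [eauto|apply horn_inst|eauto|apply horn_inst].

Qed.

Section Wf.
Variable Sg : signature.

Lemma horn_wfT k t : wf_tm Sg t = true -> closed_tm k t = true ->
  horn P [10; gn_sig Sg; k; gn_tm t].
Proof.
  induction t as [x|f ts IH] using tm_nested_ind; cbn; intros Hw Hc.
  - apply Nat.ltb_lt in Hc. replace k with (x + S (k - x - 1)) by lia. rule cl_wf 0.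
  - apply andb_true_iff in Hw as [Ha Hw]. apply has_arity_spec in Ha.
    unfold gn_sig in *. rule cl_wf 1; [apply horn_nth, Ha|]. clear Ha.
    induction IH as [|t ts Ht _ IH]; cbn in *; [rule cl_wf 2|].
    rewrite andb_true_iff in Hw, Hc. rule cl_wf 3; [apply Ht; tauto|apply IH; tauto].

Qed.

Lemma horn_wfL k ts : forallb (wf_tm Sg) ts = true -> forallb (closed_tm k) ts = true ->
  horn P [11; gn_sig Sg; k; gnt ts; length ts].
Proof.
  induction ts as [|t ts IH]; cbn; intros Hw Hc; [rule cl_wf 2|].
  rewrite andb_true_iff in Hw, Hc. rule cl_wf 3; [apply horn_wfT; tauto|apply IH; tauto].

Qed.

Lemma horn_wfF p : forall k, formula_in Sg k p -> horn P [12; gn_sig Sg; k; gn_form p].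
Proof.
  induction p; intros k [Hw Hc]; cbn in *; rewrite ?andb_true_iff in Hw;
    rewrite ?andb_true_iff in Hc.
  - rule cl_wf 4.
  - rule cl_wf 5; apply horn_wfT; tauto.
  - destruct Hw as [Ha Hw]. apply has_arity_spec in Ha.
    pose proof (horn_wfL k ts Hw Hc) as HL. unfold gn_sig in *.
    rule cl_wf 6; [apply horn_nth, Ha|exact HL].
  - rule cl_wf 7; [apply IHp1|apply IHp2]; split; tauto.
  - rule cl_wf 8; [apply IHp1|apply IHp2]; split; tauto.
  - rule cl_wf 9; [apply IHp1|apply IHp2]; split; tauto.
  - rule cl_wf 10. apply IHp. now split.
  - rule cl_wf 11. apply IHp. now split.

Qed.

Lemma horn_wfAr o m n ar ps : Forall2 (fun k p => formula_in Sg ((o + k) * m + n) p) ar ps ->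
  horn P [25; gn_sig Sg; o; m; n; gn_list ar; gnl ps].
Proof.
  induction 1; cbn; [rule cl_wf 12|rule cl_wf 13; auto; now apply horn_wfF].
Qed.

End Wf.

Lemma horn_wfTr SA SW T : wf_translation SA SW T ->
  horn P [26; gn_sig SA; gn_sig SW; gn_translation T].
Proof.
  destruct T as [m n par dm eqf fs rs].
  intros (Hm & Hpar & Hdm & Heq & Hfs & Hrs). cbn in *.
  destruct m as [|m]; [lia|]. unfold gn_translation. cbn.
  unfold gn_sig at 1. rule cl_wf 14.
  - now apply horn_wfF.
  - now apply horn_wfF.
  - now apply horn_wfF.
  - now apply horn_wfAr.
  - now apply horn_wfAr.

Qed.

Lemma horn_alls n p : horn P [14; n; gn_form p; gn_form (foralls n p)].
Proof. induction n; cbn; [rule cl_tr 0|rule cl_tr 1; auto]. Qed.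

Lemma horn_exs n p : horn P [15; n; gn_form p; gn_form (exs n p)].
Proof. induction n; cbn; [rule cl_tr 2|rule cl_tr 3; auto]. Qed.

Section Tr.
Variables (src tgt : signature) (T : translation).
Hypothesis HT : wf_translation src tgt T.

Lemma horn_tr_inst k p xs :
  horn P [4; cpair 3 (cpair (tr_dim T) (cpair (gn_list xs) k)); gn_form p;
          gn_form (tr_inst T k p xs)].
Proof. apply (horn_subF p (SbTr (tr_dim T) xs k)). apply HT. Qed.

Lemma map_TVar_var_of ts : forallb is_var ts = true -> map TVar (map var_of ts) = ts.
Proof.
  induction ts as [|[x|f us] ts IH]; cbn; intros H; try discriminate; auto.
  f_equal. auto.
Qed.

Lemma Forall2_nth_some {A B} (R : A -> B -> Prop) l l' i x d : Forall2 R l l' ->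
  nth_error l i = Some x -> nth_error l' i = Some (nth i l' d).
Proof.
  intros H. revert i. induction H; intros [|i]; cbn; intros He; try discriminate; eauto.
Qed.

Lemma horn_T i x : nth_error [tr_dim T; tr_npar T; gn_form (tr_par T); gn_form (tr_dom T);
           gn_form (tr_eq T); gn_list (map gn_form (tr_fun T));
           gn_list (map gn_form (tr_rel T))] i = Some x ->
  horn P [8; gn_translation T; i; x].
Proof. apply horn_nth. Qed.

Lemma horn_trU p : forall k, flat p = true -> wf_form src p = true ->
  horn P [16; gn_translation T; k; gn_form p; gn_form (tr_unwound T k p)].
Proof.
  induction p; intros k Hf Hw; cbn [flat wf_form] in *; rewrite ?andb_true_iff in Hf;
    rewrite ?andb_true_iff in Hw; cbn [tr_unwound gn_form].
  - rule cl_tr 4.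
  - destruct s as [x|f ts]; destruct t as [y|g us]; cbn [flat is_var] in Hf;
      rewrite ?andb_true_iff in Hf; try (now destruct Hf); try discriminate.
    + cbn [gn_tm]. rule cl_tr 5.
      * now apply horn_T.
      * now apply horn_T.
      * apply (horn_tr_inst k _ [x; y]).
    + destruct Hf as [Hv _], Hw as [Hw _]. cbn in Hw. apply andb_true_iff in Hw as [Ha _].
      apply has_arity_spec in Ha.
      pose proof (Forall2_nth_some _ _ _ f _ FBot (proj1 (proj2 (proj2 (proj2 (proj2 HT))))) Ha) as Hn.
      cbn [gn_tm var_of]. rule cl_tr 6.
      * now apply horn_T.
      * now apply horn_T.
      * apply horn_nth. rewrite nth_error_map, Hn. reflexivity.
      * rewrite <- (map_TVar_var_of ts Hv) at 1. apply horn_varL.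
      * apply horn_snoc.
      * apply horn_tr_inst.
  - destruct Hw as [Ha _]. apply has_arity_spec in Ha.
    pose proof (Forall2_nth_some _ _ _ r _ FBot (proj2 (proj2 (proj2 (proj2 (proj2 HT))))) Ha) as Hn.
    rule cl_tr 7.
    + now apply horn_T.
    + now apply horn_T.
    + apply horn_nth. rewrite nth_error_map, Hn. reflexivity.
    + rewrite <- (map_TVar_var_of ts Hf) at 1. apply horn_varL.
    + apply horn_tr_inst.
  - rule cl_tr 8; [apply IHp1|apply IHp2]; tauto.
  - rule cl_tr 9; [apply IHp1|apply IHp2]; tauto.
  - rule cl_tr 10; [apply IHp1|apply IHp2]; tauto.
  - rule cl_tr 11.
    + now apply horn_T.
    + now apply horn_T.
    + apply (horn_tr_inst (S k) _ [0]).
    + now apply IHp.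
    + apply (horn_alls (tr_dim T)
        (FImp (tr_inst T (S k) (tr_dom T) [0]) (tr_unwound T (S k) p))).
  - rule cl_tr 12.
    + now apply horn_T.
    + now apply horn_T.
    + apply (horn_tr_inst (S k) _ [0]).
    + now apply IHp.
    + apply (horn_exs (tr_dim T)
        (FAnd (tr_inst T (S k) (tr_dom T) [0]) (tr_unwound T (S k) p))).

Qed.

Lemma horn_trS p : flat p = true -> wf_form src p = true ->
  horn P [20; gn_translation T; gn_form p; gn_form (translate T p)].
Proof.
  intros Hf Hw. unfold translate. rewrite (unwind_flat p Hf). cbn [gn_form].
  rule cl_tr 13.
  - now apply horn_T.
  - now apply horn_T.
  - apply horn_exs.
  - now apply horn_trU.
  - apply (horn_alls (tr_npar T) (FImp (tr_par T) (tr_unwound T 0 p))).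

Qed.

Variable Q : form.

Definition chk_ok (p : form) : Prop :=
  flat p = true /\ wf_form src p = true /\ derives [Q] (translate T p).

Lemma horn_chk p : chk_ok p -> horn P [21; gn_form Q; gn_translation T; gn_form p].
Proof.
  intros (Hf & Hw & Hd). rule cl_chk 2; [now apply horn_trS|]. exact (horn_der _ _ Hd).

Qed.

Lemma horn_eqs n : forall a b, horn P [19; a; b; n; gn_form (eqs a b n)].
Proof.
  induction n as [|n IH]; intros a b; [rule cl_chk 0|]. rewrite eqs_S.
  cbn [gn_form gn_tm]. rule cl_chk 1. apply IH.
Qed.

Lemma horn_chkRel L : forall r, (forall i n, nth_error L i = Some n -> chk_ok (id_rel (r + i) n)) ->
  horn P [22; gn_form Q; gn_translation T; r; gn_list L].
Proof.
  induction L as [|n L IH]; intros r H; cbn; [rule cl_chk 3|].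
  rule cl_chk 4.
  - apply horn_vars.
  - apply horn_vars.
  - apply horn_eqs.
  - apply (horn_alls (n + n) (FImp (FAnd (eqs 0 n n) (FRel r (vars 0 n))) (FRel r (vars n n)))).
  - apply (horn_chk (id_rel r n)). rewrite <- (Nat.add_0_r r). now apply (H 0).
  - apply IH. intros i n' Hn. rewrite Nat.add_succ_l, <- Nat.add_succ_r. now apply (H (S i)).

Qed.

Lemma horn_chkFun L : forall f, (forall i n, nth_error L i = Some n ->
    chk_ok (id_fun_total (f + i) n) /\ chk_ok (id_fun_unique (f + i) n) /\
    chk_ok (id_fun_congr (f + i) n)) ->
  horn P [23; gn_form Q; gn_translation T; f; gn_list L].
Proof.
  induction L as [|n L IH]; intros f H; cbn; [rule cl_chk 5|].
  destruct (H 0 n eq_refl) as (h1 & h2 & h3). rewrite Nat.add_0_r in h1, h2, h3.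
  rule cl_chk 6.
  - apply horn_vars.
  - apply (horn_alls n (FEx (FEq (TFun f (vars 1 n)) (TVar 0)))).
  - exact (horn_chk _ h1).
  - apply horn_vars.
  - apply (horn_alls (2 + n) (FImp (FAnd (FEq (TFun f (vars 2 n)) (TVar 0))
                              (FEq (TFun f (vars 2 n)) (TVar 1)))
                        (FEq (TVar 0) (TVar 1)))).
  - exact (horn_chk _ h2).
  - apply (horn_vars n (2 + n)).
  - apply (horn_eqs n 2 (2 + n)).
  - apply (horn_alls (2 + (n + n)) (FImp (FAnd (eqs 2 (2 + n) n)
                (FAnd (FEq (TVar 0) (TVar 1)) (FEq (TFun f (vars 2 n)) (TVar 0))))
          (FEq (TFun f (vars (2 + n) n)) (TVar 1)))).
  - exact (horn_chk _ h3).
  - apply IH. intros i n' Hn. rewrite Nat.add_succ_l, <- Nat.add_succ_r. now apply (H (S i)).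

Qed.

Lemma horn_chkAx L : (forall a, In a L -> ax_ok Q T src a) ->
  horn P [24; gn_form Q; gn_translation T; gn_sig src; gnl L].
Proof.
  induction L as [|a L IH]; intros H; cbn; [rule cl_chk 7|].
  destruct (H a (or_introl eq_refl)) as (b & Hs & Hf & Hd & Hd').
  rule cl_chk 8.
  - apply horn_wfF, Hs.
  - exact (horn_der [] _ Hd).
  - apply horn_chk. repeat split; auto. apply Hs.
  - apply IH. intros; apply H; now right.

Qed.

End Tr.

Lemma horn_comp c n r : computes c n r -> horn P [27; gn_code c; n; r].
Proof.
  revert c n r. apply computes_nested_ind; intros; cbn.
  - rule cl_comp 0.
  - rule cl_comp 1.
  - rule cl_comp 2.
  - rule cl_comp 3.
  - rule cl_comp 4; eauto.
  - rule cl_comp 5; eauto.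
  - rule cl_comp 6; eauto.
  - rule cl_comp 7; eauto.
  - rule cl_comp 8; eauto. clear H.
    induction n as [|n IH]; [rule cl_comp 9|].
    destruct (H0 n) as [k Hk]; [lia|]. rule cl_comp 10; [|eauto].
    apply IH. intros m Hm. apply H0. lia.

Qed.

End Complete.

(** * Interpretability of finitely axiomatized theories *)

(** Each choice of parameters yields an internal model in which a sentence is true iff its
    translation is, at these parameters. Consequences of sentences with true translations therefore
    have true translations, and no derivation has to be translated. *)
Lemma model_transfer src tgt T M E p0 :
  wf_translation src tgt T -> sentence src (FEx p0) -> flat p0 = true ->
  (forall rho, satE M E rho (translate T (FEx p0))) ->
  (forall q, In q (id_axioms src) -> forall rho, satE M E rho (translate T q)) ->
  forall p, sentence src p ->
    (forall K EK, congruence K EK ->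
      (forall s, sentence src s -> (forall rho, satE M E rho (translate T s)) ->
         forall rho, satE K EK rho s) ->
      forall rho, satE K EK rho p) ->
    forall rho, satE M E rho (translate T p).
Proof.
  intros HT Hs0 Hf0 H0 Hid p Hp HK rho. apply (translate_sat src tgt T HT); auto. split.
  - apply (translate_sat src tgt T HT M E rho (FEx p0)); auto.
  - intros par Hpar.
    assert (Htr : forall s, sentence src s -> (forall rho, satE M E rho (translate T s)) ->
      satE M E par (tr_unwound T 0 (unwind s))).
    { intros s Hs Hm. apply (translate_sat src tgt T HT M E rho s Hs); auto. }
    destruct (internal_model src tgt T HT M E par p0) as (K & EK & Hcong & Hsat).
    + rewrite <- (unwind_flat (FEx p0)); auto.
    + intros q Hq. rewrite <- (unwind_flat q) by (eapply id_axioms_flat; eauto).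
      apply Htr; auto. now apply id_axioms_sentence.
    + apply Hsat; auto. apply HK; auto. intros s Hs Hm. apply Hsat; auto.
Qed.

(** Logically valid, but its translation is a real condition on the domain formula: without
    constants in the signature, the identity axioms are compatible with an empty domain. *)
Definition id_nonempty : form := FEx (FEq (TVar 0) (TVar 0)).

Definition interp_check (Q : form) (T : translation) (A : fin_theory) : Prop :=
  (forall q, In q (id_nonempty :: id_axioms (fin_sig A)) -> derives [Q] (translate T q)) /\
  (forall a, In a (fin_ax A) -> ax_ok Q T (fin_sig A) a).

(** Reduces a condition on all theorems of A to finitely many derivations. From an interpretation
    these are instances, the identity axioms being theorems of A; conversely [model_transfer] turns
    every internal model into a model of A. *)
Lemma interprets_iff_check SW Q A : wf_fin_theory A -> closed 0 Q = true ->
  interprets (Theory SW (fun q => q = Q)) A <->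
  exists T, wf_translation (fin_sig A) SW T /\ interp_check Q T A.
Proof.
  intros HA HQ. split.
  - intros (T & HT & Hint). exists T. split; auto.
    assert (HD : forall p, sentence (fin_sig A) p -> proves A p -> derives [Q] (translate T p)).
    { intros p Hs Hp. destruct (Hint p Hs Hp) as (G & HG & Hd). eapply derives_weaken; eauto.
      intros q Hq. rewrite (HG q Hq). now left. }
    assert (HAc : forall q, In q (fin_ax A) -> closed 0 q = true) by (intros; now apply HA).
    split.
    + intros q Hq. assert (Hs : sentence (fin_sig A) q).
      { destruct Hq as [<-|Hq]; [split; reflexivity|now apply id_axioms_sentence]. }
      apply HD; auto. apply (completeness (fun p => In p (fin_ax A))); auto; [apply Hs|].
      intros M E HE _ rho. destruct Hq as [<-|Hq].
      * exists (rho 0). apply (cg_refl _ _ HE).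
      * eapply id_axioms_valid; eauto.
    (* The flat companion of an axiom is its own unwinding, equivalent to it by completeness with no
       axioms. *)
    + intros a Ha. exists (unwind a). split; [now apply unwind_formula_in, HA|].
      split; [apply flat_unwind|]. split.
      * destruct (completeness (fun _ => False) (FIff a (unwind a))) as (G & HG & Hd).
        -- tauto.
        -- pose proof (HA a Ha) as Hs. destruct (unwind_formula_in _ _ _ Hs) as [_ h].
           destruct Hs as [_ h']. cbn. now rewrite h, h'.
        -- intros M E HE _ rho. cbn. pose proof (unwind_sat M E HE a rho). tauto.
        -- destruct G as [|q G]; auto. destruct (HG q (or_introl eq_refl)).
      (* Unwinding a flat formula changes nothing, so both translations are the same formula. *)
      * replace (translate T (unwind a)) with (translate T a).
        -- apply HD; [now apply HA|]. exists [a]. split; [intros q [<-|[]]; auto|].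
           apply d_ax. now left.
        -- unfold translate. now rewrite (unwind_flat (unwind a)) by apply flat_unwind.
  - intros (T & HT & Hid & Hax). exists T. split; auto. intros p Hs (G & HG & Hd).
    apply (completeness (fun q => q = Q)).
    + intros q ->. exact HQ.
    + now apply (translate_sentence (fin_sig A) SW T HT).
    + intros M E HE HM.
      assert (HMQ : forall s, derives [Q] s -> forall rho, satE M E rho s).
      { intros s Hds rho. apply (derives_sound M E HE _ _ Hds). intros q [<-|[]]. now apply HM. }
      apply (model_transfer (fin_sig A) SW T M E (FEq (TVar 0) (TVar 0))); auto.
      * split; reflexivity.
      * apply HMQ, Hid. now left.
      * intros q Hq. apply HMQ, Hid. now right.
      * intros K EK HK HKs rho. apply (derives_sound K EK HK _ _ Hd). intros a Ha.
        destruct (Hax a (HG a Ha)) as (b & Hb & _ & Hab & Hbd).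
        assert (Hi : satE K EK rho (FIff a b)).
        { apply (derives_sound K EK HK _ _ Hab). intros q []. }
        apply Hi. apply HKs; auto.
Qed.

(** * The sourced theory and the certified sentence *)

Section Source.
Variables (SW : signature) (tau : translation) (m : form).
Hypothesis Htau : wf_translation sig_ap SW tau.
Hypothesis Hpure : pure_delta0 m.
Hypothesis Hclosed : closed 1 m = true.

Definition source_ax (q : form) : Prop :=
  exists p, (R0p_axiom p \/ In p (id_axioms sig_ap)) /\ q = translate tau p.

Lemma source_sentence p : R0p_axiom p \/ In p (id_axioms sig_ap) -> sentence sig_ap p.
Proof. intros [H|H]; [now apply R0p_sentence|now apply id_axioms_sentence]. Qed.

(** Its existential closure is the totality axiom of the constant 0, an identity axiom, and serves
    as the existential sentence that [model_transfer] asks for. *)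
Let p0 : form := FEq (TFun 0 []) (TVar 0).

Let p0_in : In (FEx p0) (id_axioms sig_ap).
Proof. apply in_id_axioms. do 4 right. exists 0, 0. auto. Qed.

Lemma source_entails_certified : true_in_N (FEx m) ->
  entails source_ax (translate tau (certified_p m)).
Proof.
  intros Hm M E HE HM.
  assert (HM' : forall p, R0p_axiom p \/ In p (id_axioms sig_ap) ->
    forall rho, satE M E rho (translate tau p)).
  { intros p Hp. apply HM. exists p. auto. }
  apply (model_transfer sig_ap SW tau M E p0); auto.
  - split; reflexivity.
  - now apply certified_p_sentence.
  - intros K EK HK HKs rho. apply certified_true; auto. intros q Hq.
    apply HKs; auto. now apply R0p_sentence.
Qed.

Lemma tr_conj_list M E par l :
  satE M E par (tr_unwound tau 0 (unwind (conj_list l))) ->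
  forall q, In q l -> satE M E par (tr_unwound tau 0 (unwind q)).
Proof.
  induction l as [|p l IH]; [intros _ q []|]. intros [H1 H2] q [<-|Hq]; auto.
Qed.

(** The identity axioms are extracted first, from the leading conjunct, because only they make an
    internal model available in which [certified_false] can be applied. *)
Lemma certified_entails_source : ~ true_in_N (FEx m) ->
  forall q, source_ax q -> entails (fun p => p = translate tau (certified_p m)) q.
Proof.
  intros Hm q (p & Hp & ->) M E HE HM.
  assert (HMc := HM _ eq_refl).
  assert (Hcs : sentence sig_ap (certified_p m)) by now apply certified_p_sentence.
  assert (Hid : forall q, In q (id_axioms sig_ap) -> forall rho, satE M E rho (translate tau q)).
  { intros q Hq rho. specialize (HMc rho). apply (translate_sat sig_ap SW tau Htau) in HMc; auto.
    destruct HMc as [H1 H2]. apply (translate_sat sig_ap SW tau Htau).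
    - now apply id_axioms_sentence.
    - split; auto. intros par Hpar. apply H2 in Hpar as [Hpar _].
      exact (tr_conj_list M E par (id_axioms sig_ap) Hpar q Hq). }
  destruct Hp as [Hp|Hp]; [|now apply Hid].
  apply (model_transfer sig_ap SW tau M E p0); auto.
  - split; reflexivity.
  - now apply R0p_sentence.
  - intros K EK HK HKs rho. apply (certified_false K EK HK m rho); auto.
Qed.

End Source.

(** * The diagonal sentence *)

(** The number z enters through an equation and not by substitution into [psi], so the code of the
    sentence arises by pairing from the codes of [psi] and of the numeral. *)
Definition diag (psi : form) (z : nat) : form :=
  FEx (FEx (FAnd (FEq (TVar 1) (num z)) psi)).

(** A flat matrix is left alone by unwinding, so the unwound [lambda]_p is a fixed frame around it,
    and its code is computed from the code of the matrix by pairing. *)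
Lemma unwind_certified_p m : flat m = true -> unwind (certified_p m) =
  FAnd (unwind (conj_list (id_axioms sig_ap)))
       (FEx (FAnd (unwind cert) (FAnd m (unwind (all_le (TVar 0) (fP (TVar 0))))))).
Proof.
  intros Hm. unfold certified_p. cbn [unwind]. now rewrite (unwind_flat m Hm).
Qed.

Section Main.
(* The fixed formulas occurring in the program are kept abstract, so that no
   code number is ever evaluated. *)
Variables (c0 : code) (U1 U2 U3 I0 I1 I2 I3 : form).
Hypothesis HU : forall m, flat m = true ->
  unwind (certified_p m) = FAnd U1 (FEx (FAnd U2 (FAnd m U3))).
Hypothesis HI : [I0; I1; I2; I3] = [id_nonempty; id_refl; id_sym; id_trans].

(** The variables hold codes: x0 of [psi], x1 of the signature of W, x2 of its program, x3 of tau,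
    x4 and x5 of the two halves of the signature of A, x6 of the axioms of A. *)
Definition hinput : ht :=
  HPair x0 (HPair (HPair x1 x2) (HPair x3 (HPair (HPair x4 x5) x6))).

(** Self-reference happens in the first two premises: x7 is the numeral of the input itself, so the
    argument of [c0] is the code of lambda, and x8 is that of its matrix. Then x9 is the translated
    [lambda]_p, and x10 is a guessed translation, tested by the remaining premises. *)
Definition cl_main : clause :=
  (pMain hinput,
   [pNum hinput x7;
    pComp (HC (gn_code c0)) (hex (hex (hand (heq (hvar (HC 1)) x7) x0))) x8;
    pTrS x3 (hand (HC (gn_form U1)) (hex (hand (HC (gn_form U2)) (hand x8 (HC (gn_form U3)))))) x9;
    pWfTr (HPair x4 x5) x1 x10;
    pChk x9 x10 (HC (gn_form I0));
    pChk x9 x10 (HC (gn_form I1));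
    pChk x9 x10 (HC (gn_form I2));
    pChk x9 x10 (HC (gn_form I3));
    pChkRel x9 x10 (HC 0) x5;
    pChkFun x9 x10 (HC 0) x4;
    pChkAx x9 x10 (HPair x4 x5) x6]).

Definition program : list clause := cl_base ++ [cl_main].

Lemma program_bound : forallb (clause_bound 12) program = true.
Proof. reflexivity. Qed.

Definition input (psi : form) (SW : signature) (ge : nat) (tau : translation) (A : fin_theory) : nat :=
  cpair (gn_form psi) (cpair (cpair (gn_sig SW) ge) (cpair (gn_translation tau) (gn_fin_theory A))).

(** The result r is a bare number here, as nothing forces the values of [c0] to be codes; the claim
    about [lambda]_p is conditional on r being the code of a flat formula. *)
Definition mMain (z : nat) : Prop := forall psi SW ge tau A,
  z = input psi SW ge tau A ->
  exists r, computes c0 (gn_form (diag psi z)) r /\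
    forall m, r = gn_form m -> flat m = true ->
      exists T, wf_translation (fin_sig A) SW T /\
        interp_check (translate tau (certified_p m)) T A.

Lemma translate_certified T m : flat m = true ->
  translate T (FAnd U1 (FEx (FAnd U2 (FAnd m U3)))) = translate T (certified_p m).
Proof.
  intros Hm. rewrite <- (HU m Hm). unfold translate.
  now rewrite (unwind_flat (unwind _)) by apply flat_unwind.
Qed.

Lemma gn_diag psi z : gn_form (diag psi z) =
  cpair 7 (cpair 7 (cpair 3 (cpair (cpair 1 (cpair (cpair 0 1) (gn_tm (num z)))) (gn_form psi)))).
Proof. unfold diag. cbn [gn_form gn_tm]. reflexivity. Qed.

Lemma program_sound z : horn program [0; z] -> mMain z.
Proof.
  apply (horn_meaning mMain program [0; z]). apply Forall_app. split; [apply cl_base_sound|].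
  constructor; [|constructor]. intros e. cbn.
  intros H1 H2 H3 H4 H5 H6 H7 H8 H9 H10 H11 psi SW ge tau A Hz.
  set (z0 := cpair (e 0) _) in *. unfold input, gn_fin_theory in Hz.
  assert (Hin : e 0 = gn_form psi /\ e 1 = gn_sig SW /\ e 3 = gn_translation tau /\
    cpair (e 4) (e 5) = gn_sig (fin_sig A) /\ e 6 = gnl (fin_ax A)).
  { unfold z0 in Hz. apply cpair_inj in Hz as [h1 Hz]. apply cpair_inj in Hz as [h2 Hz].
    apply cpair_inj in h2 as [h2 _]. apply cpair_inj in Hz as [h3 Hz].
    apply cpair_inj in Hz as [h4 h5]. auto. }
  destruct Hin as (E0 & E1 & E3 & E45 & E6).
  assert (Efun : e 4 = gn_list (fun_ar (fin_sig A)) /\ e 5 = gn_list (rel_ar (fin_sig A)))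
    by (apply cpair_inj; exact E45).
  destruct Efun as [E4 E5].
  exists (e 8). split.
  - rewrite gn_diag, <- E0, <- H1. now apply H2.
  - intros m Hm Hf.
    destruct (H3 tau E3) as (p & Hp & _ & HQ).
    rewrite Hm in Hp.
    change (gn_form (FAnd U1 (FEx (FAnd U2 (FAnd m U3)))) = gn_form p) in Hp.
    apply gn_form_inj in Hp. subst p. rewrite (translate_certified tau m Hf) in HQ.
    destruct (H4 (fin_sig A) SW E45 E1) as (T & ET & HT).
    exists T. split; auto. split.
    + assert (Hchk : forall i q, i = gn_form q -> mChk (e 9) (e 10) i ->
        derives [translate tau (certified_p m)] (translate T q)).
      { intros i q -> H. destruct (H _ T HQ ET) as (p & Hp & _ & Hd).
        apply gn_form_inj in Hp. now subst p. }
      injection HI as J0 J1 J2 J3.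
      intros q [<-|Hq]; [rewrite <- J0; exact (Hchk _ I0 eq_refl H5)|].
      apply in_id_axioms in Hq as [->|[->|[->|[(r & n & Hn & ->)|(f & n & Hn & Hq)]]]].
      * rewrite <- J1. exact (Hchk _ I1 eq_refl H6).
      * rewrite <- J2. exact (Hchk _ I2 eq_refl H7).
      * rewrite <- J3. exact (Hchk _ I3 eq_refl H8).
      * exact (H9 _ T _ HQ ET E5 r n Hn).
      * destruct (H10 _ T _ HQ ET E4 f n Hn) as (h1 & h2 & h3).
        destruct Hq as [->|[->| ->]]; auto.
    + exact (H11 _ T (fin_sig A) _ HQ ET E45 E6).
Qed.

Lemma program_complete psi SW ge tau A m : let z := input psi SW ge tau A in
  computes c0 (gn_form (diag psi z)) (gn_form m) -> flat m = true ->
  wf_translation sig_ap SW tau -> sentence sig_ap (certified_p m) ->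
  (exists T, wf_translation (fin_sig A) SW T /\
        interp_check (translate tau (certified_p m)) T A) ->
  horn program [0; z].
Proof.
  intros z Hc Hf Htau Hw (T & HT & Hid & Hax). injection HI as J0 J1 J2 J3.
  assert (Hb : incl cl_base program) by apply incl_appl, incl_refl.
  remember (gn_form (translate tau (certified_p m))) as gQ eqn:HgQ.
  set (e := fun i => nth i [gn_form psi; gn_sig SW; ge; gn_translation tau;
    gn_list (fun_ar (fin_sig A)); gn_list (rel_ar (fin_sig A)); gnl (fin_ax A);
    gn_tm (num z); gn_form m; gQ; gn_translation T] 0).
  assert (Hcl : clause_holds (horn program) e cl_main).
  { apply clause_holds_iff, horn_rule. apply in_or_app. right. now left. }
  assert (Hok : forall q, In q (id_nonempty :: id_axioms (fin_sig A)) ->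
    chk_ok (fin_sig A) T (translate tau (certified_p m)) q).
  { intros q Hq. split; [|split].
    - destruct Hq as [<-|Hq]; [reflexivity|eapply id_axioms_flat; eauto].
    - destruct Hq as [<-|Hq]; [reflexivity|now apply id_axioms_sentence].
    - now apply Hid. }
  assert (Hok' : forall q, In q (id_axioms (fin_sig A)) ->
    chk_ok (fin_sig A) T (translate tau (certified_p m)) q) by (intros; apply Hok; now right).
  unfold clause_holds, cl_main in Hcl. cbn in Hcl.
  change (cpair (gn_list (fun_ar (fin_sig A))) (gn_list (rel_ar (fin_sig A)))) with
    (gn_sig (fin_sig A)) in Hcl.
  change (cpair (gn_sig (fin_sig A)) (gn_list (map gn_form (fin_ax A)))) with
    (gn_fin_theory A) in Hcl.
  change (cpair (gn_form psi) _) with z in Hcl.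
  rewrite HgQ in Hcl. clear HgQ. apply Hcl; clear Hcl.
  - now apply horn_num.
  - rewrite <- gn_diag. now apply horn_comp.
  - rewrite <- (translate_certified tau m Hf).
    change (cpair 3 _) with (gn_form (FAnd U1 (FEx (FAnd U2 (FAnd m U3))))).
    apply (horn_trS _ Hb sig_ap SW); auto; rewrite <- (HU m Hf); [apply flat_unwind|].
    now apply unwind_formula_in with (k := 0).
  - now apply horn_wfTr.
  - eapply horn_chk; eauto. rewrite J0. apply Hok. now left.
  - eapply horn_chk; eauto. rewrite J1. apply Hok', in_id_axioms. auto.
  - eapply horn_chk; eauto. rewrite J2. apply Hok', in_id_axioms. auto.
  - eapply horn_chk; eauto. rewrite J3. apply Hok', in_id_axioms. auto.
  - eapply horn_chkRel; eauto. intros i n Hn. apply Hok', in_id_axioms. do 3 right. left. eauto.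
  - eapply horn_chkFun; eauto. intros i n Hn.
    repeat split; apply Hok', in_id_axioms; do 4 right; exists i, n; auto.
  - eapply horn_chkAx; eauto.
Qed.
End Main.

(** The program is sound for some value of [c0] at lambda; uniqueness identifies this value with the
    code of the matrix. *)
Lemma computes_functional c n r : computes c n r -> forall r', computes c n r' -> r = r'.
Proof.
  revert c n r.
  apply (computes_nested_ind (fun c n r => forall r', computes c n r' -> r = r')).
  - intros n r' H. now inversion H.
  - intros n r' H. now inversion H.
  - intros a b r' H. inversion H as [| |a' b' h1 h2 h3| | | | | |]. apply cpair_inj in h2 as [? ?]. congruence.
  - intros a b r' H. inversion H as [| | |a' b' h1 h2 h3| | | | |]. apply cpair_inj in h2 as [? ?]. congruence.
  - intros c d n a b Hc Hd r' H. inversion H; subst. f_equal; auto.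
  - intros c d n m k Hd Hc r' H. inversion H as [| | | | |c' d' n' m' k' h1 h2| | |]; subst.
    apply Hd in h1. subst. auto.
  - intros c d a r Hc r' H. remember (cpair a 0) as x eqn:Hx. revert Hx.
    inversion H as [| | | | | |c' d' a' r0 h1 h2 h3 h4|c' d' a' n' i' r0 h1 h2 h3 h4 h5|];
      intros Hx; apply cpair_inj in Hx as [-> Hx]; [auto|discriminate].
  - intros c d a n i r Hc Hd r' H. remember (cpair a (S n)) as x eqn:Hx. revert Hx.
    inversion H as [| | | | | |c' d' a' r0 h1 h2 h3 h4|c' d' a' n' i' r0 h1 h2 h3 h4 h5|];
      intros Hx; apply cpair_inj in Hx as [-> Hx]; [discriminate|].
    injection Hx as ->. apply Hc in h1. subst. auto.
  - intros c a n H0 Hpos r' H. inversion H as [| | | | | | | |c' a' n' h1 h2]; subst.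
    (* The smaller of two results would be a zero of the searched function and also one of its
       positive places. *)
    destruct (Nat.lt_trichotomy n r') as [Hlt|[->|Hlt]]; auto; exfalso.
    + destruct (h2 n Hlt) as [k Hk]. apply H0 in Hk. discriminate.
    + destruct (Hpos r' Hlt) as [k Hk]. apply Hk in h1. discriminate.
Qed.

Lemma diag_true psi z : true_in_N (diag psi z) <->
  exists b, satN (scons b (scons z (fun _ => 0))) psi.
Proof.
  unfold true_in_N, diag. cbn [sat eval scons]. split.
  - intros (v & b & Hv & H). rewrite evalN_num in Hv. subst v. eauto.
  - intros (b & H). exists z, b. rewrite evalN_num. auto.
Qed.

Lemma diag_sigma1 psi z : d0_in 2 psi -> sigma1_sentence (diag psi z).
Proof.
  intros [[Hw Hc] Hd]. destruct (num_closed_wf z sig_a 2 eq_refl eq_refl) as [h1 h2].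
  split; [split|].
  - cbn. now rewrite h1, Hw.
  - cbn. now rewrite h2, Hc.
  - apply S1_ex, S1_ex, S1_delta0. repeat constructor. exact Hd.
Qed.

(** One formula serves all inputs, because signature, translation and theory are part of the number
    z. This uniformity is what makes lambda effectively computable from the data. *)
Theorem diagonal_formula c0 : exists psi, d0_in 2 psi /\ forall SW ge tau A m,
  computes c0 (gn_form (diag psi (input psi SW ge tau A))) (gn_form m) ->
  pure_delta0 m -> closed 1 m = true -> wf_translation sig_ap SW tau -> wf_fin_theory A ->
  (true_in_N (diag psi (input psi SW ge tau A)) <->
   interprets (Theory SW (fun q => q = translate tau (certified_p m))) A).
Proof.
  assert (HI : exists I0 I1 I2 I3, [I0; I1; I2; I3] = [id_nonempty; id_refl; id_sym; id_trans])
    by (do 4 eexists; reflexivity).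
  destruct HI as (I0 & I1 & I2 & I3 & HI).
  assert (HU : exists U1 U2 U3, forall m, flat m = true ->
    unwind (certified_p m) = FAnd U1 (FEx (FAnd U2 (FAnd m U3))))
    by (do 3 eexists; exact unwind_certified_p).
  destruct HU as (U1 & U2 & U3 & HU).
  set (P := program c0 U1 U2 U3 I0 I1 I2 I3).
  assert (Hb : forallb (clause_bound 12) P = true) by apply program_bound.
  assert (Hpsi : exists psi, psi = fprogram 12 P) by (eexists; reflexivity).
  destruct Hpsi as [psi Hpsi]. exists psi.
  split; [rewrite Hpsi; now apply d0_fprogram|].
  assert (Hsem : forall z rho, (exists b, satN (scons b (scons z rho)) psi) <-> horn P [0; z])
    by (rewrite Hpsi; now apply horn_sigma1).
  clear Hpsi.
  intros SW ge tau A m Hc Hm Hcl Htau HA.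
  assert (Hs : sentence sig_ap (certified_p m)) by now apply certified_p_sentence.
  assert (Hf : flat m = true) by now apply pure_flat.
  rewrite diag_true, interprets_iff_check; auto.
  2: { now apply (translate_sentence sig_ap SW tau). }
  rewrite Hsem. split.
  - intros H. eapply program_sound in H; eauto.
    destruct (H psi SW ge tau A eq_refl) as (r & Hr & Hr').
    apply Hr'; auto. eapply computes_functional; eauto.
  - intros H. eapply program_complete; eauto.
Qed.

(** * A program that computes the diagonal sentence *)

Fixpoint cconst (n : nat) : code :=
  match n with 0 => CZero | S n => CComp CSucc (cconst n) end.

Lemma computes_const n x : computes (cconst n) x n.
Proof. induction n; cbn; econstructor; eauto. constructor. Qed.

(** Identity is not a basic function, but pairing the two projections gives it, as every number is a
    pair. *)
Lemma computes_id n : computes (CPair CFst CSnd) n n.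
Proof.
  assert (H : n = cpair (fst (Cantor.of_nat n)) (snd (Cantor.of_nat n))).
  { unfold cpair. rewrite <- surjective_pairing. now rewrite Cantor.cancel_to_of. }
  rewrite H. repeat constructor.
Qed.

(** Primitive recursion with the dummy parameter 0. The base value is the code of [tzero]; the step
    finds the previous value in the second component of the second component and wraps it as a
    one-element argument list. *)
Definition cnum : code :=
  CComp (CPrec (CPair (cconst 1) (CPair CZero CZero))
               (CPair (cconst 1) (CPair (cconst 1)
                  (CComp CSucc (CPair (CComp CSnd CSnd) CZero)))))
        (CPair CZero (CPair CFst CSnd)).

Lemma computes_num n : computes cnum n (gn_tm (num n)).
Proof.
  unfold cnum. econstructor; [constructor; [constructor|apply computes_id]|].
  induction n as [|n IH].
  - constructor. change (gn_tm (num 0)) with (cpair 1 (cpair 0 0)).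
    constructor; [apply computes_const|repeat constructor].
  - econstructor; [exact IH|].
    change (gn_tm (num (S n))) with (cpair 1 (cpair 1 (S (cpair (gn_tm (num n)) 0)))).
    constructor; [apply computes_const|]. constructor; [apply computes_const|].
    econstructor; [|constructor]. constructor; [|constructor].
    econstructor; constructor.
Qed.

(** Mirrors [gn_diag]. The number k plays two parts: it is the code of the subformula [psi] and the
    first component of the number whose numeral is formed. *)
Definition cdiag (k : nat) : code :=
  CPair (cconst 7) (CPair (cconst 7) (CPair (cconst 3)
    (CPair (CPair (cconst 1) (CPair (CPair CZero (cconst 1))
              (CComp cnum (CPair (cconst k) (CPair CFst CSnd)))))
           (cconst k)))).

Lemma computes_diag psi k x : k = gn_form psi ->
  computes (cdiag k) x (gn_form (diag psi (cpair k x))).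
Proof.
  intros Hk. rewrite gn_diag, <- Hk. unfold cdiag.
  repeat first [apply computes_const | apply ev_pair | apply ev_zero].
  apply ev_comp with (cpair k x); [|apply computes_num].
  apply ev_pair; [apply computes_const|apply computes_id].
Qed.

Theorem theorem8p3 (lam0 : form -> form) (Hlam0 : bullet_matrix lam0) :
  exists c : code,
    forall (W : theory) (i : nat) (tau : translation) (A : fin_theory),
      wf_theory W -> ce_index i W -> R0p_sourced tau W -> wf_fin_theory A ->
      exists lam : form,
        computes c (cpair i (cpair (gn_translation tau) (gn_fin_theory A)))
                   (gn_form lam) /\
        sigma1_sentence lam /\
        (true_in_N lam <->
           interprets
             (Theory (th_sig W) (fun q => q = translate tau (certified_p (lam0 lam))))
             A) /\
        (true_in_N lam <-> interprets W A).
Proof.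
  destruct Hlam0 as [[c0 Hc0] Hspec].
  destruct (diagonal_formula c0) as (psi & Hpsi & Hdiag).
  assert (Hk : exists k, k = gn_form psi) by eauto. destruct Hk as [k Hk].
  exists (cdiag k). intros W i tau A HW (e & -> & _) (Htau & _ & Hded) HA.
  (* An index of W is the pair of its signature code and a program code, so this number is the pair
     of k and the argument given to [cdiag k]. *)
  set (z := input psi (th_sig W) (gn_code e) tau A).
  exists (diag psi z). set (lam := diag psi z).
  assert (Hlam : sigma1_sentence lam) by now apply diag_sigma1.
  destruct (Hspec lam Hlam) as (Hpure & Hclosed & Htrue & _).
  assert (Hii : true_in_N lam <-> interprets
     (Theory (th_sig W) (fun q => q = translate tau (certified_p (lam0 lam)))) A).
  { apply Hdiag; auto. }
  split; [|split; [exact Hlam|split; [exact Hii|]]].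
  { unfold lam, z, input. rewrite <- Hk. now apply computes_diag. }
  assert (Hcs : sentence sig_ap (certified_p (lam0 lam))) by now apply certified_p_sentence.
  assert (Hts := translate_sentence sig_ap (th_sig W) tau Htau _ Hcs).
  assert (Hsc : forall q, source_ax tau q -> closed 0 q = true).
  { intros q (p & Hp & ->).
    apply (translate_sentence sig_ap (th_sig W) tau Htau), source_sentence, Hp. }
  split.
  (* Once W proves the translated [lambda]_p, cut lets the same translation interpret A in W. *)
  - intros Ht. assert (Hw : proves W (translate tau (certified_p (lam0 lam)))).
    { apply (Hded _ Hts). apply completeness; [exact Hsc|apply Hts|].
      apply (source_entails_certified (th_sig W)); auto. now apply Htrue. }
    destruct Hw as (G & HG & Hd).
    apply Hii in Ht as (T & HT & Hint). exists T. split; auto.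
    intros p Hs Hp. destruct (Hint p Hs Hp) as (G' & HG' & Hd').
    exists G. split; auto. apply derives_cut with G'; auto.
    intros q Hq. now rewrite (HG' q Hq).
  - intros (T & HT & Hint). apply NNPP. intros Hn. apply Hn, Hii.
    exists T. split; auto. intros p Hs Hp.
    assert (Hts' := translate_sentence _ _ T HT p Hs).
    (* Deductive equivalence replaces the axioms of W by translated axioms of the source, the only
       ones about which [certified_entails_source] speaks. *)
    apply (Hded _ Hts') in Hint as (G & HG & Hd); auto.
    apply completeness; [intros q ->; apply Hts|apply Hts'|].
    intros M E HE HM rho. apply (derives_sound M E HE _ _ Hd). intros q Hq.
    apply (certified_entails_source (th_sig W) tau (lam0 lam) Htau Hpure Hclosed
      ltac:(rewrite <- Htrue; exact Hn) q (HG q Hq) M E HE HM).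
Qed.
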